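(* Let $\{Y_j\}_{j\in\mathbb{Z}}$ satisfy the usual conditions (see context) with index $\alpha\in(0,2)$ and slowly varying function $h$, and let $\{c_j\}_{j\in\mathbb{Z}}$ be real numbers with $\sum_{j}|c_j|<+\infty$ and $\sum_{j}|c_j|^{\alpha}h(|c_j|^{-1})<+\infty$, so that $X_i=\sum_{j\in\mathbb{Z}}c_jY_{i-j}$, $i\in\mathbb{Z}$, converges almost surely. Put $A=\sum_j c_j$, $S_n(t)=\frac{1}{a_n}\sum_{i=1}^{[nt]}X_i$, and $d_{n,j}=\sum_{k=1-j}^{n-j}c_k$ for $n\in\mathbb{N}$, $j\in\mathbb{Z}$. Then the finite dimensional distributions of $(S_n(t))_{t\in[0,1]}$ converge to those of $(A\cdot Z(t))_{t\in[0,1]}$ if, and only if, \[\sum_{j=-\infty}^{0}\frac{|d_{n,j}|^{\alpha}}{a_n^{\alpha}}h\Big(\frac{a_n}{|d_{n,j}|}\Big)\to 0\quad\text{and}\quad \sum_{j=n+1}^{\infty}\frac{|d_{n,j}|^{\alpha}}{a_n^{\alpha}}h\Big(\frac{a_n}{|d_{n,j}|}\Big)\to 0,\qquad n\to\infty.\]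
   Context: Usual conditions: $\{Y_j\}_{j\in\mathbb{Z}}$ are i.i.d.; there exist $\alpha\in(0,2)$ and a function $h$ slowly varying at $+\infty$ with $P(|Y_1|>x)=x^{-\alpha}h(x)$ for $x>0$; the limits $\lim_{x\to\infty}P(Y_1>x)/P(|Y_1|>x)=p$ and $\lim_{x\to\infty}P(Y_1<-x)/P(|Y_1|>x)=q$ exist with $p+q=1$; $E Y_1=0$ if $\alpha>1$; $Y_1$ is symmetric if $\alpha=1$. The norming constants $a_n>0$ satisfy $nP(|Y_1|>a_n)\to C$ for some constant $C>0$; then $a_n^{-1}\sum_{i=1}^nY_i$ converges in distribution to a non-degenerate strictly $\alpha$-stable random variable $Z$, and $(Z(t))_{t\ge0}$ denotes the $\alpha$-stable Lévy motion with $Z(1)\overset{d}{=}Z$. Terms of the form $|c|^{\alpha}h(1/|c|)$ (and similarly with $d_{n,j}$) are interpreted as $0$ when $c=0$. *)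

(* Defs.v *)
From HB Require Import structures.
From mathcomp Require Import all_boot all_order all_algebra.
From mathcomp Require Import all_classical all_reals all_analysis.
Set Implicit Arguments. Unset Strict Implicit. Unset Printing Implicit Defensive.
Import Order.TTheory GRing.Theory Num.Theory.
Import numFieldNormedType.Exports.
Local Open Scope classical_set_scope.
Local Open Scope ring_scope.

Section Defs.
Context {R : realType}.

Definition mutually_independent {d} {Omega : measurableType d}
  (P : probability Omega R) {I : eqType} (X : I -> Omega -> R) : Prop :=
  forall (s : seq I) (B : I -> set R), uniq s -> (forall i, measurable (B i)) ->
    P (\bigcap_(i in [set` s]) (X i @^-1` B i)) =
    (\prod_(i <- s) P (X i @^-1` B i))%E.

Definition iid {d} {Omega : measurableType d} (P : probability Omega R)
  (Y : int -> Omega -> R) : Prop :=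
  mutually_independent P Y /\
  forall (j : int) (B : set R), measurable B ->
    P (Y j @^-1` B) = P (Y 0 @^-1` B).

Definition slowly_varying (h : R -> R) : Prop :=
  measurable_fun [set x : R | 0 < x] h /\
  (\forall x \near +oo, 0 < h x) /\
  forall lam : R, 0 < lam -> h (lam * x) / h x @[x --> +oo] --> (1 : R).

Definition cvg_in_dist {d d'} {Omega : measurableType d}
  {Omega' : measurableType d'} (P : probability Omega R)
  (Q : probability Omega' R) {T : topologicalType}
  (X : nat -> Omega -> T) (L : Omega' -> T) : Prop :=
  forall f : T -> R, continuous f -> (exists M : R, forall x, `|f x| <= M) ->
    (fun n => (\int[P]_w (f (X n w))%:E)%E) @ \oo --> (\int[Q]_w (f (L w))%:E)%E.

Definition levy_process {d} {Omega : measurableType d}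
  (Q : probability Omega R) (Z : R -> Omega -> R) : Prop :=
  [/\ Q [set w | Z 0 w = 0] = 1%E,
      (forall (k : nat) (t : 'I_k.+1 -> R),
          0 <= t ord0 -> (forall i : 'I_k, t (widen_ord (leqnSn k) i) < t (lift ord0 i)) ->
          mutually_independent Q
            (fun i : 'I_k => fun w => Z (t (lift ord0 i)) w - Z (t (widen_ord (leqnSn k) i)) w)),
      (forall (s t : R) (B : set R), 0 <= s -> s <= t -> measurable B ->
          Q [set w | Z t w - Z s w \in B] = Q [set w | Z (t - s) w \in B]) &
      (forall s : R, 0 <= s -> forall eps eta : R, 0 < eps -> 0 < eta ->
          exists2 delta : R, 0 < delta & forall t : R, 0 <= t -> `|t - s| < delta ->
            (Q [set w | (eps < `|Z t w - Z s w|)%R] < eta%:E)%E)].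

Definition symsum (u : int -> R) (N : nat) : R :=
  \sum_(0 <= k < (N + N).+1) u (k%:Z - N%:Z).

Definition sumZ (u : int -> R) : R := limn (symsum u).

Definition linproc {Omega : Type} (c : int -> R) (Y : int -> Omega -> R)
  (i : int) (w : Omega) : R :=
  limn (symsum (fun j => c j * Y (i - j) w)).

Definition Sn {Omega : Type} (a : nat -> R) (X : int -> Omega -> R)
  (n : nat) (t : R) (w : Omega) : R :=
  (a n)^-1 * \sum_(1 <= i < (Num.truncn (n%:R * t)).+1) X i%:Z w.

Definition dnj (c : int -> R) (n : nat) (j : int) : R :=
  \sum_(1 <= m < n.+1) c (m%:Z - j).

Definition regvar_term (alpha : R) (h : R -> R) (x : R) : R :=
  if x == 0 then 0 else `|x| `^ alpha * h (`|x|^-1).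

Definition dterm (alpha : R) (h : R -> R) (a d : R) : R :=
  if d == 0 then 0 else `|d| `^ alpha / a `^ alpha * h (a / `|d|).

End Defs.

(* Main.v *)
(* Write T(b) = P(|b Y_1| > 1), which is |b|^alpha h(1/|b|) for b != 0, and
   V_n(t) = a_n^-1 (Y_1 + ... + Y_[nt]).

   V_n converges to Z in the sense of finite dimensional distributions: if z_n and
   b_n are the characteristic functions of Y_1 / a_n and Z(1/n), then z_n(u)^n tends
   to phi(u) = b_n(u)^n, and the equicontinuity in u of the powers of z_n and b_n of
   exponent at most n improves this to n |z_n(u) - b_n(u)| -> 0.

   Truncation and Karamata's bounds on truncated moments give
   P(|sum_j b_j Y_j| > 1) <= K sum_j T(b_j) for small b_j. With m = [nt],
   S_n(t) - A V_n(t) is a_n^-1 sum_k (d_{m,k} - A 1_{1 <= k <= m}) Y_k. The part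
   1 <= k <= m always vanishes in probability, because d_{m,k} is close to A away
   from the two ends; the other part vanishes if the two outer sums do. This gives
   sufficiency, by Levy's continuity theorem.

   Conversely |E exp(i S_n(1))| is at most the product over 1 <= k <= n of the
   |phi_Y(d_{n,k} / a_n)| times any finite product of such factors with k outside
   [1, n]. The first product has the same nonzero limit as |E exp(i S_n(1))|, so the
   outer products tend to 1 uniformly, and |phi_Y(b)| <= 1 - kappa T(b) for small b
   turns this into the convergence of the outer sums. *)
Require Import Defs.
From HB Require Import structures.
From mathcomp Require Import all_boot all_order all_algebra.
From mathcomp Require Import all_classical all_reals all_analysis.
From mathcomp Require Import measurable_realfun.
From mathcomp.real_closed Require Import complex.
From mathcomp Require Import ring lra zify.
Set Implicit Arguments.
Unset Strict Implicit.
Unset Printing Implicit Defensive.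
Import Order.TTheory GRing.Theory Num.Theory.
Import numFieldNormedType.Exports.
Local Open Scope classical_set_scope.
Local Open Scope ring_scope.

(** Recovering z_n from z_n^n means choosing an n-th root. No complex logarithm is used: the branch
    is followed from u = 0, where z_n and b_n are both 1, and this is what the smallness and
    equicontinuity of the powers are for. The rate n |z_n - b_n| -> 0 is the form that survives
    products of n factors, because two products of numbers of modulus at most 1 differ by at most
    the sum of the differences of the factors. T is the natural unit of size: the truncated mean and
    second moment of b Y_1 are both O(T(b)), and T(l b) is O(T(b)) for fixed l. For sufficiency at
    time t the outer sums are known at index m with scale a_m, whereas S_n(t) carries the scale a_n;
    the bound a_m <= 2 a_n for large m <= n closes this gap. The converse divides by the limit of
    the middle product, which is allowed because the characteristic function of Z(1), an n-th power
    of a number close to 1, has no zero. *)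

(** * Real-valued expectations and probabilities *)

Section BoundedExpectation.
Context {R : realType} {d} {T : measurableType d} (P : probability T R).
Implicit Types (f g : T -> R) (A B : set T).

(** On a probability space these functions are integrable, so expectations can be real numbers that
    are linear and monotone without further side conditions. Apart from the centering condition E
    Y_1 = 0, everything integrated below is bounded: cosines, sines, indicators, truncations,
    minima. *)
Definition bounded_mfun f := measurable_fun setT f /\ exists M : R, forall x, `|f x| <= M.

Definition Ex f : R := fine (\int[P]_x (f x)%:E)%E.

Definition pr A : R := fine (P A).

Lemma bounded_mfunW f (M : R) : measurable_fun setT f -> (forall x, `|f x| <= M) -> bounded_mfun f.
Proof. by move=> mf fM; split=> //; exists M. Qed.

Lemma bounded_mfun_measurable f : bounded_mfun f -> measurable_fun setT f.
Proof. by case. Qed.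

Lemma bounded_mfun_integrable f : bounded_mfun f -> P.-integrable setT (EFin \o f).
Proof.
move=> [mf [M fM]]; apply: measurable_bounded_integrable => //.
  exact: fin_num_fun_lty.
exists M; split; first exact: num_real. move=> y My x _; apply: le_trans (fM x) _; exact: ltW.
Qed.

Lemma EFin_Ex f : bounded_mfun f -> (\int[P]_x (f x)%:E)%E = (Ex f)%:E.
Proof.
move=> /bounded_mfun_integrable bf.
by rewrite /Ex fineK//; exact: integrable_fin_num.
Qed.

Lemma bounded_mfun_cst (c : R) : bounded_mfun (fun _ => c).
Proof. by apply: (@bounded_mfunW _ `|c|) => //; exact: measurable_cst. Qed.

Lemma bounded_mfunD f g : bounded_mfun f -> bounded_mfun g -> bounded_mfun (fun x => f x + g x).
Proof.
move=> [mf [M fM]] [mg [N gN]]; apply: (@bounded_mfunW _ (M + N)).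
  exact: measurable_funD.
by move=> x; rewrite (le_trans (ler_normD _ _))// lerD.
Qed.

Lemma bounded_mfunM f g : bounded_mfun f -> bounded_mfun g -> bounded_mfun (fun x => f x * g x).
Proof.
move=> [mf [M fM]] [mg [N gN]]; apply: (@bounded_mfunW _ (M * N)).
  exact: measurable_funM.
by move=> x; rewrite normrM ler_pM.
Qed.

Lemma bounded_mfunZ (c : R) f : bounded_mfun f -> bounded_mfun (fun x => c * f x).
Proof. by move=> bf; apply: bounded_mfunM => //; exact: bounded_mfun_cst. Qed.

Lemma bounded_mfunB f g : bounded_mfun f -> bounded_mfun g -> bounded_mfun (fun x => f x - g x).
Proof.
move=> bf bg; have := bounded_mfunD bf (bounded_mfunZ (-1) bg).
by congr bounded_mfun; apply/funext => x; rewrite mulN1r.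
Qed.

Lemma bounded_mfun_abs f : bounded_mfun f -> bounded_mfun (fun x => `|f x|).
Proof.
move=> [mf [M fM]]; apply: (@bounded_mfunW _ M); last by move=> x; rewrite normr_id.
exact: measurableT_comp.
Qed.

Lemma bounded_mfun_sum I (s : seq I) (F : I -> T -> R) :
  (forall i, bounded_mfun (F i)) -> bounded_mfun (fun x => \sum_(i <- s) F i x).
Proof.
move=> bF; elim: s => [|i s IH].
  rewrite (_ : (fun _ => _) = fun _ => 0); first exact: bounded_mfun_cst.
  by apply/funext => x; rewrite big_nil.
rewrite (_ : (fun _ => _) = fun x => F i x + \sum_(j <- s) F j x).
  exact: bounded_mfunD.
by apply/funext => x; rewrite big_cons.
Qed.

Lemma bounded_mfun_indic A : measurable A -> bounded_mfun (\1_A).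
Proof.
move=> mA; apply: (@bounded_mfunW _ 1); first exact: measurable_indic.
by move=> x; rewrite indicE; case: (_ \in _); rewrite ?normr1 ?normr0.
Qed.

Lemma bounded_mfun_cos f : measurable_fun setT f -> bounded_mfun (fun x => cos (f x)).
Proof.
move=> mf; apply: (@bounded_mfunW _ 1); last by move=> x; rewrite ler_norml cos_geN1 cos_le1.
apply: (measurableT_comp (f := @cos R)) => //.
by apply: continuous_measurable_fun; exact: continuous_cos.
Qed.

Lemma bounded_mfun_sin f : measurable_fun setT f -> bounded_mfun (fun x => sin (f x)).
Proof.
move=> mf; apply: (@bounded_mfunW _ 1); last by move=> x; rewrite ler_norml sin_geN1 sin_le1.
apply: (measurableT_comp (f := @sin R)) => //.
by apply: continuous_measurable_fun; exact: continuous_sin.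
Qed.

Lemma bounded_mfun_min f (c : R) : 0 <= c -> measurable_fun setT f ->
  bounded_mfun (fun x => Num.min c `|f x|).
Proof.
move=> c0 mf; apply: (@bounded_mfunW _ c).
  apply: (measurable_minr (f := fun=> c)); first exact: measurable_cst.
  exact: measurableT_comp.
by move=> x; rewrite ger0_norm ?le_min ?c0//= ge_min lexx.
Qed.

Lemma Ex_cst (c : R) : Ex (fun _ => c) = c.
Proof. rewrite /Ex integral_cst//. by rewrite [X in (_ * X)%E]probability_setT mule1. Qed.

Lemma ExD f g : bounded_mfun f -> bounded_mfun g -> Ex (fun x => f x + g x) = Ex f + Ex g.
Proof. by move=> bf bg; apply: RintegralD => //; exact: bounded_mfun_integrable. Qed.

Lemma ExB f g : bounded_mfun f -> bounded_mfun g -> Ex (fun x => f x - g x) = Ex f - Ex g.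
Proof. by move=> bf bg; apply: RintegralB => //; exact: bounded_mfun_integrable. Qed.

Lemma ExZ (c : R) f : bounded_mfun f -> Ex (fun x => c * f x) = c * Ex f.
Proof. by move=> bf; apply: RintegralZl => //; exact: bounded_mfun_integrable. Qed.

Lemma Ex_sum I (s : seq I) (F : I -> T -> R) : (forall i, bounded_mfun (F i)) ->
  Ex (fun x => \sum_(i <- s) F i x) = \sum_(i <- s) Ex (F i).
Proof.
move=> bF; elim: s => [|i s IH].
  rewrite big_nil -[RHS](Ex_cst 0); congr Ex.
  by apply/funext => x; rewrite big_nil.
rewrite big_cons -IH -ExD//; last exact: bounded_mfun_sum.
by congr Ex; apply/funext => x; rewrite big_cons.
Qed.

Lemma Ex_ge0 f : (forall x, 0 <= f x) -> 0 <= Ex f.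
Proof. by move=> f0; apply: Rintegral_ge0. Qed.

Lemma le_Ex f g : bounded_mfun f -> bounded_mfun g -> (forall x, f x <= g x) -> Ex f <= Ex g.
Proof.
by move=> bf bg fg; apply: le_Rintegral => //; exact: bounded_mfun_integrable.
Qed.

Lemma norm_Ex f : bounded_mfun f -> `|Ex f| <= Ex (fun x => `|f x|).
Proof.
by move=> bf; apply: le_normr_Rintegral => //; exact: bounded_mfun_integrable.
Qed.

Lemma Ex_indic A : measurable A -> Ex (\1_A) = pr A.
Proof. by move=> mA; rewrite /Ex integral_indic// setIT. Qed.

Lemma EFin_pr A : measurable A -> P A = (pr A)%:E.
Proof. by move=> mA; rewrite /pr fineK// fin_num_measure. Qed.

Lemma pr_ge0 A : 0 <= pr A.
Proof. by rewrite /pr fine_ge0. Qed.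

Lemma pr_le1 A : measurable A -> pr A <= 1.
Proof. by move=> mA; rewrite -lee_fin -EFin_pr// probability_le1. Qed.

Lemma le_pr A B : measurable A -> measurable B -> A `<=` B -> pr A <= pr B.
Proof. by move=> mA mB AB; rewrite -lee_fin -!EFin_pr// le_measure ?inE. Qed.

Lemma pr_setU A B : measurable A -> measurable B -> pr (A `|` B) <= pr A + pr B.
Proof.
move=> mA mB; rewrite -lee_fin EFinD -!EFin_pr//; last exact: measurableU.
exact: measureU2.
Qed.

Lemma pr_le_setU A B C : measurable A -> measurable B -> measurable C ->
  A `<=` B `|` C -> pr A <= pr B + pr C.
Proof.
move=> mA mB mC ABC; apply: le_trans (pr_setU mB mC).
by apply: le_pr => //; exact: measurableU.
Qed.

Lemma pr_setC A : measurable A -> pr (~` A) = 1 - pr A.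
Proof.
move=> mA; have := probability_setC P mA.
by rewrite !EFin_pr//; [case|exact: measurableC].
Qed.

Lemma pr_set0 : pr set0 = 0.
Proof. by rewrite /pr measure0. Qed.

Lemma pr_bigU I (s : seq I) (F : I -> set T) : (forall i, measurable (F i)) ->
  pr (\big[setU/set0]_(i <- s) F i) <= \sum_(i <- s) pr (F i).
Proof.
move=> mF; elim: s => [|i s IH]; first by rewrite !big_nil pr_set0.
rewrite !big_cons; apply: (le_trans (pr_setU _ _)) => //.
  exact: bigsetU_measurable.
by rewrite lerD2l.
Qed.

Lemma measurable_gt_abs f (c : R) : measurable_fun setT f -> measurable [set x | c < `|f x|].
Proof.
move=> mf; rewrite -[X in measurable X]setTI.
have -> : [set x | c < `|f x|] = (fun x => `|f x|) @^-1` `]c, +oo[.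
  by apply/seteqP; split => x /=; rewrite in_itv/= andbT.
have mn : measurable_fun setT (fun x => `|f x|) by exact: measurableT_comp.
by apply: mn => //; exact: measurable_itv.
Qed.

Lemma measurable_le_abs f (c : R) : measurable_fun setT f -> measurable [set x | `|f x| <= c].
Proof.
move=> mf; rewrite (_ : [set _ | _] = ~` [set x | c < `|f x|]).
  by apply: measurableC; exact: measurable_gt_abs.
by apply/seteqP; split => x /=; rewrite leNgt => /negP.
Qed.

Lemma markov_sqr f (c : R) : 0 < c -> bounded_mfun f ->
  pr [set x | c < `|f x|] <= Ex (fun x => f x ^+ 2) / c ^+ 2.
Proof.
move=> c0 bf; have mf := bounded_mfun_measurable bf.
rewrite -Ex_indic ?ler_pdivlMr ?exprn_gt0//; last exact: measurable_gt_abs.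
have bi : bounded_mfun (\1_[set x | c < `|f x|]).
  by apply: bounded_mfun_indic; exact: measurable_gt_abs.
rewrite mulrC -ExZ//; apply: le_Ex; first exact: bounded_mfunZ.
  rewrite (_ : (fun x => f x ^+ 2) = (fun x => f x * f x)).
    exact: bounded_mfunM.
  by apply/funext => x; rewrite expr2.
move=> x; rewrite indicE; have [|_] := boolP (x \in _); last by rewrite mulr0 sqr_ge0.
rewrite inE/= mulr1 => cx; rewrite -(real_normK (num_real (f x))).
by rewrite ler_sqr ?nnegrE ?normr_ge0 // ltW.
Qed.

Lemma Ex_dct (F : nat -> T -> R) f (M : R) :
  (forall n, measurable_fun setT (F n)) -> measurable_fun setT f ->
  (forall n x, `|F n x| <= M) ->
  {ae P, forall x, F ^~ x @ \oo --> f x} ->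
  (fun n => Ex (F n)) @ \oo --> Ex f.
Proof.
move=> mF mf FM cF.
have [|||||i h1 h2] := @dominated_convergence _ _ _ P setT measurableT
  (fun n x => (F n x)%:E) (fun x => (f x)%:E) (fun=> M%:E).
- by move=> n; apply/measurable_EFinP.
- exact/measurable_EFinP.
- case: cF => N [mN N0 sub]; exists N; split => // x /= h; apply: sub => /= h'; apply: h => _.
  by apply: cvg_EFin => //; exact: nearW.
- by apply: finite_measure_integrable_cst.
- by apply: aeW => x n _; rewrite lee_fin.
apply: fine_cvg; rewrite fineK; first exact: h2.
exact: integrable_fin_num.
Qed.

End BoundedExpectation.

(** * Independence of families and of the sigma-algebras they generate *)

Section Independence.
Context {R : realType} {d} {T : measurableType d} (P : probability T R).

(** For fixed B the finite measures A |-> P(A [&] B) and A |-> P(A) P(B) agree on a pi-system, hence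
    on the sigma-algebra it generates. This is done in one argument and then in the other. *)
Lemma sigma_algebra_product_rule (G1 G2 : set (set T)) :
  G1 `<=` measurable -> G2 `<=` measurable -> setI_closed G1 -> setI_closed G2 ->
  G1 setT -> G2 setT ->
  (forall A B, G1 A -> G2 B -> P (A `&` B) = (P A * P B)%E) ->
  forall A B, <<s G1 >> A -> <<s G2 >> B -> P (A `&` B) = (P A * P B)%E.
Proof.
have sm (G : set (set T)) : G `<=` measurable -> <<s G >> `<=` measurable.
  by move=> GM; apply: smallest_sub => //; exact: sigma_algebra_measurable.
have step (H1 H2 : set (set T)) : H1 `<=` measurable -> H2 `<=` measurable ->
    setI_closed H1 -> H1 setT ->
    (forall A B, H1 A -> H2 B -> P (A `&` B) = (P A * P B)%E) ->
    forall A B, <<s H1 >> A -> H2 B -> P (A `&` B) = (P A * P B)%E.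
  move=> m1 m2 I1 T1 prodr A B HA HB.
  have mB := m2 _ HB.
  have pB0 : (0 <= fine (P B))%R by rewrite fine_ge0.
  have -> : P (A `&` B) = mrestr P mB A by [].
  have -> : (P A * P B)%E = mscale (NngNum pB0) P A.
    by rewrite /mscale/= muleC fineK// fin_num_measure.
  apply: (@g_sigma_algebra_measure_unique _ _ _ H1 m1 (fun=> setT)) => //.
  - by apply/seteqP; split => // x _; exists 0%N.
  - move=> C HC; transitivity (P C * P B)%E; first exact: prodr.
    rewrite [RHS](_ : _ = (fine (P B))%:E * P C)%E// muleC fineK//.
    by rewrite fin_num_measure.
  - move=> _; rewrite -[_ setT]/(P (setT `&` B)) setTI -ge0_fin_numE// fin_num_measure//.
move=> m1 m2 I1 I2 T1 T2 prodr A B HA HB.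
rewrite setIC muleC; apply: (step G2 <<s G1 >>) => //; first exact: sm.
by move=> C D GC GD; rewrite setIC muleC; apply: (step G1 G2).
Qed.

Definition independent2 (X Y : T -> R) := forall A B : set R, measurable A -> measurable B ->
  P (X @^-1` A `&` Y @^-1` B) = (P (X @^-1` A) * P (Y @^-1` B))%E.

(** The joint law agrees with the product of the marginal laws on rectangles, hence everywhere;
    Fubini's theorem then separates the factors. *)
Lemma Ex_independent2 (X Y : T -> R) (f g : R -> R) :
  measurable_fun setT X -> measurable_fun setT Y -> independent2 X Y ->
  bounded_mfun f -> bounded_mfun g ->
  Ex P (fun x => f (X x) * g (Y x)) = Ex P (f \o X) * Ex P (g \o Y).
Proof.
move=> mX mY iXY [mf [M fM]] [mg [N gN]].
pose X' : {mfun T >-> R} := HB.pack X (isMeasurableFun.Build _ _ _ _ X mX).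
pose Y' : {mfun T >-> R} := HB.pack Y (isMeasurableFun.Build _ _ _ _ Y mY).
have mXY : measurable_fun setT (fun x => (X x, Y x)) by exact: measurable_fun_pair.
pose XY : {mfun T >-> (R * R)%type} :=
  HB.pack (fun x => (X x, Y x)) (isMeasurableFun.Build _ _ _ _ _ mXY).
pose mu : probability R R := distribution P X'.
pose nu : probability R R := distribution P Y'.
pose rho : probability (R * R)%type R := distribution P XY.
have rhoE : forall C, measurable C -> (mu \x nu)%E C = rho C.
  by apply: product_measure_unique => A B mA mB; exact: iXY.
have mfg : measurable_fun setT (fun z : R * R => f z.1 * g z.2).
  by apply: measurable_funM; [exact: (measurableT_comp mf measurable_fst)|exact: (measurableT_comp mg measurable_snd)].
have bd h (m : measurableType h) (m0 : probability m R) (k : m -> R) (K : R) :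
    measurable_fun setT k -> (forall x, `|k x| <= K) -> m0.-integrable setT (EFin \o k).
  by move=> mk kK; apply: bounded_mfun_integrable; exact: (bounded_mfunW mk kK).
have fgMN z : `|f z.1 * g z.2| <= M * N by rewrite normrM ler_pM.
have inu : forall a : R, (\int[nu]_y (f a * g y)%:E = (f a * Ex nu g)%:E)%E.
  move=> a; rewrite EFin_Ex; last by apply: bounded_mfunZ; exact: (bounded_mfunW mg gN).
  by rewrite ExZ//; exact: (bounded_mfunW mg gN).
have Exd (h : R -> R) (Z : {mfun T >-> R}) : bounded_mfun h -> Ex (distribution P Z) h = Ex P (h \o Z).
  move=> bh; rewrite /Ex; congr fine.
  rewrite [LHS]integral_distribution//.
    by apply/measurable_EFinP; case: bh.
  apply: bounded_mfun_integrable; case: bh => mh [K hK]; apply: (@bounded_mfunW _ _ _ _ K) => //.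
  exact: measurableT_comp.
have : (\int[mu \x nu]_z (f z.1 * g z.2)%:E = \int[rho]_z (f z.1 * g z.2)%:E)%E.
  by apply: eq_measure_integral => A mA _; exact: rhoE.
rewrite -integral12_prod_meas1; last first.
  have -> : (fun z : R * R => (f z.1 * g z.2)%:E) = EFin \o (fun z => f z.1 * g z.2) by [].
  apply/integrableP; split; first exact/measurable_EFinP.
  have := bd _ _ rho _ _ mfg fgMN => /integrableP[_].
  apply: le_lt_trans; rewrite le_eqVlt; apply/orP; left; apply/eqP.
  by apply: eq_measure_integral => A mA _; exact: rhoE.
rewrite /fubini_F/=.
under eq_integral do rewrite inu.
move=> /(congr1 fine).
have -> : fine (\int[mu]_x (f x * Ex nu g)%:E)%E = Ex mu f * Ex nu g.
  rewrite -/(Ex mu (fun x => f x * Ex nu g)) mulrC -ExZ; last exact: (bounded_mfunW mf fM).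
  by congr Ex; apply/funext => x; rewrite mulrC.
rewrite !Exd; [|exact: (bounded_mfunW mg gN)|exact: (bounded_mfunW mf fM)] => ->.
rewrite /Ex; congr fine; rewrite [RHS]integral_distribution//.
  exact/measurable_EFinP.
apply: (bd _ _ P (fun x => f (X x) * g (Y x)) (M * N)); last by move=> x; exact: (fgMN (X x, Y x)).
exact: (measurableT_comp mfg mXY).
Qed.

End Independence.

Section IndependentFamily.
Context {R : realType} {d} {T : measurableType d} (P : probability T R).
Context {I : eqType} (X : I -> T -> R).
Hypothesis mX : forall i, measurable_fun setT (X i).
Hypothesis indX : mutually_independent P X.

Definition rectangles (s : seq I) : set (set T) :=
  [set A | exists2 B : I -> set R, (forall i, measurable (B i)) &
     A = \bigcap_(i in [set` s]) (X i @^-1` B i)].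

Lemma rectangles_measurable s : rectangles s `<=` measurable.
Proof.
move=> _ [B mB ->]; apply: fin_bigcap_measurable => // i _.
by rewrite -[X in measurable X]setTI; exact: mX.
Qed.

Lemma rectangles_setI s : setI_closed (rectangles s).
Proof.
move=> _ _ [A mA ->] [B mB ->]; exists (fun i => A i `&` B i).
  by move=> i; exact: measurableI.
by rewrite -bigcapI.
Qed.

Lemma rectangles_setT s : rectangles s setT.
Proof.
by exists (fun=> setT) => //; rewrite bigcapT.
Qed.

Lemma rectangles_product_rule s1 s2 : uniq (s1 ++ s2) ->
  forall A B, rectangles s1 A -> rectangles s2 B -> P (A `&` B) = (P A * P B)%E.
Proof.
move=> us _ _ [A mA ->] [B mB ->].
move: (us); rewrite cat_uniq => /and3P[u1 /hasPn d12 u2].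
(* Gluing the two families turns an intersection of rectangles over disjoint index lists into one
   rectangle over their concatenation. *)
pose C i := if i \in s1 then A i else B i.
have mC i : measurable (C i) by rewrite /C; case: ifP.
have := indX us mC; rewrite big_cat/=.
have -> : (\prod_(i <- s1) P (X i @^-1` C i) = \prod_(i <- s1) P (X i @^-1` A i))%E.
  by rewrite !big_seq; apply: eq_bigr => i si; rewrite /C si.
have -> : (\prod_(i <- s2) P (X i @^-1` C i) = \prod_(i <- s2) P (X i @^-1` B i))%E.
  by rewrite !big_seq; apply: eq_bigr => i si; rewrite /C (negbTE (d12 _ si)).
rewrite -indX// -indX// => <-; congr (P _).
apply/seteqP; split => x /=.
  move=> [hA hB] i /=; rewrite mem_cat /C => /orP[si|si].
    by rewrite si; exact: hA.
  by rewrite (negbTE (d12 _ si)); exact: hB.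
move=> h; split => i /= si; have := h i; rewrite /= mem_cat si ?orbT => /(_ isT); rewrite /C.
  by rewrite si.
by rewrite (negbTE (d12 _ si)).
Qed.

Definition sigma_of (s : seq I) := <<s rectangles s >>.

Lemma sigma_of_product_rule s1 s2 A B : uniq (s1 ++ s2) ->
  sigma_of s1 A -> sigma_of s2 B -> P (A `&` B) = (P A * P B)%E.
Proof.
move=> us; apply: sigma_algebra_product_rule; do ?exact: rectangles_measurable;
  do ?exact: rectangles_setI; do ?exact: rectangles_setT.
exact: rectangles_product_rule.
Qed.

(** Measurability for the sigma-algebra of the X i with i in s, encoded as ordinary measurability on
    a copy of T that carries this sigma-algebra, so that the library closure lemmas apply. *)
Definition measurable_wrt (s : seq I) (f : T -> R) :=
  @measurable_fun _ _ (g_sigma_algebraType (rectangles s)) R setT f.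

Lemma measurable_wrt_preimage s f B : measurable_wrt s f -> measurable B ->
  sigma_of s (f @^-1` B).
Proof. by move=> mf mB; have := mf measurableT _ mB; rewrite setTI. Qed.

Lemma measurable_wrt_comp s (g : R -> R) i : measurable_fun setT g -> i \in s ->
  measurable_wrt s (fun x => g (X i x)).
Proof.
move=> mg si; apply: (measurableT_comp mg) => _ B mB; rewrite setTI.
apply: sub_gen_smallest; exists (fun j => if j == i then B else setT).
  by move=> j; case: ifP.
apply/seteqP; split => x /= h.
  by move=> j _; case: eqP => // ->.
by have := h i si; rewrite eqxx.
Qed.

Lemma measurable_wrt_sum s s' (g : I -> R -> R) : (forall i, measurable_fun setT (g i)) ->
  {subset s' <= s} -> measurable_wrt s (fun x => \sum_(i <- s') g i (X i x)).
Proof.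
move=> mg; elim: s' => [|i s' IH] ss.
  rewrite (_ : (fun _ => _) = fun=> 0); first exact: measurable_cst.
  by apply/funext => x; rewrite big_nil.
rewrite (_ : (fun _ => _) = fun x => g i (X i x) + \sum_(j <- s') g j (X j x)).
  apply: measurable_funD.
    by apply: measurable_wrt_comp => //; apply: ss; rewrite mem_head.
  by apply: IH => j js; apply: ss; rewrite inE js orbT.
by apply/funext => x; rewrite big_cons.
Qed.

Lemma measurable_wrt_independent2 s1 s2 f g : uniq (s1 ++ s2) ->
  measurable_wrt s1 f -> measurable_wrt s2 g -> independent2 P f g.
Proof.
move=> us mf mg A B mA mB.
by apply: (sigma_of_product_rule us); exact: measurable_wrt_preimage.
Qed.

End IndependentFamily.

(** * Characteristic functions *)

Section TrigonometricBounds.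
Context {R : realType}.
Implicit Types x t : R.

Lemma sin_MVT x : 0 < x -> exists2 y : R, 0 < y < x & sin x = x * cos y.
Proof.
move=> x0; have [|y yx h] := @MVT R sin cos 0 x x0 (fun y _ => is_derive_sin y).
  by apply: continuous_subspaceT => y; exact: continuous_sin.
by exists y; [move: yx; rewrite in_itv|rewrite mulrC; move: h; rewrite sin0 !subr0].
Qed.

Lemma norm_sin_le x : `|sin x| <= `|x|.
Proof.
wlog x0 : x / 0 <= x.
  move=> h; have [/h//|x0] := leP 0 x; rewrite -normrN -sinN -(normrN x).
  by apply: h; rewrite oppr_ge0 ltW.
have [->|xn0] := eqVneq x 0; first by rewrite sin0.
have [|y _ ->] := @sin_MVT x; first by rewrite lt_def xn0.
by rewrite normrM ler_piMr// ler_norml cos_geN1 cos_le1.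
Qed.

Lemma cos_half x : cos x = 1 - 2 * sin (x / 2) ^+ 2.
Proof.
have -> : cos x = cos (x / 2 + x / 2) by congr cos; field.
rewrite cosD -!expr2; have := cos2Dsin2 (x / 2).
set a := cos _; set b := sin _ => h; have -> : a ^+ 2 = 1 - b ^+ 2 by rewrite -h addrK.
by ring.
Qed.

Lemma cos_ge_quadratic x : 1 - x ^+ 2 / 2 <= cos x.
Proof.
have := norm_sin_le (x / 2); rewrite -(@ler_pXn2r _ 2)// ?nnegrE// !real_normK ?num_real//.
rewrite cos_half => h; have e : (x / 2) ^+ 2 = x ^+ 2 / 4 by field.
lra.
Qed.

Lemma sin_ge_half x : 0 <= x <= 1 -> x / 2 <= sin x.
Proof.
move=> /andP[]; rewrite le_eqVlt => /orP[/eqP <-|x0 x1]; first by rewrite sin0 mul0r.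
have [y /andP[y0 yx] ->] := sin_MVT x0; rewrite ler_wpM2l ?(ltW x0)//.
have := cos_ge_quadratic y; have : y ^+ 2 <= 1 by rewrite expr_le1 ?(ltW y0)//; lra.
lra.
Qed.

Lemma cos_le_quadratic x : `|x| <= 1 -> cos x <= 1 - x ^+ 2 / 8.
Proof.
wlog x0 : x / 0 <= x.
  move=> h; have [/h//|x0 x1] := leP 0 x; rewrite -cosN -(sqrrN x).
  by apply: h; rewrite ?normrN// oppr_ge0 ltW.
rewrite ger0_norm// => x1; have h : x / 2 / 2 <= sin (x / 2) by apply: sin_ge_half; lra.
have : (x / 2 / 2) ^+ 2 <= sin (x / 2) ^+ 2 by rewrite ler_sqr ?nnegrE//; lra.
rewrite (cos_half x) => h2; have e : (x / 2 / 2) ^+ 2 = x ^+ 2 / 16 by field.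
lra.
Qed.

End TrigonometricBounds.

Section ComplexNorm.
Context {R : realType}.
Implicit Types z w : R[i].

(** The norm of [R[i]] takes its values in [R[i]]; limits and inequalities need a modulus with
    values in R. *)
Definition cnorm z : R := Normc.normc z.

Lemma cnorm_ge0 z : 0 <= cnorm z.
Proof. by case: z => a b; rewrite /cnorm/= sqrtr_ge0. Qed.

Lemma cnorm0 : cnorm 0 = 0.
Proof. exact: Normc.normc0. Qed.

Lemma cnorm1 : cnorm 1 = 1.
Proof. exact: Normc.normc1. Qed.

Lemma cnormM z w : cnorm (z * w) = cnorm z * cnorm w.
Proof. exact: Normc.normcM. Qed.

Lemma cnormD z w : cnorm (z + w) <= cnorm z + cnorm w.
Proof. exact: (@le_normcD R). Qed.

Lemma cnormN z : cnorm (- z) = cnorm z.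
Proof. exact: (@normcN R). Qed.

Lemma cnormB z w : cnorm (z - w) = cnorm (w - z).
Proof. by rewrite -cnormN opprB. Qed.

Lemma cnorm_dist w z v : cnorm (z - v) <= cnorm (z - w) + cnorm (w - v).
Proof. by apply: le_trans (cnormD _ _); rewrite addrA subrK. Qed.

Lemma cnormX z n : cnorm (z ^+ n) = cnorm z ^+ n.
Proof. by elim: n => [|n IH]; rewrite ?expr0 ?cnorm1// !exprS cnormM IH. Qed.

Lemma cnorm_natr n : cnorm n%:R = n%:R.
Proof.
elim: n => [|n IH]; first by rewrite cnorm0.
by have := @normcMn R 1 n.+1; rewrite Normc.normc1.
Qed.

Lemma cnorm_sum I (s : seq I) (F : I -> R[i]) :
  cnorm (\sum_(i <- s) F i) <= \sum_(i <- s) cnorm (F i).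
Proof.
elim/big_ind2 : _ => [|z a w b za wb|//]; first by rewrite cnorm0.
by rewrite (le_trans (cnormD _ _))// lerD.
Qed.

Lemma cnorm_prod I (s : seq I) (F : I -> R[i]) :
  cnorm (\prod_(i <- s) F i) = \prod_(i <- s) cnorm (F i).
Proof.
elim/big_ind2 : _ => [|z a w b <- <-|//]; first by rewrite cnorm1.
by rewrite cnormM.
Qed.

Lemma cnorm_prod_le1 I (s : seq I) (F : I -> R[i]) : (forall i, cnorm (F i) <= 1) ->
  cnorm (\prod_(i <- s) F i) <= 1.
Proof.
move=> F1; rewrite cnorm_prod; elim: s => [|i s IH]; first by rewrite big_nil.
by rewrite big_cons mulr_ile1// ?cnorm_ge0// prodr_ge0// => j _; exact: cnorm_ge0.
Qed.

Lemma sqr_cnorm a b : cnorm (Complex a b) ^+ 2 = a ^+ 2 + b ^+ 2.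
Proof. by rewrite /cnorm/= sqr_sqrtr// addr_ge0// sqr_ge0. Qed.

Lemma Re_le_cnorm z : `|complex.Re z| <= cnorm z.
Proof.
case: z => a b /=; rewrite -(@ler_pXn2r _ 2)// ?nnegrE ?cnorm_ge0//.
by rewrite real_normK ?num_real// sqr_cnorm lerDl sqr_ge0.
Qed.

Lemma Im_le_cnorm z : `|complex.Im z| <= cnorm z.
Proof.
case: z => a b /=; rewrite -(@ler_pXn2r _ 2)// ?nnegrE ?cnorm_ge0//.
by rewrite real_normK ?num_real// sqr_cnorm lerDr sqr_ge0.
Qed.

Lemma cnorm_le_ReIm z : cnorm z <= `|complex.Re z| + `|complex.Im z|.
Proof.
case: z => a b /=; rewrite -(@ler_pXn2r _ 2)// ?nnegrE ?cnorm_ge0 ?addr_ge0//.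
rewrite sqr_cnorm sqrrD !real_normK ?num_real// -addrA lerD2l.
by rewrite -[leLHS]add0r lerD2r mulrn_wge0// mulr_ge0.
Qed.

(** Factors are exchanged one at a time; those left in place have modulus at most 1. *)
Lemma cnorm_prodB I (s : seq I) (F G : I -> R[i]) :
  (forall i, cnorm (F i) <= 1) -> (forall i, cnorm (G i) <= 1) ->
  cnorm (\prod_(i <- s) F i - \prod_(i <- s) G i) <= \sum_(i <- s) cnorm (F i - G i).
Proof.
move=> F1 G1; elim: s => [|i s IH]; first by rewrite !big_nil subrr cnorm0.
rewrite !big_cons; set p := \prod_(_ <- _) _; set q := \prod_(_ <- _) _.
have -> : F i * p - G i * q = (F i - G i) * p + G i * (p - q) by ring.
rewrite (le_trans (cnormD _ _))// !cnormM lerD//.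
  by rewrite ler_piMr ?cnorm_ge0//; exact: cnorm_prod_le1.
by rewrite (le_trans _ IH)// ler_piMl ?cnorm_ge0.
Qed.

(** Meant for the cofactor of x - y in x^n - y^n: when its terms are near 1 it has size about n, so
    that |x^n - y^n| controls n |x - y|. *)
Lemma cnorm_sum_near1 (n : nat) (F : nat -> R[i]) (e : R) :
  (forall k, (k < n)%N -> cnorm (F k - 1) <= e) ->
  n%:R * (1 - e) <= cnorm (\sum_(k < n) F k).
Proof.
move=> F1; have h : cnorm (n%:R - \sum_(k < n) F k) <= n%:R * e.
  have -> : n%:R = \sum_(k < n) (1 : R[i]) by rewrite sumr_const card_ord.
  have -> : n%:R * e = \sum_(k < n) e by rewrite sumr_const card_ord mulr_natl.
  rewrite -sumrB (le_trans (cnorm_sum _ _))// ler_sum// => k _.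
  by rewrite cnormB F1.
have := cnorm_dist (\sum_(k < n) F k) n%:R 0.
by rewrite !subr0 cnorm_natr; lra.
Qed.

End ComplexNorm.

Lemma measurable_scale (R : realType) (u : R) : measurable_fun setT (fun y : R => u * y).
Proof. by apply: measurable_funM => //; exact: measurable_cst. Qed.

Section CharacteristicFunction.
Context {R : realType} {d} {T : measurableType d} (P : probability T R).
Implicit Types (X Y f g m : T -> R) (u v : R).

Definition cf X u : R[i] := Complex (Ex P (fun x => cos (u * X x))) (Ex P (fun x => sin (u * X x))).

Lemma measurable_funZ X u : measurable_fun setT X -> measurable_fun setT (fun x => u * X x).
Proof. by move=> mX; apply: measurable_funM => //; exact: measurable_cst. Qed.

(** The modulus of an integral is at most the integral of the modulus. If (a, b) is the integral and
    N its modulus, then N^2 = E(a f + b g), and a f + b g <= N m pointwise by Cauchy-Schwarz. *)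
Lemma cnorm_Ex f g m : bounded_mfun f -> bounded_mfun g -> bounded_mfun m ->
  (forall x, 0 <= m x) -> (forall x, f x ^+ 2 + g x ^+ 2 <= m x ^+ 2) ->
  cnorm (Complex (Ex P f) (Ex P g)) <= Ex P m.
Proof.
move=> bf bg bm m0 fgm; set a := Ex P f; set b := Ex P g.
set N := cnorm _; have N0 : 0 <= N by exact: cnorm_ge0.
have [N00|Nn0] := eqVneq N 0; first by rewrite N00 Ex_ge0.
have Np : 0 < N by rewrite lt_def Nn0.
rewrite -(ler_pM2l Np) -expr2 sqr_cnorm -ExZ// !expr2 -!ExZ// -ExD//; do ?exact: bounded_mfunZ.
apply: le_Ex; [by apply: bounded_mfunD; exact: bounded_mfunZ|exact: bounded_mfunZ|].
move=> x; apply: le_trans (ler_norm _) _.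
rewrite -(@ler_pXn2r _ 2)// ?nnegrE ?mulr_ge0// real_normK ?num_real//.
rewrite exprMn sqr_cnorm -/a -/b.
have h := fgm x; apply: (@le_trans _ _ ((a ^+ 2 + b ^+ 2) * (f x ^+ 2 + g x ^+ 2))).
  (* Lagrange's identity, the two-dimensional Cauchy-Schwarz inequality. *)
  rewrite -subr_ge0; have -> : (a ^+ 2 + b ^+ 2) * (f x ^+ 2 + g x ^+ 2) -
    (a * f x + b * g x) ^+ 2 = (a * g x - b * f x) ^+ 2 by ring.
  exact: sqr_ge0.
by rewrite ler_wpM2l// addr_ge0// sqr_ge0.
Qed.

Lemma cnorm_cf_le1 X u : measurable_fun setT X -> cnorm (cf X u) <= 1.
Proof.
move=> mX; rewrite -(Ex_cst P 1); apply: cnorm_Ex => //.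
- by apply: bounded_mfun_cos; exact: measurable_funZ.
- by apply: bounded_mfun_sin; exact: measurable_funZ.
- exact: bounded_mfun_cst.
- by move=> x; rewrite cos2Dsin2 expr1n.
Qed.

(** Pointwise |exp(is) - exp(it)|^2 = 2 - 2 cos(s - t), which is at most 4 and at most (s - t)^2. *)
Lemma cf_dist X Y u v : measurable_fun setT X -> measurable_fun setT Y ->
  cnorm (cf X u - cf Y v) <= Ex P (fun x => Num.min 2 `|u * X x - v * Y x|).
Proof.
move=> mX mY; have mu := measurable_funZ u mX; have mv := measurable_funZ v mY.
have -> : cf X u - cf Y v = Complex (Ex P (fun x => cos (u * X x) - cos (v * Y x)))
    (Ex P (fun x => sin (u * X x) - sin (v * Y x))).
  by rewrite !ExB//; (apply: bounded_mfun_cos || apply: bounded_mfun_sin).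
apply: cnorm_Ex.
- by apply: bounded_mfunB; exact: bounded_mfun_cos.
- by apply: bounded_mfunB; exact: bounded_mfun_sin.
- by apply: bounded_mfun_min => //; exact: measurable_funB.
- by move=> x; rewrite le_min normr_ge0 ler0n.
- move=> x; set s := u * X x; set t := v * Y x.
  have -> : (cos s - cos t) ^+ 2 + (sin s - sin t) ^+ 2 = 2 - 2 * cos (s - t).
    rewrite cosB; have := cos2Dsin2 s; have := cos2Dsin2 t => h1 h2.
    by lra.
  have := cos_geN1 (s - t); have := cos_ge_quadratic (s - t) => h1 h2.
  rewrite /Num.min; case: ifP => _; first by rewrite expr2; lra.
  by rewrite real_normK ?num_real//; lra.
Qed.

Lemma cf_dist_pr X Y u v e : 0 <= e -> measurable_fun setT X -> measurable_fun setT Y ->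
  cnorm (cf X u - cf Y v) <= e + 2 * pr P [set x | e < `|u * X x - v * Y x|].
Proof.
move=> e0 mX mY; apply: le_trans (cf_dist _ _ mX mY) _.
have mD : measurable_fun setT (fun x => u * X x - v * Y x).
  by apply: measurable_funB; exact: measurable_funZ.
have mA := measurable_gt_abs e mD.
rewrite -(Ex_indic P mA) -(ExZ P 2 (bounded_mfun_indic mA)) -[X in X + _](Ex_cst P e).
rewrite -ExD//; [|exact: bounded_mfun_cst|by apply: bounded_mfunZ; exact: bounded_mfun_indic].
apply: le_Ex.
- exact: bounded_mfun_min.
- apply: bounded_mfunD; first exact: bounded_mfun_cst.
  by apply: bounded_mfunZ; exact: bounded_mfun_indic.
- move=> x; rewrite indicE; have [|] := boolP (x \in _).
    by move=> _; rewrite mulr1 ge_min; apply/orP; left; rewrite lerDr.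
  rewrite notin_setE/= => /negP; rewrite -leNgt => h.
  by rewrite mulr0 addr0 ge_min h orbT.
Qed.

Lemma cf0 X : cf X 0 = 1.
Proof.
rewrite /cf; under [in X in Complex X _]eq_fun do rewrite mul0r cos0.
under [in X in Complex _ X]eq_fun do rewrite mul0r sin0.
by rewrite !Ex_cst.
Qed.

Lemma cf_near1 X u e : 0 <= e -> measurable_fun setT X ->
  cnorm (cf X u - 1) <= e + 2 * pr P [set x | e < `|u * X x|].
Proof.
move=> e0 mX; have := @cf_dist_pr X X u 0 e e0 mX mX; rewrite cf0.
by under eq_set do rewrite mul0r subr0.
Qed.

Lemma cf_scale X u v : cf (fun x => u * X x) v = cf X (u * v).
Proof. by rewrite /cf; congr Complex; congr Ex; apply/funext => x; congr (_ _); ring. Qed.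

Lemma cf_independent2 X Y u : measurable_fun setT X -> measurable_fun setT Y ->
  independent2 P X Y -> cf (fun x => X x + Y x) u = cf X u * cf Y u.
Proof.
move=> mX mY iXY; have mcu := measurable_scale u.
have bc := bounded_mfun_cos mcu; have bs := bounded_mfun_sin mcu.
have bcX := bounded_mfun_cos (measurable_funZ u mX); have bsX := bounded_mfun_sin (measurable_funZ u mX).
have bcY := bounded_mfun_cos (measurable_funZ u mY); have bsY := bounded_mfun_sin (measurable_funZ u mY).
have := Ex_independent2 mX mY iXY bc bc; have := Ex_independent2 mX mY iXY bs bs.
have := Ex_independent2 mX mY iXY bc bs; have := Ex_independent2 mX mY iXY bs bc.
rewrite /comp => sc cs ss cc.
rewrite /cf; congr Complex.
  rewrite -cc -ss -ExB; [|exact: bounded_mfunM..].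
  by congr Ex; apply/funext => x; rewrite mulrDr cosD.
rewrite -cs -sc addrC -ExD; [|exact: bounded_mfunM..].
by congr Ex; apply/funext => x; rewrite mulrDr sinD.
Qed.

Lemma cf_sum_independent {I : eqType} (X : I -> T -> R) (s : seq I) (b : I -> R) u :
  (forall i, measurable_fun setT (X i)) -> mutually_independent P X -> uniq s ->
  cf (fun x => \sum_(i <- s) b i * X i x) u = \prod_(i <- s) cf (X i) (b i * u).
Proof.
move=> mX iX; elim: s => [|i s IH] /=.
  by move=> _; rewrite big_nil -[RHS](cf0 (fun=> 0)) /cf; congr Complex; congr Ex;
    apply/funext => x; rewrite big_nil mulr0 mul0r.
move=> /andP[si us]; rewrite big_cons -IH// -(cf_scale (X i)).
rewrite -cf_independent2; last 1 first.
- apply: (measurable_wrt_independent2 mX iX (s1 := [:: i]) (s2 := s)).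
  + by rewrite /= si.
  + apply: (@measurable_wrt_comp _ _ _ _ _ _ (fun y => b i * y)); last by rewrite mem_head.
    exact: measurable_scale.
  + by apply: (@measurable_wrt_sum _ _ _ _ _ _ _ (fun i y => b i * y)) => // j; exact: measurable_scale.
- by rewrite /cf; congr Complex; congr Ex; apply/funext => x; rewrite big_cons.
- exact: measurable_funZ.
- by apply: measurable_sum => j; exact: measurable_funZ.
Qed.

End CharacteristicFunction.

Section EqualInLaw.
Context {R : realType} {d d'} {T : measurableType d} {T' : measurableType d'}.
Variables (P : probability T R) (Q : probability T' R) (X : T -> R) (Y : T' -> R).
Hypotheses (mX : measurable_fun setT X) (mY : measurable_fun setT Y).
Hypothesis XY : forall B, measurable B -> P (X @^-1` B) = Q (Y @^-1` B).

Lemma Ex_eq_law (f : R -> R) : bounded_mfun f -> Ex P (f \o X) = Ex Q (f \o Y).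
Proof.
pose X' : {mfun T >-> R} := HB.pack X (isMeasurableFun.Build _ _ _ _ X mX).
pose Y' : {mfun T' >-> R} := HB.pack Y (isMeasurableFun.Build _ _ _ _ Y mY).
move=> bf; case: (bf) => mf [M fM].
have : (\int[distribution P X']_y (f y)%:E = \int[distribution Q Y']_y (f y)%:E)%E.
  by apply: eq_measure_integral => A mA _; exact: XY.
rewrite !integral_distribution//; do ?exact/measurable_EFinP.
- by rewrite /Ex => ->.
- apply: bounded_mfun_integrable; apply: (@bounded_mfunW _ _ _ _ M) => //; exact: measurableT_comp.
- apply: bounded_mfun_integrable; apply: (@bounded_mfunW _ _ _ _ M) => //; exact: measurableT_comp.
Qed.

Lemma cf_eq_law u : cf P X u = cf Q Y u.
Proof.
have mu := measurable_scale u.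
by rewrite /cf -(Ex_eq_law (bounded_mfun_cos mu)) -(Ex_eq_law (bounded_mfun_sin mu)).
Qed.

End EqualInLaw.

(** * Comparison of triangular arrays *)

Section Arrays.
Context {R : realType}.
Implicit Types (a b : nat -> R -> R[i]).

(** Here [a n u] stands for the characteristic function of one term of row n, and its m-th power for
    that of a block of m terms. Blocks of length at most del n are uniformly close to 0 in law. *)
Definition small_blocks a := forall U e : R, 0 < e -> exists2 del : R, 0 < del &
  \forall n \near \oo, forall (m : nat) (u : R), m%:R <= del * n%:R -> `|u| <= U ->
    cnorm (a n u ^+ m - 1) <= e.

(** The counterpart, for characteristic functions, of the joint tightness of all sums of at most n
    terms of row n. *)
Definition equicontinuous_blocks a := forall e : R, 0 < e -> exists2 rho : R, 0 < rho &
  \forall n \near \oo, forall (m : nat) (u v : R), (m <= n)%N -> `|u - v| <= rho ->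
    cnorm (a n u ^+ m - a n v ^+ m) <= e.

(** Take a block length m of order del n for which all powers up to m are near 1. In x^m - y^m = (x
    - y) times a sum of m products, that sum has modulus at least 3 m / 4, so equicontinuity of the
    m-th powers bounds m |x - y|, hence n |x - y|. *)
Lemma equicontinuous_rate a : (forall n u, cnorm (a n u) <= 1) ->
  small_blocks a -> equicontinuous_blocks a ->
  forall U e : R, 0 < e -> exists2 rho : R, 0 < rho &
    \forall n \near \oo, forall u v : R, `|u| <= U -> `|v| <= U -> `|u - v| <= rho ->
      n%:R * cnorm (a n u - a n v) <= e.
Proof.
move=> a1 sa ea U e e0.
have [//|del0 del0p Hs] := sa U (1 / 8).
pose del := Num.min del0 1; have delp : 0 < del by rewrite lt_min del0p ltr01.
have del1 : del <= 1 by rewrite ge_min lexx orbT.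
(* The factor del / 4 absorbs the losses n <= 2 m / del and 3 m / 4. *)
have [|rho rhop He] := ea (e * del / 4); first by rewrite divr_gt0// mulr_gt0.
exists rho => //; near=> n => u v uU vU uv.
have n2 : 2 / del <= n%:R by near: n; exact: nbhs_infty_ger.
have dn2 : 2 <= del * n%:R by rewrite mulrC -ler_pdivrMr.
have [m /andP[m1 m2]] : exists m : nat, m%:R <= del * n%:R < m.+1%:R.
  by exists (Num.truncn (del * n%:R)); apply: truncn_itv; lra.
have mh : del * n%:R / 2 <= m%:R by move: m2; rewrite -natr1; lra.
have mn : (m <= n)%N.
  by rewrite -(ler_nat R) (le_trans m1)// ler_piMl.
have A k w : (k <= m)%N -> `|w| <= U -> cnorm (a n w ^+ k - 1) <= 1 / 8.
  move=> km wU; suff : forall (m : nat) (u : R), m%:R <= del0 * n%:R -> `|u| <= U ->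
    cnorm (a n u ^+ m - 1) <= 1 / 8.
    apply => //; apply: le_trans (_ : m%:R <= _); first by rewrite ler_nat.
    by rewrite (le_trans m1)// ler_wpM2r// ge_min lexx.
  by near: n.
have B : cnorm (a n u ^+ m - a n v ^+ m) <= e * del / 4.
  suff : forall (m : nat) (u v : R), (m <= n)%N -> `|u - v| <= rho ->
    cnorm (a n u ^+ m - a n v ^+ m) <= e * del / 4 by apply.
  by near: n.
move: B; rewrite subrXX cnormM => B.
have C : m%:R * (1 - 1 / 4) <= cnorm (\sum_(i < m) a n u ^+ (m.-1 - i) * a n v ^+ i).
  apply: (@cnorm_sum_near1 _ m (fun i => a n u ^+ (m.-1 - i) * a n v ^+ i)) => k km.
  set x := a n u ^+ _; set y := a n v ^+ _.
  have -> : x * y - 1 = (x - 1) * y + (y - 1) by ring.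
  rewrite (le_trans (cnormD _ _))// cnormM.
  have hx : cnorm (x - 1) <= 1 / 8 by apply: A => //; rewrite (leq_trans (leq_subr _ _))// leq_pred.
  have hy : cnorm (y - 1) <= 1 / 8 by apply: A => //; exact: ltnW.
  have y1 : cnorm y <= 1.
    by rewrite cnormX exprn_ile1 ?cnorm_ge0.
  have : cnorm (x - 1) * cnorm y <= 1 / 8 by rewrite (le_trans _ hx)// ler_piMr ?cnorm_ge0.
  lra.
have z0 := cnorm_ge0 (a n u - a n v).
set z := cnorm (a n u - a n v) in B z0 *.
set S := cnorm (\sum_(_ < _) _) in B C.
have zS : z * (m%:R * (1 - 1 / 4)) <= z * S by rewrite ler_wpM2l.
have zm : z * (del * n%:R / 2) <= z * m%:R by rewrite ler_wpM2l.
clearbody z S.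
have e1 : z * (m%:R * (1 - 1 / 4)) = 3 / 4 * (z * m%:R) by field.
have e2 : z * (del * n%:R / 2) = (del * (n%:R * z)) / 2 by field.
rewrite e1 in zS; rewrite e2 in zm; rewrite -(ler_pM2l delp).
have ed : 0 < e * del by rewrite mulr_gt0.
rewrite (mulrC del e); lra.
Unshelve. all: by end_near.
Qed.

(** Linear growth of |w^k - 1|: as long as 2 n x <= 1 the previous powers stay within distance 1 of
    1, so each step adds at most 2 x. *)
Lemma cnorm_expr_near1 (w : R[i]) (x : R) (n k : nat) : cnorm (w - 1) <= x -> 0 <= x ->
  (2 * n)%:R * x <= 1 -> (k <= n)%N -> cnorm (w ^+ k - 1) <= (2 * k)%:R * x.
Proof.
move=> wx x0 nx; elim: k => [|k IH] kn; first by rewrite expr0 subrr cnorm0 muln0 mul0r.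
have {}IH := IH (ltnW kn).
have -> : w ^+ k.+1 - 1 = (w - 1) * (w ^+ k - 1) + (w ^+ k - 1) + (w - 1) by rewrite exprS; ring.
rewrite (le_trans (cnormD _ _))//.
have := cnormD ((w - 1) * (w ^+ k - 1)) (w ^+ k - 1); rewrite cnormM => t1.
have kn2 : (2 * k)%:R * x <= 1.
  by rewrite (le_trans _ nx)// ler_wpM2r// ler_nat leq_mul2l/= ltnW.
have : cnorm (w - 1) * cnorm (w ^+ k - 1) <= x * 1.
  by rewrite ler_pM ?cnorm_ge0// (le_trans IH).
rewrite mulr1 => t2; rewrite mulnS natrD [leRHS]mulrDl.
move: t1 t2 IH wx; set p := cnorm (_ + _); set q := cnorm (w - 1); set r := cnorm (w ^+ k - 1).
lra.
Qed.

(** The bound 1/8 singles out the right n-th root. For w = x / y it gives n |w - 1| <= 1/4, so the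
    powers of w up to n stay within 1/2 of 1, their sum has modulus at least n / 2, and |w^n - 1| >=
    n |w - 1| / 2. *)
Lemma root_distance (x y : R[i]) (n : nat) : (0 < n)%N -> 1 / 2 <= cnorm y ->
  cnorm y <= 1 ->
  n%:R * cnorm (x - y) <= 1 / 8 ->
  cnorm (y ^+ n) * (n%:R * cnorm (x - y)) <= 2 * cnorm (x ^+ n - y ^+ n).
Proof.
move=> n0 y2 y1 h.
have yn0 : y != 0 by apply/eqP => y0; move: y2; rewrite y0 cnorm0; lra.
pose w := x / y; have xE : x = w * y by rewrite /w divfK.
have rE : cnorm (x - y) = cnorm (w - 1) * cnorm y by rewrite xE -cnormM mulrBl mul1r.
set r := cnorm (w - 1) in rE; have r0 : 0 <= r by exact: cnorm_ge0.
have nr : n%:R * r <= 1 / 4.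
  have : n%:R * r * (1 / 2) <= n%:R * r * cnorm y by rewrite ler_wpM2l// mulr_ge0.
  by move: h; rewrite rE mulrA; lra.
have C : n%:R * (1 - 1 / 2) <= cnorm (\sum_(i < n) w ^+ i).
  apply: (@cnorm_sum_near1 _ n (fun i => w ^+ i)) => k kn.
  have := @cnorm_expr_near1 w r n k (lexx _) r0 _ (ltnW kn).
  rewrite natrM -mulrA => /(_ _) hk; have {}hk : cnorm (w ^+ k - 1) <= (2 * k)%:R * r by apply: hk; lra.
  rewrite (le_trans hk)// natrM -mulrA.
  have : k%:R * r <= n%:R * r by rewrite ler_wpM2r// ler_nat ltnW.
  lra.
have D : cnorm (x ^+ n - y ^+ n) = cnorm (y ^+ n) * (r * cnorm (\sum_(i < n) w ^+ i)).
  have -> : x ^+ n - y ^+ n = y ^+ n * (w ^+ n - 1) by rewrite xE exprMn; ring.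
  by rewrite subrX1 !cnormM.
rewrite D (mulrCA 2) ler_wpM2l ?cnorm_ge0// rE.
have : r * (n%:R * (1 - 1 / 2)) <= r * cnorm (\sum_(i < n) w ^+ i) by rewrite ler_wpM2l.
have : n%:R * (r * cnorm y) <= n%:R * r by rewrite ler_wpM2l// ler_piMr.
lra.
Qed.

(* Once n |a_n - b_n| is known to be at most 1/8, it is controlled by |a_n^n - b_n^n|, which
   tends to 0. Equicontinuity allows to reach v from 0 by finitely many steps that do not
   leave this regime. *)
Lemma rate_cvg0 a b (phi : R -> R[i]) :
  (forall n u, cnorm (a n u) <= 1) -> (forall n u, cnorm (b n u) <= 1) ->
  (forall n, a n 0 = b n 0) ->
  small_blocks a -> small_blocks b ->
  equicontinuous_blocks a -> equicontinuous_blocks b ->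
  (forall n u, (0 < n)%N -> b n u ^+ n = phi u) ->
  (forall u, (fun n => cnorm (a n u ^+ n - phi u)) @ \oo --> 0) ->
  forall v e : R, 0 < e -> \forall n \near \oo, n%:R * cnorm (a n v - b n v) <= e.
Proof.
move=> a1 b1 ab0 sa sb ea eb bphi aphi.
have b_half u : \forall n \near \oo, cnorm (b n u - 1) <= 1 / 2.
  have [//|del delp H] := sb `|u| (1 / 2).
  near=> n; rewrite -(expr1 (b n u)).
  suff : forall (m : nat) (v : R), m%:R <= del * n%:R -> `|v| <= `|u| ->
    cnorm (b n v ^+ m - 1) <= 1 / 2.
    apply => //; rewrite mulrC -ler_pdivrMr//; near: n; exact: nbhs_infty_ger.
  by near: n.
have b_half' u : \forall n \near \oo, 1 / 2 <= cnorm (b n u).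
  apply: filterS (b_half u) => n h.
  by have := cnorm_dist (b n u) 1 0; rewrite !subr0 cnorm1 cnormB; lra.
(* [phi u] is the n-th power of a number within 1/2 of 1, hence not zero. *)
have phi0 u : 0 < cnorm (phi u).
  have [N _ HN] := b_half' u.
  have := HN N.+1 (leqnSn N); rewrite /= => h.
  by rewrite -(bphi N.+1)// cnormX exprn_gt0//; lra.
have weak u : (\forall n \near \oo, n%:R * cnorm (a n u - b n u) <= 1 / 8) ->
    forall e : R, 0 < e -> \forall n \near \oo, n%:R * cnorm (a n u - b n u) <= e.
  move=> wk e e0; near=> n.
  have n0 : (0 < n)%N by near: n; exact: nbhs_infty_gt.
  have h1 : 1 / 2 <= cnorm (b n u) by near: n; exact: b_half'.
  have h2 : n%:R * cnorm (a n u - b n u) <= 1 / 8 by near: n.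
  have := root_distance n0 h1 (b1 n u) h2; rewrite bphi//.
  have h3 : cnorm (a n u ^+ n - phi u) <= cnorm (phi u) * e / 2.
    near: n; have /cvgr_dist_le /(_ (cnorm (phi u) * e / 2)) := aphi u.
    rewrite divr_gt0 ?mulr_gt0// => /(_ isT); apply: filterS => n.
    by rewrite sub0r normrN ger0_norm ?cnorm_ge0.
  move=> h4; rewrite -(ler_pM2l (phi0 u)); lra.
move=> v.
(* Two moves of size 1/32 added to a gap of 1/16 give the 1/8 that [weak] requires. *)
have [//|r1 r1p H1] := @equicontinuous_rate a a1 sa ea `|v| (1 / 32).
have [//|r2 r2p H2] := @equicontinuous_rate b b1 sb eb `|v| (1 / 32).
pose rho := Num.min r1 r2; have rhop : 0 < rho by rewrite lt_min r1p r2p.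
pose M := (Num.truncn (`|v| / rho)).+1.
have vM : `|v| / M%:R <= rho.
  rewrite ler_pdivrMr// mulrC -ler_pdivrMr//.
  by apply: ltW; have /andP[] := @truncn_itv _ (`|v| / rho) ltac:(by rewrite divr_ge0// ltW).
have uk (k : nat) : (k <= M)%N -> `|k%:R / M%:R * v| <= `|v|.
  move=> kM; rewrite normrM ler_piMl// ger0_norm ?divr_ge0// ler_pdivrMr// mul1r ler_nat//.
(* Induction along the points k v / M of the segment from 0 to v, whose spacing is at most [rho]. *)
suff H k : (k <= M)%N -> forall e : R, 0 < e ->
    \forall n \near \oo, n%:R * cnorm (a n (k%:R / M%:R * v) - b n (k%:R / M%:R * v)) <= e.
  by have := H M (leqnn M); rewrite divff ?gt_eqF// mul1r.
elim: k => [|k IH] kM.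
  by move=> e e0; near=> n; rewrite !mul0r ab0 subrr cnorm0 mulr0 ltW.
apply: weak; near=> n.
set u := k%:R / M%:R * v; set u' := k.+1%:R / M%:R * v.
have uu' : `|u' - u| <= rho.
  rewrite /u /u' -mulrBl -mulrBl -natr1 addrAC subrr add0r mul1r normrM.
  by rewrite normfV normr_nat mulrC.
have ha : n%:R * cnorm (a n u' - a n u) <= 1 / 32.
  suff : forall u v0 : R, `|u| <= `|v| -> `|v0| <= `|v| -> `|u - v0| <= r1 ->
      n%:R * cnorm (a n u - a n v0) <= 1 / 32.
    by apply; [exact: uk|exact/uk/ltnW|rewrite (le_trans uu')// ge_min lexx].
  by near: n.
have hb : n%:R * cnorm (b n u' - b n u) <= 1 / 32.
  suff : forall u v0 : R, `|u| <= `|v| -> `|v0| <= `|v| -> `|u - v0| <= r2 ->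
      n%:R * cnorm (b n u - b n v0) <= 1 / 32.
    by apply; [exact: uk|exact/uk/ltnW|rewrite (le_trans uu')// ge_min lexx orbT].
  by near: n.
have hab : n%:R * cnorm (a n u - b n u) <= 1 / 16.
  by near: n; apply: IH => //; exact: ltnW.
have d1 := cnorm_dist (a n u) (a n u') (b n u').
have d2 := cnorm_dist (b n u) (a n u) (b n u').
rewrite (cnormB (b n u) (b n u')) in d2.
have : n%:R * cnorm (a n u' - b n u') <= n%:R * (cnorm (a n u' - a n u) + (cnorm (a n u - b n u) + cnorm (b n u' - b n u))).
  by rewrite ler_wpM2l//; lra.
rewrite !mulrDr; lra.
Unshelve. all: by end_near.
Qed.

End Arrays.

(** * Truncated moments of a regularly varying tail *)

(* U (2^k x) is bounded by a sum of values of W dominated by a geometric series of ratio r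
   that ends with W (2^k x). *)
Lemma doubling_bound (R : realType) (U W : R -> R) (x0 r c M w : R) :
  0 < x0 -> 0 < r < 1 -> 0 <= c -> 0 <= M -> 0 < w ->
  (forall x, x0 <= x -> 0 <= W x) ->
  (forall x, x0 <= x -> U (2 * x) <= U x + c * W x) ->
  (forall x, x0 <= x -> W x <= r * W (2 * x)) ->
  (forall x, x0 <= x <= 2 * x0 -> U x <= M /\ w <= W x) ->
  exists2 K : R, 0 <= K & forall x, x0 <= x -> U x <= K * W x.
Proof.
move=> x0p /andP[r0 r1] c0 M0 w0 W0 HU HW Hb.
(* K is at least M / w, for the initial interval, and satisfies (K + c) r <= K, for the doubling
   step. *)
pose K := M / w + c * r / (1 - r).
have r0' := ltW r0; have r1' := ltW r1; have w0' := ltW w0.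
have K1 : M / w <= K by rewrite lerDl divr_ge0 ?mulr_ge0 ?subr_ge0.
have Kr : (K + c) * r <= K.
  have e : (c * r / (1 - r)) * (1 - r) = c * r by rewrite divfK// subr_eq0 gt_eqF.
  have : 0 <= M / w * (1 - r) by rewrite mulr_ge0 ?divr_ge0 ?subr_ge0.
  rewrite /K; move: e; set y := c * r / (1 - r); set z := M / w.
  lra.
have K0 : 0 <= K by apply: le_trans K1; rewrite divr_ge0// ltW.
exists K => //.
have base x : x0 <= x <= 2 * x0 -> U x <= K * W x.
  move=> xx; have [UM wW] := Hb x xx.
  rewrite (le_trans UM)//.
  have : M / w * w <= K * W x by rewrite ler_pM ?divr_ge0.
  by rewrite divfK// gt_eqF.
have H (k : nat) : forall x, x0 <= x -> x <= 2 ^+ k.+1 * x0 -> U x <= K * W x.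
  elim: k => [|k IH] x x0x xk; first by apply: base; rewrite x0x.
  have [x2|x2] := leP x (2 * x0); first by apply: base; rewrite x0x.
  have xh : x0 <= x / 2 by lra.
  have xE : x = 2 * (x / 2) by field.
  have UW : U (x / 2) <= K * W (x / 2).
    by apply: IH => //; move: xk; rewrite exprS; lra.
  have := HU _ xh; have := HW _ xh; rewrite -xE => h1 h2.
  have W2 := W0 _ xh; have Wx := W0 _ x0x.
  have h3 : (K + c) * W (x / 2) <= (K + c) * (r * W x) by rewrite ler_wpM2l// addr_ge0.
  have h4 : (K + c) * r * W x <= K * W x by rewrite ler_wpM2r.
  lra.
move=> x x0x; apply: (H (Num.truncn (x / x0))) => //.
rewrite -ler_pdivrMr//; set n := Num.truncn _.
have /andP[_ /ltW h] : n%:R <= x / x0 < n.+1%:R.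
  by apply: truncn_itv; rewrite divr_ge0 ?ltW// (lt_le_trans x0p).
by rewrite (le_trans h)// -natrX ler_nat ltnW// ltn_expl.
Qed.

Lemma powR2_gt1 (R : realType) (s : R) : 0 < s -> 1 < 2 `^ s.
Proof.
move=> s0; have := gt0_ltr_powR s0 (x := 1) (y := 2); rewrite powR1; apply.
- by rewrite nnegrE ler01.
- by rewrite nnegrE ler0n.
- by rewrite ltr1n.
Qed.

Lemma powR2_lt (R : realType) (s t : R) : s < t -> 2 `^ s < 2 `^ t.
Proof.
move=> st; have -> : t = s + (t - s) by rewrite addrC subrK.
rewrite powRD; last by rewrite pnatr_eq0 implybT.
by rewrite ltr_pMr ?powR_gt0// powR2_gt1// subr_gt0.
Qed.

Definition trunc {R : realType} (x y : R) : R := if `|y| <= x then y else 0.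

Lemma measurable_trunc {R : realType} (x : R) : measurable_fun setT (trunc x).
Proof.
apply: measurable_fun_ifT => //.
by apply: (measurable_fun_ler (f := fun y : R => `|y|)); [exact: (measurableT_comp (f := @Num.norm R R))|exact: measurable_cst].
Qed.

Lemma trunc_le {R : realType} (x y : R) : 0 <= x -> `|trunc x y| <= x.
Proof. by rewrite /trunc; case: ifP => // _; rewrite normr0. Qed.

Section Tail.
Context {R : realType} {d} {T : measurableType d} (P : probability T R).
Variables (xi : T -> R) (alpha : R).
Hypothesis mxi : measurable_fun setT xi.
Hypothesis alpha02 : 0 < alpha < 2.

Definition tail (x : R) : R := pr P [set w | x < `|xi w|].

Hypothesis tail_gt0 : forall x, 0 < tail x.
Hypothesis tail_rv : forall l : R, 0 < l -> tail (l * x) / tail x @[x --> +oo] --> l `^ (- alpha).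

Lemma le_tail x y : x <= y -> tail y <= tail x.
Proof.
move=> xy; apply: le_pr; do ?exact: measurable_gt_abs.
by move=> w /=; exact: le_lt_trans.
Qed.

Lemma tail_ratio_near (l e : R) : 0 < l -> 0 < e ->
  exists2 x0 : R, 0 < x0 & forall x, x0 <= x -> `|tail (l * x) - l `^ (- alpha) * tail x| <= e * tail x.
Proof.
move=> l0 e0; have /cvgr_dist_le /(_ e e0) [M [_ HM]] := tail_rv l0.
exists (Num.max 1 (M + 1)); first by rewrite lt_max ltr01.
move=> x; rewrite ge_max => /andP[x1 xM].
have /= := HM x ltac:(lra) => h.
rewrite -ler_pdivrMr// -[X in _ / X]ger0_norm ?(ltW (tail_gt0 x))// -normf_div.
by rewrite mulrBl mulfK ?gt_eqF// distrC.
Qed.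

(** This is T(b). As a probability it is monotone in |b| and vanishes at 0 without any
    convention. *)
Definition pr_gt1 (b : R) : R := pr P [set w | 1 < `|b * xi w|].

Lemma pr_gt1E b : b != 0 -> pr_gt1 b = tail (`|b|^-1).
Proof.
move=> b0; rewrite /pr_gt1 /tail; congr pr; apply/seteqP; split => w /=;
  by rewrite normrM -[_ < `|xi w|](ltr_pM2l (_ : 0 < `|b|)) ?normr_gt0// divff ?normr_eq0.
Qed.

Lemma pr_gt1_0 : pr_gt1 0 = 0.
Proof.
rewrite /pr_gt1 (_ : [set _ | _] = set0) ?pr_set0//.
by apply/seteqP; split => w //=; rewrite mul0r normr0; lra.
Qed.

Lemma pr_gt1_ge0 b : 0 <= pr_gt1 b. Proof. exact: pr_ge0. Qed.

Lemma le_pr_gt1 b b' : `|b| <= `|b'| -> pr_gt1 b <= pr_gt1 b'.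
Proof.
move=> bb; apply: le_pr; do ?by apply: measurable_gt_abs; exact: measurable_funZ.
move=> w /=; rewrite !normrM => h; apply: (lt_le_trans h).
by rewrite ler_wpM2r.
Qed.

(** With x = 1 / |b| the left side is the tail at x / l. Regular variation compares it with the tail
    at x once x is large; K exceeds the limiting ratio l^alpha by 1. *)
Lemma pr_gt1_scale (l : R) : 0 < l -> exists2 K : R, 0 <= K & exists2 r : R, 0 < r &
  forall b, `|b| <= r -> pr_gt1 (l * b) <= K * pr_gt1 b.
Proof.
move=> l0; have li : 0 < l^-1 by rewrite invr_gt0.
have [x0 x0p H] := tail_ratio_near li (ltr01 : 0 < 1).
exists (l^-1 `^ (- alpha) + 1); first by rewrite addr_ge0// powR_ge0.
exists x0^-1; first by rewrite invr_gt0.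
move=> b br; have [->|b0] := eqVneq b 0; first by rewrite mulr0 pr_gt1_0 mulr0.
rewrite (pr_gt1E b0) pr_gt1E; last by rewrite mulf_neq0// gt_eqF.
rewrite normrM invfM (gtr0_norm l0).
have := H `|b|^-1; rewrite -[x0 <= _]lef_pV2 ?posrE ?invr_gt0 ?normr_gt0// invrK br => /(_ isT).
by rewrite mul1r mulrDl mul1r => /(le_trans (ler_norm _)); rewrite lerBlDl.
Qed.

Definition moment2 x := Ex P (fun w => trunc x (xi w) ^+ 2).
Definition abs_moment x := Ex P (fun w => `|trunc x (xi w)|).
Definition trunc_mean x := Ex P (fun w => trunc x (xi w)).

Lemma bounded_trunc x : 0 <= x -> bounded_mfun (fun w => trunc x (xi w)).
Proof.
move=> x0; apply: (@bounded_mfunW _ _ _ _ x); last by move=> w; exact: trunc_le.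
exact: (measurableT_comp (measurable_trunc x)).
Qed.

Lemma bounded_trunc2 x : 0 <= x -> bounded_mfun (fun w => trunc x (xi w) ^+ 2).
Proof.
move=> x0; rewrite (_ : (fun _ => _) = fun w => trunc x (xi w) * trunc x (xi w)).
  by apply: bounded_mfunM; exact: bounded_trunc.
by apply/funext => w; rewrite expr2.
Qed.

Lemma bounded_tail_indic x : bounded_mfun (\1_[set w | x < `|xi w|] : T -> R).
Proof. by apply: bounded_mfun_indic; exact: measurable_gt_abs. Qed.

(** In this and the next two lemmas, doubling the truncation level only adds the shell x < |xi| <= 2
    x, whose probability is at most [tail x]. *)
Lemma moment2_double x : 0 <= x -> moment2 (2 * x) <= moment2 x + 4 * (x ^+ 2 * tail x).
Proof.
move=> x0; have xx0 : 0 <= 2 * x by rewrite mulr_ge0.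
rewrite /tail -Ex_indic; last exact: measurable_gt_abs.
rewrite mulrA -ExZ; last exact: bounded_tail_indic.
rewrite -ExD; [|exact: bounded_trunc2|by apply: bounded_mfunZ; exact: bounded_tail_indic].
apply: le_Ex; first exact: bounded_trunc2.
  by apply: bounded_mfunD; [exact: bounded_trunc2|apply: bounded_mfunZ; exact: bounded_tail_indic].
move=> w; rewrite /trunc indicE; case: ifP => h2; last first.
  by rewrite expr0n/= addr_ge0 ?sqr_ge0// mulr_ge0// mulr_ge0// sqr_ge0.
case: ifP => h1; first by rewrite lerDl mulr_ge0// mulr_ge0// sqr_ge0.
rewrite mem_set/=; last by rewrite ltNge h1.
rewrite mulr1 expr0n/= add0r (_ : 4 * x ^+ 2 = (2 * x) ^+ 2); last by ring.
by rewrite -(real_normK (num_real (xi w))) ler_sqr ?nnegrE.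
Qed.

Lemma abs_moment_double x : 0 <= x -> abs_moment (2 * x) <= abs_moment x + 2 * (x * tail x).
Proof.
move=> x0; have xx0 : 0 <= 2 * x by rewrite mulr_ge0.
rewrite /tail -Ex_indic; last exact: measurable_gt_abs.
rewrite mulrA -ExZ; last exact: bounded_tail_indic.
rewrite -ExD; [|exact/bounded_mfun_abs/bounded_trunc|by apply: bounded_mfunZ; exact: bounded_tail_indic].
apply: le_Ex; first exact/bounded_mfun_abs/bounded_trunc.
  by apply: bounded_mfunD; [exact/bounded_mfun_abs/bounded_trunc|apply: bounded_mfunZ; exact: bounded_tail_indic].
move=> w; rewrite /trunc indicE; case: ifP => h2; last first.
  by rewrite normr0 addr_ge0// mulr_ge0.
case: ifP => h1; first by rewrite lerDl mulr_ge0.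
by rewrite mem_set/= ?mulr1 ?normr0 ?add0r// ltNge h1.
Qed.

Lemma trunc_mean_double x : 0 <= x -> `|trunc_mean (2 * x) - trunc_mean x| <= 2 * (x * tail x).
Proof.
move=> x0; have xx0 : 0 <= 2 * x by rewrite mulr_ge0.
have b1 := bounded_trunc x0; have b2 := bounded_trunc xx0.
rewrite /trunc_mean -ExB//; apply: le_trans (norm_Ex _ (bounded_mfunB b2 b1)) _.
rewrite /tail -Ex_indic; last exact: measurable_gt_abs.
rewrite mulrA -ExZ; last exact: bounded_tail_indic.
apply: le_Ex; first exact/bounded_mfun_abs/bounded_mfunB.
  by apply: bounded_mfunZ; exact: bounded_tail_indic.
move=> w; rewrite /trunc indicE; case: ifP => h2.
  case: ifP => h1; first by rewrite subrr normr0 mulr_ge0.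
  by rewrite mem_set/= ?mulr1 ?subr0// ltNge h1.
case: ifP => h1; last by rewrite subrr normr0 mulr_ge0.
by move: h2; rewrite (le_trans h1)//; lra.
Qed.

Lemma tail_lower (l s : R) : 0 < l -> s < l `^ (- alpha) ->
  exists2 x0 : R, 0 < x0 & forall x, x0 <= x -> s * tail x <= tail (l * x).
Proof.
move=> l0 sl; have [x0 x0p H] := tail_ratio_near l0 (e := l `^ (- alpha) - s) ltac:(by rewrite subr_gt0).
exists x0 => // x /H; rewrite ler_norml => /andP[+ _].
by rewrite mulrBl; lra.
Qed.

Lemma tail_upper (l s : R) : 0 < l -> l `^ (- alpha) < s ->
  exists2 x0 : R, 0 < x0 & forall x, x0 <= x -> tail (l * x) <= s * tail x.
Proof.
move=> l0 sl; have [x0 x0p H] := tail_ratio_near l0 (e := s - l `^ (- alpha)) ltac:(by rewrite subr_gt0).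
exists x0 => // x /H; rewrite ler_norml => /andP[_].
by rewrite mulrBl; lra.
Qed.

(** Since alpha < 2, x^2 [tail x] grows at each doubling by a factor close to 4 / 2^alpha > 1, so
    the contributions of the dyadic shells are dominated by the last one. *)
Lemma moment2_bound : exists2 K : R, 0 <= K & exists2 x0 : R, 0 < x0 &
  forall x, x0 <= x -> moment2 x <= K * (x ^+ 2 * tail x).
Proof.
have /andP[a0 a2] := alpha02.
have p2 : 1 / 4 < 2 `^ (- alpha).
  have -> : 1 / 4 = 2 `^ (- 2%:R) :> R.
    by rewrite powR_invn// -natrX mul1r.
  by apply: powR2_lt; rewrite ltrN2.
(* Any value strictly between 1/4 and 2^(-alpha) serves: the ratio 1 / (4 s) is then below 1, and
   [tail (2 * x)] is eventually at least s [tail x]. *)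
pose s := (1 / 4 + 2 `^ (- alpha)) / 2.
have [s1 s2] : 1 / 4 < s /\ s < 2 `^ (- alpha) by rewrite /s; split; lra.
have [x0 x0p H] := tail_lower (ltr0Sn R 1) s2.
have [|||||x x0x|x x0x|x x0x|x /andP[x0x xx0]|K K0 HK] :=
  @doubling_bound R moment2 (fun x => x ^+ 2 * tail x) x0 (1 / (4 * s)) 4 ((2 * x0) ^+ 2) (x0 ^+ 2 * tail (2 * x0)) => //.
- by rewrite divr_gt0 ?mulr_gt0//= ?ltr_pdivrMr; lra.
- exact: sqr_ge0.
- by rewrite mulr_gt0// exprn_gt0.
- by rewrite mulr_ge0 ?sqr_ge0// ltW.
- by apply: moment2_double; lra.
- have sp : 0 < s by lra.
  have e : 1 / (4 * s) * ((2 * x) ^+ 2 * tail (2 * x)) = x ^+ 2 * (tail (2 * x) / s).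
    by field; rewrite gt_eqF.
  by rewrite e ler_wpM2l ?sqr_ge0// ler_pdivlMr// mulrC H.
- split; last first.
    by rewrite ler_pM ?sqr_ge0 ?(ltW (tail_gt0 _))// ?le_tail// ler_sqr ?nnegrE//; lra.
  have xp : 0 <= x by lra.
  rewrite -(Ex_cst P ((2 * x0) ^+ 2)); apply: le_Ex; first exact: bounded_trunc2.
    exact: bounded_mfun_cst.
  move=> w; rewrite -real_normK ?num_real// ler_sqr ?nnegrE//; last by lra.
  by rewrite (le_trans (trunc_le _ xp)).
- by exists K => //; exists x0.
Qed.

(** The same argument for x [tail x], which grows geometrically along doublings when alpha < 1. *)
Lemma abs_moment_bound : alpha < 1 -> exists2 K : R, 0 <= K & exists2 x0 : R, 0 < x0 &
  forall x, x0 <= x -> abs_moment x <= K * (x * tail x).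
Proof.
move=> a1; have /andP[a0 a2] := alpha02.
have p2 : 1 / 2 < 2 `^ (- alpha).
  have -> : 1 / 2 = 2 `^ (- 1) :> R by rewrite powR_inv1// mul1r.
  by apply: powR2_lt; rewrite ltrN2.
pose s := (1 / 2 + 2 `^ (- alpha)) / 2.
have [s1 s2] : 1 / 2 < s /\ s < 2 `^ (- alpha) by rewrite /s; split; lra.
have [x0 x0p H] := tail_lower (ltr0Sn R 1) s2.
have [|||||x x0x|x x0x|x x0x|x /andP[x0x xx0]|K K0 HK] :=
  @doubling_bound R abs_moment (fun x => x * tail x) x0 (1 / (2 * s)) 2 (2 * x0) (x0 * tail (2 * x0)) => //.
- by rewrite divr_gt0 ?mulr_gt0//= ?ltr_pdivrMr; lra.
- by lra.
- by rewrite mulr_gt0.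
- by rewrite mulr_ge0 ?(ltW (tail_gt0 _))//; lra.
- by apply: abs_moment_double; lra.
- have sp : 0 < s by lra.
  have e : 1 / (2 * s) * ((2 * x) * tail (2 * x)) = x * (tail (2 * x) / s).
    by field; rewrite gt_eqF.
  by rewrite e ler_wpM2l//; [lra|rewrite ler_pdivlMr// mulrC H].
- split; last first.
    by rewrite ler_pM ?(ltW (tail_gt0 _))// ?le_tail//; lra.
  have xp : 0 <= x by lra.
  rewrite -(Ex_cst P (2 * x0)); apply: le_Ex; first exact/bounded_mfun_abs/bounded_trunc.
    exact: bounded_mfun_cst.
  by move=> w; rewrite (le_trans (trunc_le _ xp)).
- by exists K => //; exists x0.
Qed.

(** For alpha > 1, x [tail x] decays geometrically along doublings. As the full mean is 0, the
    truncated mean is minus the sum of the shells above x, a series dominated by its first term. *)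
Lemma trunc_mean_bound_gt1 : 1 < alpha ->
  (forall x, 0 < x -> (fun k => trunc_mean (2 ^+ k * x)) @ \oo --> 0) ->
  exists2 K : R, 0 <= K & exists2 x0 : R, 0 < x0 &
  forall x, x0 <= x -> `|trunc_mean x| <= K * (x * tail x).
Proof.
move=> a1 m0; have /andP[a0 a2] := alpha02.
have p2 : 2 `^ (- alpha) < 1 / 2.
  have -> : 1 / 2 = 2 `^ (- 1) :> R by rewrite powR_inv1// mul1r.
  by apply: powR2_lt; rewrite ltrN2.
pose s := (1 / 2 + 2 `^ (- alpha)) / 2.
have [s1 s2] : s < 1 / 2 /\ 2 `^ (- alpha) < s by rewrite /s; split; lra.
have [x0 x0p H] := tail_upper (ltr0Sn R 1) s2.
(* The fixed point of K = 2 + 2 s K: one shell, plus the bound for the shells above 2 x. *)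
pose K := 2 / (1 - 2 * s).
have K0 : 0 <= K by rewrite divr_ge0//; lra.
have KE : 2 + K * (2 * s) = K by rewrite /K; field; rewrite gt_eqF//; lra.
exists K => //; exists x0 => //.
have step (k : nat) : forall x, x0 <= x -> `|trunc_mean (2 ^+ k * x) - trunc_mean x| <= K * (x * tail x).
  elim: k => [|k IH] x x0x.
    by rewrite expr0 mul1r subrr normr0 mulr_ge0// mulr_ge0 ?(ltW (tail_gt0 _))//; lra.
  have xp : 0 < x by lra.
  have h1 := trunc_mean_double (ltW xp).
  have h2 := IH (2 * x) ltac:(lra).
  have h3 := H x x0x.
  have -> : 2 ^+ k.+1 * x = 2 ^+ k * (2 * x) by rewrite exprSr mulrA.
  have h4 : K * (2 * x * tail (2 * x)) <= K * (2 * s) * (x * tail x).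
    have -> : K * (2 * s) * (x * tail x) = K * (2 * x * (s * tail x)) by ring.
    by rewrite ler_wpM2l// ler_wpM2l//; lra.
  have := ler_distD (trunc_mean (2 * x)) (trunc_mean (2 ^+ k * (2 * x))) (trunc_mean x).
  move/le_trans; apply.
  have -> : K * (x * tail x) = K * (2 * s) * (x * tail x) + 2 * (x * tail x) by rewrite -mulrDl addrC KE.
  by rewrite lerD// (le_trans h2).
move=> x x0x; apply/ler_addgt0Pr => e e0.
have /cvgr_dist_le /(_ e e0) := m0 x (lt_le_trans x0p x0x).
move=> [N _ /(_ N (leqnn N))] /=; rewrite sub0r normrN => h.
have := step N x x0x; rewrite distrC => h2.
have := ler_distD (trunc_mean (2 ^+ N * x)) (trunc_mean x) 0; rewrite !subr0 => h3.
by rewrite (le_trans h3)// lerD.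
Qed.

(** The three regimes of the centering condition. At alpha = 1 neither geometric argument applies,
    and symmetry makes the truncated mean vanish. *)
Lemma trunc_mean_bound :
  (1 < alpha -> forall x, 0 < x -> (fun k => trunc_mean (2 ^+ k * x)) @ \oo --> 0) ->
  (alpha = 1 -> forall x, trunc_mean x = 0) ->
  exists2 K : R, 0 <= K & exists2 x0 : R, 0 < x0 &
  forall x, x0 <= x -> `|trunc_mean x| <= K * (x * tail x).
Proof.
move=> h1 hs; have [a1|a1|a1] := ltgtP alpha 1.
- have [K K0 [x0 x0p H]] := abs_moment_bound a1.
  exists K => //; exists x0 => // x x0x; apply: le_trans (H x x0x).
  by apply: norm_Ex; apply: bounded_trunc; lra.
- exact: trunc_mean_bound_gt1 (h1 a1).
- exists 0 => //; exists 1 => // x x1; rewrite hs// normr0 mul0r//.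
Qed.

Lemma trunc1_scale (b y : R) : b != 0 -> trunc 1 (b * y) = b * trunc `|b|^-1 y.
Proof.
move=> b0; rewrite /trunc normrM.
rewrite -[`|y| <= _](ler_pM2l (_ : 0 < `|b|)) ?normr_gt0// divff ?normr_eq0//.
by case: ifP => // _; rewrite mulr0.
Qed.

(** Truncating b xi at 1 is truncating xi at x = 1 / |b|. The powers of x in Karamata's bounds
    cancel those of b and leave the tail at x, which is T(b). *)
Lemma trunc_moments_bound :
  (1 < alpha -> forall x, 0 < x -> (fun k => trunc_mean (2 ^+ k * x)) @ \oo --> 0) ->
  (alpha = 1 -> forall x, trunc_mean x = 0) ->
  exists2 K : R, 0 <= K & exists2 r : R, 0 < r & forall b, `|b| <= r ->
    Ex P (fun w => trunc 1 (b * xi w) ^+ 2) <= K * pr_gt1 b /\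
    `|Ex P (fun w => trunc 1 (b * xi w))| <= K * pr_gt1 b.
Proof.
move=> h1 hs; have [K1 K10 [x1 x1p H1]] := moment2_bound.
have [K2 K20 [x2 x2p H2]] := trunc_mean_bound h1 hs.
exists (K1 + K2); first by rewrite addr_ge0.
exists (Num.min x1^-1 x2^-1); first by rewrite lt_min !invr_gt0 x1p x2p.
move=> b; rewrite le_min => /andP[b1 b2].
have [->|b0] := eqVneq b 0.
  rewrite pr_gt1_0 mulr0; under eq_fun do rewrite mul0r /trunc if_same expr0n/=.
  under [X in _ /\ `|Ex P X| <= 0]eq_fun do rewrite mul0r /trunc if_same.
  by rewrite !Ex_cst normr0.
have bp : 0 < `|b| by rewrite normr_gt0.
have xb1 : x1 <= `|b|^-1 by rewrite -lef_pV2 ?posrE ?invr_gt0// invrK.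
have xb2 : x2 <= `|b|^-1 by rewrite -lef_pV2 ?posrE ?invr_gt0// invrK.
split.
- under eq_fun do rewrite (trunc1_scale _ b0) exprMn.
  rewrite ExZ; last exact: bounded_trunc2.
  have := H1 _ xb1; rewrite /moment2 -(ler_pM2l (_ : 0 < b ^+ 2)); last by rewrite exprn_even_gt0.
  move/le_trans; apply; rewrite pr_gt1E//.
  have -> : b ^+ 2 * (K1 * (`|b|^-1 ^+ 2 * tail `|b|^-1)) = K1 * tail `|b|^-1.
    by rewrite -(real_normK (num_real b)); field; rewrite gt_eqF.
  by rewrite ler_wpM2r ?(ltW (tail_gt0 _))// lerDl.
- under eq_fun do rewrite (trunc1_scale _ b0).
  rewrite ExZ; last exact: bounded_trunc.
  rewrite normrM; have := H2 _ xb2; rewrite /trunc_mean -(ler_pM2l bp).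
  move/le_trans; apply; rewrite pr_gt1E//.
  have -> : `|b| * (K2 * (`|b|^-1 * tail `|b|^-1)) = K2 * tail `|b|^-1.
    by field; rewrite gt_eqF.
  by rewrite ler_wpM2r ?(ltW (tail_gt0 _))// lerDr.
Qed.

End Tail.

(** * Series of independent random variables *)

Lemma bigsetU_mem (T : Type) (I : eqType) (s : seq I) (F : I -> set T) i w :
  i \in s -> F i w -> (\big[setU/set0]_(j <- s) F j) w.
Proof.
elim: s => // j s IH; rewrite inE big_cons => /orP[/eqP <-|/IH h] Fw; first by left.
by right; exact: h.
Qed.

Section SumsOfIndependent.
Context {R : realType} {d} {T : measurableType d} (P : probability T R).
Context {I : eqType} (Y : I -> T -> R).
Hypothesis mY : forall i, measurable_fun setT (Y i).
Hypothesis indY : mutually_independent P Y.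

(** A new summand is independent of the sum of the others, so the cross term is a product of means;
    the means then add up to the square of their total bound. *)
Lemma sum_second_moment (g : I -> R -> R) (v m : I -> R) (s : seq I) :
  (forall i, bounded_mfun (g i)) -> uniq s ->
  (forall i, i \in s -> Ex P (fun w => g i (Y i w) ^+ 2) <= v i) ->
  (forall i, i \in s -> `|Ex P (fun w => g i (Y i w))| <= m i) ->
  Ex P (fun w => (\sum_(i <- s) g i (Y i w)) ^+ 2) <=
    \sum_(i <- s) v i + (\sum_(i <- s) m i) ^+ 2 /\
  `|Ex P (fun w => \sum_(i <- s) g i (Y i w))| <= \sum_(i <- s) m i.
Proof.
move=> bg; have mg i : measurable_fun setT (g i) by case: (bg i).
have bgY i : bounded_mfun (fun w => g i (Y i w)).
  case: (bg i) => mgi [M hM]; apply: (@bounded_mfunW _ _ _ _ M) => //.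
  exact: (measurableT_comp mgi).
have bsq (f : T -> R) : bounded_mfun f -> bounded_mfun (fun w => f w ^+ 2).
  by move=> bf; rewrite (_ : (fun _ => _) = fun w => f w * f w); [exact: bounded_mfunM|
    apply/funext => w; rewrite expr2].
elim: s => [|i s IH] /=.
  move=> _ _ _; rewrite !big_nil expr0n/= addr0.
  under eq_fun do rewrite big_nil expr0n/=.
  under [X in _ /\ `|Ex P X| <= 0]eq_fun do rewrite big_nil.
  by rewrite !Ex_cst normr0.
move=> /andP[si us] hv hm.
have [|||h1 h2] := IH => //; first by move=> j js; apply: hv; rewrite inE js orbT.
  by move=> j js; apply: hm; rewrite inE js orbT.
have hvi := hv i (mem_head _ _); have hmi := hm i (mem_head _ _).
set S := fun w => \sum_(i <- s) g i (Y i w) in h1 h2 *.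
have bS : bounded_mfun S by exact: bounded_mfun_sum.
have bi := bgY i; have mi := bounded_mfun_measurable bi.
have iS : independent2 P (fun w => g i (Y i w)) S.
  apply: (measurable_wrt_independent2 mY indY (s1 := [:: i]) (s2 := s)).
  - by rewrite /= si.
  - by apply: measurable_wrt_comp => //; rewrite mem_head.
  - exact: measurable_wrt_sum.
split; last first.
  under eq_fun do rewrite big_cons; rewrite ExD// big_cons.
  by rewrite (le_trans (ler_normD _ _))// lerD.
(* [Ex_independent2] wants bounded functions of the two variables. Truncations at the bounds M1 and
   M2 play this role without changing any value. *)
have cross : Ex P (fun w => g i (Y i w) * S w) = Ex P (fun w => g i (Y i w)) * Ex P S.
  case: (bgY i) => m1 [M1 H1]; case: bS => m2 [M2 H2].
  have := Ex_independent2 m1 m2 iS (f := trunc M1) (g := trunc M2).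
  have M10 : 0 <= M1 by apply: le_trans (H1 point); exact: normr_ge0.
  have M20 : 0 <= M2 by apply: le_trans (H2 point); exact: normr_ge0.
  have bt (M : R) : 0 <= M -> bounded_mfun (trunc M : R -> R).
    by move=> M0; apply: (@bounded_mfunW _ _ _ _ M); [exact: measurable_trunc|move=> y; exact: trunc_le].
  move=> /(_ (bt _ M10) (bt _ M20)).
  have -> : (fun x => trunc M1 (g i (Y i x)) * trunc M2 (S x)) = (fun w => g i (Y i w) * S w).
    by apply/funext => w; rewrite /trunc H1 H2.
  have -> : trunc M1 \o (fun w => g i (Y i w)) = (fun w => g i (Y i w)).
    by apply/funext => w; rewrite /trunc/= H1.
  by have -> : trunc M2 \o S = S by apply/funext => w; rewrite /trunc/= H2.
have -> : (fun w => (\sum_(i <- i :: s) g i (Y i w)) ^+ 2) =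
    (fun w => (g i (Y i w) ^+ 2 + 2 * (g i (Y i w) * S w)) + S w ^+ 2).
  by apply/funext => w; rewrite big_cons -/(S w); ring.
have bgS : bounded_mfun (fun w => g i (Y i w) * S w) by exact: bounded_mfunM.
rewrite ExD; [|by apply: bounded_mfunD; [exact: bsq|exact: bounded_mfunZ]|exact: bsq].
rewrite ExD; [|exact: bsq|exact: bounded_mfunZ].
rewrite ExZ// cross !big_cons.
have h3 : Ex P (fun w => g i (Y i w)) * Ex P S <= m i * \sum_(j <- s) m j.
  by rewrite (le_trans (ler_norm _))// normrM ler_pM.
have h1' : Ex P (fun w => S w ^+ 2) <= \sum_(j <- s) v j + (\sum_(j <- s) m j) ^+ 2 := h1.
have := sqr_ge0 (m i); move: h1' hvi h3.
set e1 := Ex P (fun w => S w ^+ 2); set e2 := Ex P (fun w => g i (Y i w) ^+ 2).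
set e3 := _ * Ex P S; set b := \sum_(j <- s) m j; set c := \sum_(j <- s) v j.
rewrite sqrrD; set x := m i ^+ 2; set y := b ^+ 2; set z := m i * b.
by rewrite mulr2n; lra.
Qed.

Context (xi : T -> R) (alpha : R).
Hypothesis mxi : measurable_fun setT xi.
Hypothesis eq_law : forall i B, measurable B -> P (Y i @^-1` B) = P (xi @^-1` B).

Variables (K r : R).
Hypothesis K0 : 0 <= K.
Hypothesis moments : forall b, `|b| <= r ->
    Ex P (fun w => trunc 1 (b * xi w) ^+ 2) <= K * pr_gt1 P xi b /\
    `|Ex P (fun w => trunc 1 (b * xi w))| <= K * pr_gt1 P xi b.

Lemma pr_law i (b e : R) : pr P [set w | e < `|b * Y i w|] = pr P [set w | e < `|b * xi w|].
Proof.
have := @eq_law i [set y | e < `|b * y|] (measurable_gt_abs _ (measurable_scale b)).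
by rewrite /pr => ->.
Qed.

(** Unless some |b_i Y_i| exceeds 1, the sum equals the sum of the terms truncated at 1, to which
    Chebyshev's inequality applies. *)
Lemma pr_sum_le (s : seq I) (b : I -> R) : uniq s -> (forall i, i \in s -> `|b i| <= r) ->
  pr P [set w | 1 < `|\sum_(i <- s) b i * Y i w|] <= (1 + 2 * K) * \sum_(i <- s) pr_gt1 P xi (b i).
Proof.
move=> us br.
have mbY i : measurable_fun setT (fun w => b i * Y i w) by exact: measurable_funZ.
have mS : measurable_fun setT (fun w => \sum_(i <- s) b i * Y i w) by exact: measurable_sum.
set S := \sum_(i <- s) pr_gt1 P xi (b i).
have S0 : 0 <= S by apply: sumr_ge0 => i _; exact: pr_gt1_ge0.
(* If K S > 1 the claimed bound exceeds 1. Otherwise the squared mean (K S)^2 is at most K S. *)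
have [KS1|KS1] := leP (K * S) 1; last first.
  apply: le_trans (pr_le1 _ _) _; first exact: measurable_gt_abs.
  by rewrite mulrDl; lra.
pose g i := fun y : R => trunc 1 (b i * y).
have bg i : bounded_mfun (g i).
  apply: (@bounded_mfunW _ _ _ _ 1); last by move=> y; exact: trunc_le.
  exact: (measurableT_comp (measurable_trunc 1) (measurable_scale (b i))).
have Eg (f : R -> R) i : bounded_mfun f -> Ex P (fun w => f (Y i w)) = Ex P (fun w => f (xi w)).
  by move=> bf; exact: (Ex_eq_law (mY i) mxi (@eq_law i) bf).
have bg2 i : bounded_mfun (fun y => g i y ^+ 2).
  by rewrite (_ : (fun _ => _) = fun y => g i y * g i y); [exact: bounded_mfunM|
    apply/funext => w; rewrite expr2].
have [h1 _] := @sum_second_moment g (fun i => K * pr_gt1 P xi (b i)) (fun i => K * pr_gt1 P xi (b i)) s bg us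
  (fun i si => ltac:(rewrite (Eg _ _ (bg2 i)); exact: (moments (br _ si)).1))
  (fun i si => ltac:(rewrite (Eg _ _ (bg i)); exact: (moments (br _ si)).2)).
set A := fun w => \sum_(i <- s) g i (Y i w) in h1.
have bA : bounded_mfun A.
  apply: bounded_mfun_sum => i; case: (bg i) => mgi [M hM].
  by apply: (@bounded_mfunW _ _ _ _ M) => //; exact: (measurableT_comp mgi).
have mA := bounded_mfun_measurable bA.
have hA : pr P [set w | 1 < `|A w|] <= 2 * K * S.
  have := markov_sqr P ltr01 bA; rewrite expr1n divr1 => /le_trans; apply.
  apply: le_trans h1 _; rewrite -mulr_sumr -/S.
  have : (K * S) ^+ 2 <= K * S * 1 by rewrite expr2 ler_wpM2l// mulr_ge0.
  lra.
rewrite mulrDl mul1r; apply: le_trans (_ : pr P (\big[setU/set0]_(i <- s) [set w | 1 < `|b i * Y i w|]) + _ <= _).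
  apply: (@pr_le_setU _ _ _ _ _ _ [set w | 1 < `|A w|]).
  - exact: measurable_gt_abs.
  - by apply: bigsetU_measurable => i _; exact: measurable_gt_abs.
  - exact: measurable_gt_abs.
  - move=> w /= hw.
    have [[i si hi]|hn] := pselect (exists2 i, i \in s & 1 < `|b i * Y i w|); first by left; exact: (bigsetU_mem si).
    right; rewrite /A; move: hw; rewrite !big_seq (eq_bigr (fun i => g i (Y i w)))// => i si.
    by rewrite /g /trunc; case: leP => // h; exfalso; apply: hn; exists i.
apply: lerD => //; apply: le_trans (pr_bigU _ _ _) _; first by move=> i; exact: measurable_gt_abs.
by rewrite /S; apply: ler_sum => i _; rewrite pr_law.
Qed.

Lemma pr_sum_le_scaled (e : R) (s : seq I) (b : I -> R) : 0 < e -> uniq s ->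
  (forall i, i \in s -> `|b i / e| <= r) ->
  pr P [set w | e < `|\sum_(i <- s) b i * Y i w|] <= (1 + 2 * K) * \sum_(i <- s) pr_gt1 P xi (b i / e).
Proof.
move=> e0 us br; have := pr_sum_le us br; congr (pr P _ <= _).
apply/seteqP; split => w /=.
all: have -> : \sum_(i <- s) b i / e * Y i w = (\sum_(i <- s) b i * Y i w) / e
  by rewrite mulr_suml; apply: eq_bigr => i _; ring.
all: by rewrite normrM (gtr0_norm (_ : 0 < e^-1)) ?invr_gt0// ltr_pdivlMr// mul1r.
Qed.

End SumsOfIndependent.

Section IndependentSeries.
Context {R : realType} {d} {T : measurableType d} (P : probability T R).
Context {I : eqType} (Y : I -> T -> R) (b : I -> R) (e : nat -> I).
Hypothesis mY : forall i, measurable_fun setT (Y i).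
Hypothesis indY : mutually_independent P Y.
Hypothesis e_inj : injective e.

Definition block_sum (m n : nat) (w : T) : R := \sum_(m <= k < n) b (e k) * Y (e k) w.

Definition block (m n : nat) : seq I := [seq e k | k <- index_iota m n].

Lemma block_sum_wrt (s : seq I) m n : {subset block m n <= s} -> measurable_wrt Y s (block_sum m n).
Proof.
move=> ss; rewrite (_ : block_sum m n = fun w => \sum_(i <- block m n) b i * Y i w).
  by apply: (@measurable_wrt_sum _ _ _ _ _ _ _ (fun i y => b i * y)) => // i; exact: measurable_scale.
by apply/funext => w; rewrite big_map.
Qed.

Lemma measurable_block_sum m n : measurable_fun setT (block_sum m n).
Proof. by apply: measurable_sum => k; exact: measurable_funZ. Qed.

Lemma uniq_block_cat m n p : (m <= n)%N -> (n <= p)%N -> uniq (block m n ++ block n p).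
Proof.
move=> mn np; rewrite -map_cat map_inj_uniq//.
rewrite cat_uniq !iota_uniq /= andbT; apply/hasPn => k.
by rewrite !mem_index_iota => /andP[nk _]; apply/negP => /andP[_]; rewrite ltnNge nk.
Qed.

Lemma sub_block m n p : (n <= p)%N -> {subset block m n <= block m p}.
Proof.
move=> np _ /mapP[k + ->]; rewrite mem_index_iota => /andP[mk kn].
by apply: map_f; rewrite mem_index_iota mk (leq_trans kn).
Qed.

Lemma sigma_of_abs (s : seq I) (f : T -> R) (c : R) : measurable_wrt Y s f ->
  sigma_of Y s [set w | c < `|f w|].
Proof.
move=> mf; rewrite (_ : [set _ | _] = f @^-1` [set y | c < `|y|]) //.
by apply: measurable_wrt_preimage => //; exact: (measurable_gt_abs c (@measurable_id _ R setT)).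
Qed.

Definition exceeds (c : R) (m j : nat) : set T := [set w | c < `|block_sum m (m + j) w|].

Lemma sigma_of_seqDU c m j : sigma_of Y (block m (m + j)) (seqDU (exceeds c m) j).
Proof.
have F i : (i <= j)%N -> sigma_of Y (block m (m + j)) (exceeds c m i).
  by move=> ij; apply: sigma_of_abs; apply: block_sum_wrt; apply: sub_block; rewrite leq_add2l.
pose G : algebraOfSetsType _ := g_sigma_algebraType (rectangles Y (block m (m + j))).
apply: (@measurableD _ G); first exact: F.
apply: (@bigsetU_measurable _ G) => i _.
by apply: F; exact: ltnW.
Qed.

(** Ottaviani's maximal inequality. Split according to the first j at which the block sum exceeds 2
    c; the remaining block is independent of that event and stays below c with probability at least
    1/2, in which case the whole sum exceeds c. *)
Lemma ottaviani (c : R) (m J : nat) :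
  (forall j, (j <= J)%N -> pr P [set w | c < `|block_sum (m + j) (m + J) w|] <= 1 / 2) ->
  pr P (\big[setU/set0]_(j < J.+1) exceeds (2 * c) m j) <=
    2 * pr P [set w | c < `|block_sum m (m + J) w|].
Proof.
move=> half.
have mF j : measurable (exceeds (2 * c) m j).
  by apply: measurable_gt_abs; exact: measurable_block_sum.
have mD j : measurable (seqDU (exceeds (2 * c) m) j).
  by apply: measurableD => //; exact: bigsetU_measurable.
have mE : measurable [set w | c < `|block_sum m (m + J) w|].
  by apply: measurable_gt_abs; exact: measurable_block_sum.
pose G j := ~` [set w | c < `|block_sum (m + j) (m + J) w|].
have mG j : measurable (G j).
  by apply: measurableC; apply: measurable_gt_abs; exact: measurable_block_sum.
(* First passage at j followed by a small remainder. The empty value beyond J makes this a disjoint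
   family over all of nat. *)
pose H j := if (j <= J)%N then seqDU (exceeds (2 * c) m) j `&` G j else set0.
have mH j : measurable (H j) by rewrite /H; case: ifP => // _; exact: measurableI.
have tH : trivIset setT H.
  move=> i j _ _ [w [Hi Hj]]; apply: (@trivIset_seqDU _ (exceeds (2 * c) m) i j Logic.I Logic.I).
  exists w; split; [move: Hi; rewrite /H|move: Hj; rewrite /H];
    by case: ifP => // _ [].
have sH : \big[setU/set0]_(j < J.+1) H j `<=` [set w | c < `|block_sum m (m + J) w|].
  rewrite -bigcup_mkord => w [j /= jJ]; rewrite /H -ltnS jJ => -[[+ _]]; rewrite /G /exceeds/=.
  move=> h1 /negP; rewrite -leNgt => h2.
  have E : block_sum m (m + J) w = block_sum m (m + j) w + block_sum (m + j) (m + J) w.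
    by rewrite /block_sum -big_cat_nat// ?leq_addr// leq_add2l.
  rewrite E; set x := block_sum m (m + j) w in h1 *; set y := block_sum _ _ w in h2 *.
  have := ler_normD (x + y) (- y); rewrite addrK normrN; lra.
have PD j : (j <= J)%N -> pr P (seqDU (exceeds (2 * c) m) j) <= 2 * pr P (H j).
  move=> jJ; rewrite /H jJ.
  have us : uniq (block m (m + j) ++ block (m + j) (m + J)).
    by apply: uniq_block_cat; rewrite ?leq_addr// leq_add2l.
  have sG : sigma_of Y (block (m + j) (m + J)) (G j).
    pose GT : algebraOfSetsType _ := g_sigma_algebraType (rectangles Y (block (m + j) (m + J))).
    apply: (@measurableC _ GT).
    by apply: sigma_of_abs; exact: block_sum_wrt.
  have := sigma_of_product_rule mY indY us (@sigma_of_seqDU (2 * c) m j) sG.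
  rewrite !(EFin_pr P)//; [|exact: measurableI] => -[->].
  have : 1 / 2 <= pr P (G j).
    rewrite pr_setC; last by apply: measurable_gt_abs; exact: measurable_block_sum.
    by have := half j jJ; lra.
  move=> h; have := ler_wpM2l (pr_ge0 P (seqDU (exceeds (2 * c) m) j)) h; lra.
rewrite bigsetU_seqDU.
have eqD : pr P (\big[setU/set0]_(j < J.+1) seqDU (exceeds (2 * c) m) j) =
    \sum_(j < J.+1) pr P (seqDU (exceeds (2 * c) m) j).
  apply: EFin_inj; rewrite -(EFin_pr P); last exact: bigsetU_measurable.
  rewrite (measure_bigsetU P mD (@trivIset_seqDU _ _)).
  by rewrite -sumEFin; apply: eq_bigr => i _; exact: (EFin_pr P (mD i)).
have eqH : pr P (\big[setU/set0]_(j < J.+1) H j) = \sum_(j < J.+1) pr P (H j).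
  apply: EFin_inj; rewrite -(EFin_pr P); last exact: bigsetU_measurable.
  rewrite (measure_bigsetU P mH tH) -sumEFin.
  by apply: eq_bigr => i _; exact: (EFin_pr P (mH i)).
rewrite eqD; apply: le_trans (_ : 2 * \sum_(j < J.+1) pr P (H j) <= _).
  by rewrite mulr_sumr; apply: ler_sum => j _; apply: PD; rewrite -ltnS.
rewrite ler_wpM2l// -eqH; apply: le_pr => //.
exact: bigsetU_measurable.
Qed.

Lemma pr_bigcup_le (F : nat -> set T) (c : R) : (forall j, measurable (F j)) ->
  (forall J, pr P (\big[setU/set0]_(j < J.+1) F j) <= c) -> pr P (\bigcup_j F j) <= c.
Proof.
move=> mF h.
have mU : measurable (\bigcup_j F j) by exact: bigcup_measurable.
rewrite -lee_fin -(EFin_pr P)//.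
have := @nondecreasing_cvg_mu _ _ _ P (fun J => \big[setU/set0]_(j < J.+1) F j).
rewrite bigcup_bigsetU_bigcup => /(_ _ mU) H.
have {}H : (P \o (fun J => \big[setU/set0]_(j < J.+1) F j)) @ \oo --> P (\bigcup_j F j).
  apply: H; first by move=> J; exact: bigsetU_measurable.
  by move=> i j ij; apply/subsetPset; apply: subset_bigsetU.
rewrite -(cvg_lim _ H)//; apply: lime_le; first by apply/cvg_ex; eexists; exact: H.
apply: nearW => J /=; rewrite (EFin_pr P); last exact: bigsetU_measurable.
by rewrite lee_fin; exact: h.
Qed.

Hypothesis cauchy_in_probability : forall c eta : R, 0 < c -> 0 < eta ->
  exists N, forall m n, (N <= m)%N -> pr P [set w | c < `|block_sum m n w|] <= eta.

(** For independent terms, being Cauchy in probability implies almost sure convergence. By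
    Ottaviani's inequality it is unlikely that some block starting at a large N exceeds 2 c, so the
    event that every start has such a block is null. *)
Lemma ae_cvg_series : {ae P, forall w, cvgn (fun n => block_sum 0 n w)}.
Proof.
pose Bad c := \bigcap_m \bigcup_j exceeds c m j.
have mB c : measurable (Bad c).
  apply: bigcap_measurable => // m _; apply: bigcup_measurable => j _.
  by apply: measurable_gt_abs; exact: measurable_block_sum.
have mU c m : measurable (\bigcup_j exceeds c m j).
  by apply: bigcup_measurable => j _; apply: measurable_gt_abs; exact: measurable_block_sum.
have B0 (c : R) : 0 < c -> P (Bad (2 * c)) = 0.
  move=> c0; rewrite (EFin_pr P)//; congr EFin; apply/eqP; rewrite eq_le pr_ge0 andbT.
  apply/ler_addgt0Pr => eta eta0; rewrite add0r.
  have [||N HN] := @cauchy_in_probability c (Num.min (1 / 2) (eta / 2)) => //.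
    by rewrite lt_min !divr_gt0.
  apply: le_trans (_ : pr P (\bigcup_j exceeds (2 * c) N j) <= _).
    by apply: le_pr => // w; exact.
  apply: pr_bigcup_le => [j|J]; first by apply: measurable_gt_abs; exact: measurable_block_sum.
  apply: le_trans (ottaviani _) _.
    move=> j _; apply: le_trans (HN _ _ (leq_addr _ _)) _.
    by rewrite ge_min lexx.
  have := HN N (N + J)%N (leqnn N); rewrite le_min => /andP[_]; lra.
have neg : P.-negligible (\bigcup_q Bad (2 * q.+1%:R^-1)).
  by apply: negligible_bigcup => q; exists (Bad (2 * q.+1%:R^-1)); split => //; apply: B0.
apply: negligibleS neg => w /= ncv; apply: contrapT => nb; apply: ncv.
have hq (q : nat) : exists m, forall j, `|block_sum m (m + j) w| <= 2 * q.+1%:R^-1.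
  apply: contrapT => hn; apply: nb; exists q => // m _.
  apply: contrapT => hj; apply: hn; exists m => j; rewrite leNgt; apply/negP => hlt.
  by apply: hj; exists j.
apply: cauchy_cvg; apply: cauchy_exP => eps eps0.
have [m hm] := hq (Num.truncn (2 / eps)).
exists (block_sum 0 m w); exists m => // n /= mn.
rewrite -ball_normE/= distrC.
have -> : block_sum 0 n w - block_sum 0 m w = block_sum m n w.
  by rewrite /block_sum (big_cat_nat _ (n := m))//= addrAC subrr add0r.
have := hm (n - m)%N; rewrite subnKC// => /le_lt_trans; apply.
rewrite ltr_pdivrMr// mulrC -ltr_pdivrMr//.
by have /andP[] := @truncn_itv _ (2 / eps) ltac:(by rewrite divr_ge0// ltW).
Qed.

End IndependentSeries.

(** * Measurability of limits, and almost sure against stochastic convergence *)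

Section MeasurableLimits.
Context {R : realType} {d} {T : measurableType d}.

Lemma measurable_cvg_set (f : nat -> T -> R) : (forall n, measurable_fun setT (f n)) ->
  measurable [set w | cvgn (f ^~ w)].
Proof.
move=> mf.
have -> : [set w | cvgn (f ^~ w)] = \bigcap_(q : nat) \bigcup_(m : nat) \bigcap_(j : nat)
    [set w | `|f (m + j)%N w - f m w| <= q.+1%:R^-1].
  apply/seteqP; split => w /=.
    move=> /cvg_ex[/= l cw] q _.
    have /cvgr_dist_le /(_ (q.+1%:R^-1 / 2)) := cw.
    rewrite divr_gt0// => /(_ isT) [m _ hm]; exists m => // j _ /=.
    have h1 := hm m (leqnn m); have h2 := hm (m + j)%N (leq_addr _ _).
    rewrite /= in h1 h2.
    have := ler_distD l (f (m + j)%N w) (f m w).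
    by move/le_trans; apply; rewrite [leRHS]splitr lerD// distrC.
  move=> h; apply: cauchy_cvg; apply: cauchy_exP => eps eps0.
  have [m _ hm] := h (Num.truncn (eps^-1)) Logic.I.
  exists (f m w); exists m => // n /= mn.
  rewrite -ball_normE/= distrC.
  have := hm (n - m)%N Logic.I; rewrite /= subnKC// => /le_lt_trans; apply.
  rewrite invf_plt ?posrE//.
  by have /andP[] := @truncn_itv _ eps^-1 ltac:(by rewrite invr_ge0 ltW).
apply: bigcap_measurable => // q _; apply: bigcup_measurable => m _.
apply: bigcap_measurable => // j _; apply: measurable_le_abs.
exact: measurable_funB.
Qed.

(** [limn] takes the value [point] where there is no convergence. Replacing f n by [point] off the
    measurable convergence set gives a sequence that converges everywhere to the same function. *)
Lemma measurable_limn (f : nat -> T -> R) : (forall n, measurable_fun setT (f n)) ->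
  measurable_fun setT (fun w => limn (f ^~ w)).
Proof.
move=> mf; have mC := measurable_cvg_set mf.
set C := [set w | cvgn (f ^~ w)] in mC.
apply: (@measurable_fun_cvg _ _ R setT
  (fun (n : nat) (w : T) => \1_C w * f n w + (1 - \1_C w) * (point : R))).
  move=> n; apply: measurable_funD.
    by apply: measurable_funM => //; exact: measurable_indic.
  apply: measurable_funM; last exact: measurable_cst.
  by apply: measurable_funB; [exact: measurable_cst|exact: measurable_indic].
move=> w _; rewrite indicE; have [/set_mem Cw|nC] := boolP (w \in C).
  under eq_fun do rewrite mul1r subrr mul0r addr0; exact: Cw.
rewrite dvgP; last by move=> h; move: nC; rewrite notin_setE; apply.
under eq_fun do rewrite mul0r subr0 mul1r add0r.
exact: cvg_cst.
Qed.

(** Bounded convergence applies to min(e, |g - f_n|), which dominates e times the indicator of the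
    event. *)
Lemma ae_cvg_pr (P : probability T R) (f : nat -> T -> R) (g : T -> R) :
  (forall n, measurable_fun setT (f n)) -> measurable_fun setT g ->
  {ae P, forall w, f ^~ w @ \oo --> g w} ->
  forall e eta : R, 0 < e -> 0 < eta ->
  \forall n \near \oo, pr P [set w | e < `|g w - f n w|] <= eta.
Proof.
move=> mf mg cf e eta e0 eta0.
have mD n : measurable_fun setT (fun w => g w - f n w) by exact: measurable_funB.
have H : (fun n => Ex P (fun w => Num.min e `|g w - f n w|)) @ \oo --> Ex P (fun _ => 0).
  apply: (@Ex_dct _ _ _ _ _ _ e).
  - by move=> n; exact: bounded_mfun_measurable (bounded_mfun_min (ltW e0) (mD n)).
  - exact: measurable_cst.
  - move=> n w; rewrite ger0_norm ?ge_min ?lexx// le_min (ltW e0)/=; exact: normr_ge0.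
  - apply: filterS cf => w cw; apply/cvgrPdist_le => k k0.
    have /cvgr_dist_le /(_ k k0) := cw; apply: filterS => n h.
    rewrite sub0r normrN ger0_norm; first by rewrite ge_min h orbT.
    by rewrite le_min (ltW e0)/=; exact: normr_ge0.
rewrite Ex_cst in H.
have /cvgr_dist_le /(_ (e * eta)) := H; rewrite mulr_gt0// => /(_ isT).
apply: filterS => n; rewrite sub0r normrN => h.
rewrite -(ler_pM2l e0); apply: le_trans (le_trans (ler_norm _) h).
have mA := measurable_gt_abs e (mD n).
rewrite -(Ex_indic P mA) -(ExZ P e (bounded_mfun_indic mA)).
apply: le_Ex; first by apply: bounded_mfunZ; exact: bounded_mfun_indic.
  by apply: bounded_mfun_min => //; exact: ltW.
move=> w; rewrite indicE; have [/set_mem/= h1|_] := boolP (w \in _).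
  by rewrite mulr1 le_min lexx ltW.
by rewrite mulr0 le_min (ltW e0)/=.
Qed.

End MeasurableLimits.

(** * Sums indexed by the integers *)

Section IntegerSums.
Context {R : realType}.

Definition zseq (N : nat) : seq int := [seq k%:Z - N%:Z | k <- index_iota 0 (N + N).+1].

Lemma symsumE (u : int -> R) N : symsum u N = \sum_(j <- zseq N) u j.
Proof. by rewrite /symsum /zseq big_map. Qed.

Lemma uniq_zseq N : uniq (zseq N).
Proof. by rewrite map_inj_uniq ?iota_uniq// => x y; lia. Qed.

Lemma mem_zseq N (j : int) : (j \in zseq N) = (`|j| <= N)%N.
Proof.
apply/mapP/idP => [[k + ->]|jN]; first by rewrite mem_index_iota; lia.
exists (absz (j + N%:Z)); last by lia.
by rewrite mem_index_iota; lia.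
Qed.

Lemma sum_seq_le_esum (S : set int) (f : int -> R) (s : seq int) : uniq s ->
  (forall j, j \in s -> S j) ->
  ((\sum_(j <- s) f j)%:E <= \esum_(j in S) (f j)%:E)%E.
Proof.
move=> us sS; apply: esum_ge; exists [set` s]; last by rewrite -fsbig_seq// sumEFin.
by split => [|j]; [exact: finite_seq|exact: sS].
Qed.

(** Some finite set reaches the total up to eta; a finite set disjoint from it can only carry the
    remaining eta. *)
Lemma esum_tail (f : int -> R) : (forall j, 0 <= f j) ->
  (\esum_(j in [set: int]) (f j)%:E < +oo)%E ->
  forall eta : R, 0 < eta -> exists N : nat, forall s, uniq s ->
    (forall j, j \in s -> (N < `|j|)%N) -> \sum_(j <- s) f j <= eta.
Proof.
move=> f0 fin eta eta0.
have finE : (\esum_(j in [set: int]) (f j)%:E)%E \is a fin_num.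
  by rewrite ge0_fin_numE// esum_ge0// => j _; rewrite lee_fin.
have [_ [A [/finite_seqP[r rE] _] <-] hA] := ub_ereal_sup_adherent eta0 finE.
pose r' := undup r.
have rE' : A = [set` r'] by rewrite rE; apply/seteqP; split => j /=; rewrite mem_undup.
move: hA; rewrite rE' -fsbig_seq ?undup_uniq// sumEFin -/(esum _ _) => hA.
exists (\max_(j <- r') `|j|)%N => s us hs.
have usr : uniq (r' ++ s).
  rewrite cat_uniq undup_uniq us andbT /=; apply/hasPn => j js; apply/negP => jr.
  by have := hs _ js; rewrite ltnNge (leq_bigmax_seq _ jr).
have := @sum_seq_le_esum setT f (r' ++ s) usr (fun _ _ => Logic.I).
rewrite big_cat/= -(fineK finE); move: hA; rewrite -(fineK finE) -EFinB lte_fin lee_fin; lra.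
Qed.

(* The enumeration 0, 1, -1, 2, -2, ... makes symsum a subsequence of the partial sums. *)
Definition zenum (k : nat) : int := if odd k then (k./2.+1)%:Z else - (k./2)%:Z.

Lemma zenum_inj : injective zenum.
Proof.
move=> x y; rewrite /zenum; have := odd_double_half x; have := odd_double_half y.
by case: (odd x); case: (odd y) => /=; lia.
Qed.

Lemma symsum_zenum (u : int -> R) N : symsum u N = \sum_(0 <= k < (N + N).+1) u (zenum k).
Proof.
elim: N => [|N IH]; first by rewrite /symsum !big_nat1.
have e1 : zenum (N + N).+1 = N.+1%:Z.
  by rewrite /zenum /= oddD addbb/=; congr (Posz _); lia.
have e2 : zenum (N + N).+2 = - N.+1%:Z.
  by rewrite /zenum /= oddD addbb/=; congr (- Posz _); lia.
have -> : (N.+1 + N.+1).+1 = (N + N).+3 by lia.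
rewrite 2?big_nat_recr//= -IH e1 e2 /symsum.
rewrite (_ : (N.+1 + N.+1).+1 = (N + N).+3); last by lia.
rewrite big_nat_recl// big_nat_recr//=.
rewrite (_ : 0%Z - N.+1%:Z = - N.+1%:Z); last by lia.
rewrite (_ : (N + N).+2%:Z - N.+1%:Z = N.+1%:Z); last by lia.
rewrite [LHS]addrC; congr (_ + _); congr (_ + _).
by apply: eq_bigr => k _; congr u; lia.
Qed.

End IntegerSums.

(** * Levy's continuity theorem *)

Section Fejer.
Context {R : realType}.
Implicit Types x t p : R.

Lemma sin_shift x (k : nat) : sin (x + 2 * pi * k%:R) = sin x.
Proof.
elim: k => [|k IH]; first by rewrite mulr0 addr0.
have -> : x + 2 * pi * k.+1%:R = (x + 2 * pi * k%:R) + pi *+ 2.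
  by rewrite -natr1 mulr2n; ring.
by rewrite mulr2n addrA !sinDpi opprK IH.
Qed.

Lemma cos_sum_telescope p t (N : nat) :
  2 * sin (t / 2) * \sum_(0 <= l < N) cos (p + l%:R * t) =
  sin (p + N%:R * t - t / 2) - sin (p - t / 2).
Proof.
elim: N => [|N IH]; first by rewrite big_nil mulr0 mul0r addr0 subrr.
rewrite big_nat_recr//= mulrDr IH.
set u := p + N%:R * t.
have -> : p + N.+1%:R * t - t / 2 = u + t / 2 by rewrite /u -natr1; field.
by rewrite (sinD u (t / 2)) (sinB u (t / 2)); ring.
Qed.

Lemma cos_sum_bound p t (N : nat) : `|sin (t / 2) * \sum_(0 <= l < N) cos (p + l%:R * t)| <= 1.
Proof.
have := cos_sum_telescope p t N; rewrite -mulrA.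
set x := sin (t / 2) * _; move=> h.
have : `|2 * x| <= 2.
  rewrite h (le_trans (ler_normB _ _))// -[2]/(1 + 1) lerD// ler_norml sin_geN1 sin_le1//.
by rewrite normrM ger0_norm//; lra.
Qed.

(** The Fejer kernel |sum_{m < N} exp(i m x)|^2 / N^2, normalised to be 1 at 0 when N > 0, so that
    its N translates by multiples of 2 pi / N add up to 1. *)
Definition fejer (N : nat) x : R :=
  ((\sum_(0 <= m < N) cos (m%:R * x)) ^+ 2 + (\sum_(0 <= m < N) sin (m%:R * x)) ^+ 2) / N%:R ^+ 2.

Lemma fejer_ge0 N x : 0 <= fejer N x.
Proof. by rewrite divr_ge0 ?addr_ge0 ?sqr_ge0. Qed.

Lemma fejer_bound N x (s : R) : 0 < s -> s <= `|sin (x / 2)| -> fejer N x <= 2 / (N%:R * s) ^+ 2.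
Proof.
move=> s0 sx.
have S p : (\sum_(0 <= m < N) cos (p + m%:R * x)) ^+ 2 <= 1 / s ^+ 2.
  have h := cos_sum_bound p x N; move: h; rewrite normrM.
  set y := \sum_(_ <= _ < _) _ => h.
  rewrite ler_pdivlMr ?exprn_gt0// -(real_normK (num_real y)) -exprMn -(expr1n R 2).
  rewrite ler_sqr ?nnegrE ?mulr_ge0// ?(ltW s0)//.
  by apply: le_trans h; rewrite mulrC ler_wpM2r.
have e1 : \sum_(0 <= m < N) cos (m%:R * x) = \sum_(0 <= m < N) cos (0 + m%:R * x).
  by apply: eq_bigr => m _; rewrite add0r.
have e2 : \sum_(0 <= m < N) sin (m%:R * x) = \sum_(0 <= m < N) cos (- (pi / 2) + m%:R * x).
  by apply: eq_bigr => m _; rewrite addrC cosBpihalf.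
rewrite /fejer e1 e2.
have [->|N0] := posnP N; first by rewrite expr0n/= invr0 mulr0 divr_ge0// sqr_ge0.
have Np : (0 : R) < N%:R by rewrite ltr0n.
rewrite ler_pdivrMr ?exprn_gt0//.
have -> : 2 / (N%:R * s) ^+ 2 * N%:R ^+ 2 = 1 / s ^+ 2 + 1 / s ^+ 2.
  by field; rewrite !gt_eqF.
by rewrite lerD.
Qed.

(** Orthogonality of the characters of the cyclic group of order N. Multiplied by 2 sin(t / 2), the
    sum telescopes over a whole number of periods; sin(t / 2) is not 0 because 0 < |m - m'| < N. *)
Lemma cos_nodes_sum0 (N m m' : nat) x : (m < N)%N -> (m' < N)%N -> m != m' ->
  \sum_(0 <= l < N) cos ((m%:R - m'%:R) * (x - l%:R * (2 * pi / N%:R))) = 0.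
Proof.
move=> mN m'N mm'.
have N0 : (0 : R) < N%:R by rewrite ltr0n; case: N mN m'N.
pose t : R := (m'%:R - m%:R) * (2 * pi / N%:R).
pose p : R := (m%:R - m'%:R) * x.
have -> : \sum_(0 <= l < N) cos ((m%:R - m'%:R) * (x - l%:R * (2 * pi / N%:R))) =
    \sum_(0 <= l < N) cos (p + l%:R * t).
  by apply: eq_bigr => l _; congr cos; rewrite /p /t; ring.
have := cos_sum_telescope p t N.
have -> : p + N%:R * t - t / 2 = (p - t / 2 - 2 * pi * m%:R) + 2 * pi * m'%:R.
  by rewrite /t; field; rewrite gt_eqF.
rewrite sin_shift -(sin_shift (p - t / 2 - 2 * pi * m%:R) m) subrK subrr => /eqP.
rewrite mulf_eq0 => /orP[|/eqP//]; rewrite mulf_eq0 pnatr_eq0/= => /eqP s0; exfalso.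
have pos (i j : nat) : (i < j)%N -> (j < N)%N -> 0 < sin ((j%:R - i%:R) * (2 * pi / N%:R) / 2 : R).
  move=> ij jN; apply: sin_gt0_pi.
  have -> : (j%:R - i%:R) * (2 * pi / N%:R) / 2 = pi * ((j%:R - i%:R) / N%:R) :> R by field; rewrite gt_eqF.
  have h0 : (0 : R) < (j%:R - i%:R) / N%:R by rewrite divr_gt0// subr_gt0 ltr_nat.
  have h1 : (j%:R - i%:R) / N%:R < 1 :> R.
    by rewrite ltr_pdivrMr// mul1r ltrBlDr (lt_le_trans (_ : j%:R < N%:R :> R)) ?ltr_nat// lerDl.
  by rewrite mulr_gt0 ?pi_gt0//= gtr_pMr ?pi_gt0.
have [lt|lt|e] := ltngtP m m'.
- by have := pos _ _ lt m'N; rewrite -/t s0 ltxx.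
- have := pos _ _ lt mN; have -> : (m%:R - m'%:R) * (2 * pi / N%:R) / 2 = - (t / 2) by rewrite /t; ring.
  by rewrite sinN s0 oppr0 ltxx.
- by rewrite e eqxx in mm'.
Qed.

(** Expanding the squares gives cosines of frequency m - m'. Summed over the nodes, only the N
    diagonal terms survive, each equal to N. *)
Lemma fejer_partition (N : nat) x : (0 < N)%N ->
  \sum_(0 <= l < N) fejer N (x - l%:R * (2 * pi / N%:R)) = 1.
Proof.
move=> N0; have Np : (0 : R) < N%:R by rewrite ltr0n.
have E y : fejer N y = (\sum_(0 <= m < N) \sum_(0 <= m' < N) cos ((m%:R - m'%:R) * y)) / N%:R ^+ 2.
  rewrite /fejer !expr2 !big_distrlr/= -big_split/=; congr (_ / _).
  apply: eq_bigr => m _; rewrite -big_split/=; apply: eq_bigr => m' _.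
  by rewrite mulrBl cosB.
under eq_bigr do rewrite E.
rewrite -mulr_suml exchange_big/=.
have -> : \sum_(0 <= m < N) \sum_(0 <= l < N) \sum_(0 <= m' < N)
      cos ((m%:R - m'%:R) * (x - l%:R * (2 * pi / N%:R))) = \sum_(0 <= m < N) N%:R.
  apply: eq_big_nat => m /andP[_ mN]; rewrite exchange_big/=.
  rewrite (bigD1_seq m)/= ?mem_index_iota ?iota_uniq//.
  rewrite [X in _ + X]big1_seq ?addr0; last first.
    move=> m' /andP[mm']; rewrite mem_index_iota => /andP[_ m'N].
    by apply: cos_nodes_sum0 => //; rewrite eq_sym.
  under eq_bigr do rewrite subrr mul0r cos0.
  by rewrite sumr_const_nat subn0.
rewrite sumr_const_nat subn0 -[X in X / _]mulr_natr -expr2 divff//.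
by rewrite expf_neq0// gt_eqF.
Qed.

End Fejer.

Section TrigPolynomials.
Context {R : realType} {k : nat}.
Implicit Types (u v x y : 'rV[R]_k) (g h : 'rV[R]_k -> R).

Definition dot u x : R := \sum_i u ord0 i * x ord0 i.

(** A term is an amplitude, a phase and a frequency vector. The phase covers sines and makes the
    class closed under products, and the mean of such a g is a finite combination of values of the
    characteristic function. *)
Definition trig_poly g := exists s : seq (R * R * 'rV[R]_k), forall x,
  g x = \sum_(z <- s) z.1.1 * cos (dot z.2 x + z.1.2).

Lemma dotD u v x : dot (u + v) x = dot u x + dot v x.
Proof. by rewrite /dot -big_split/=; apply: eq_bigr => i _; rewrite mxE mulrDl. Qed.

Lemma dotN u x : dot (- u) x = - dot u x.
Proof. by rewrite /dot -sumrN; apply: eq_bigr => i _; rewrite mxE mulNr. Qed.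

Lemma dot0 x : dot 0 x = 0.
Proof. by rewrite /dot big1// => i _; rewrite mxE mul0r. Qed.

Lemma dot_coord (a : R) (i : 'I_k) x : dot (\row_j (if j == i then a else 0)) x = a * x ord0 i.
Proof.
rewrite /dot (bigD1 i)//= mxE eqxx big1 ?addr0// => j ji.
by rewrite mxE (negbTE ji) mul0r.
Qed.

Lemma eq_trig_poly g h : (forall x, g x = h x) -> trig_poly h -> trig_poly g.
Proof. by move=> gh [s hs]; exists s => x; rewrite gh. Qed.

Lemma trig_poly_cos (a : R) u (t : R) : trig_poly (fun x => a * cos (dot u x + t)).
Proof. by exists [:: (a, t, u)] => x; rewrite big_seq1. Qed.

Lemma trig_poly_cst (a : R) : trig_poly (fun=> a).
Proof.
apply: (@eq_trig_poly _ (fun x => a * cos (dot 0 x + 0))); last exact: trig_poly_cos.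
by move=> x; rewrite dot0 addr0 cos0 mulr1.
Qed.

Lemma trig_polyD g h : trig_poly g -> trig_poly h -> trig_poly (fun x => g x + h x).
Proof. by move=> [s hs] [t ht]; exists (s ++ t) => x; rewrite big_cat/= hs ht. Qed.

Lemma trig_poly_sum I (s : seq I) (F : I -> 'rV[R]_k -> R) :
  (forall i, trig_poly (F i)) -> trig_poly (fun x => \sum_(i <- s) F i x).
Proof.
move=> hF; elim: s => [|i s IH].
  by apply: eq_trig_poly (trig_poly_cst 0) => x; rewrite big_nil.
apply: (@eq_trig_poly _ (fun x => F i x + \sum_(j <- s) F j x)); last exact: trig_polyD.
by move=> x; rewrite big_cons.
Qed.

Lemma trig_polyM g h : trig_poly g -> trig_poly h -> trig_poly (fun x => g x * h x).
Proof.
move=> [s hs] [t ht].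
apply: (@eq_trig_poly _ (fun x => \sum_(z <- s) \sum_(y <- t)
  ((z.1.1 * y.1.1 / 2) * cos (dot (z.2 + y.2) x + (z.1.2 + y.1.2)) +
   (z.1.1 * y.1.1 / 2) * cos (dot (z.2 - y.2) x + (z.1.2 - y.1.2))))).
  move=> x; rewrite hs ht big_distrlr/=; apply: eq_bigr => z _; apply: eq_bigr => y _.
  rewrite !dotD dotN.
  have -> : dot z.2 x + dot y.2 x + (z.1.2 + y.1.2) = (dot z.2 x + z.1.2) + (dot y.2 x + y.1.2) by ring.
  have -> : dot z.2 x - dot y.2 x + (z.1.2 - y.1.2) = (dot z.2 x + z.1.2) - (dot y.2 x + y.1.2) by ring.
  set p := dot z.2 x + z.1.2; set q := dot y.2 x + y.1.2.
  by rewrite (cosD p q) (cosB p q); field.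
apply: trig_poly_sum => z; apply: trig_poly_sum => y.
by apply: trig_polyD; exact: trig_poly_cos.
Qed.

Lemma trig_poly_prod I (s : seq I) (F : I -> 'rV[R]_k -> R) :
  (forall i, trig_poly (F i)) -> trig_poly (fun x => \prod_(i <- s) F i x).
Proof.
move=> hF; elim: s => [|i s IH].
  by apply: eq_trig_poly (trig_poly_cst 1) => x; rewrite big_nil.
apply: (@eq_trig_poly _ (fun x => F i x * \prod_(j <- s) F j x)); last exact: trig_polyM.
by move=> x; rewrite big_cons.
Qed.

Lemma trig_poly_fejer (N : nat) (a t : R) (i : 'I_k) :
  trig_poly (fun x => fejer N (a * x ord0 i + t)).
Proof.
have hc (m : nat) (p : R) : trig_poly (fun x => cos (m%:R * (a * x ord0 i + t) + p)).
  apply: (@eq_trig_poly _ (fun x => 1 * cos (dot (\row_j (if j == i then m%:R * a else 0)) x + (m%:R * t + p))));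
    last exact: trig_poly_cos.
  by move=> x; rewrite dot_coord mul1r; congr cos; ring.
have hs p : trig_poly (fun x => \sum_(0 <= m < N) cos (m%:R * (a * x ord0 i + t) + p)).
  by apply: trig_poly_sum => m; exact: hc.
pose S x p := \sum_(0 <= m < N) cos (m%:R * (a * x ord0 i + t) + p).
apply: (@eq_trig_poly _ (fun x => (S x 0 * S x 0 + S x (- (pi / 2)) * S x (- (pi / 2))) * (N%:R ^+ 2)^-1)).
  move=> x; rewrite /fejer -!expr2 /S.
  by congr ((_ ^+ 2 + _ ^+ 2) / _); apply: eq_bigr => m _; rewrite ?addr0// cosBpihalf.
apply: trig_polyM; last exact: trig_poly_cst.
by apply: trig_polyD; apply: trig_polyM; exact: hs.
Qed.

(** Only x is confined to the compact box. The point y may lie slightly outside, as the nodes used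
    for the approximation do. *)
Lemma unif_continuous_box (f : 'rV[R]_k -> R) (K e : R) : continuous f -> 0 < e ->
  exists2 del : R, 0 < del & forall x y, (forall i, `|x ord0 i| <= K) ->
    (forall i, `|x ord0 i - y ord0 i| <= del) -> `|f x - f y| <= e.
Proof.
move=> cf e0.
have cK : compact [set x : 'rV[R]_k | forall i, `[- K, K]%classic (x ord0 i)].
  by apply: (@rV_compact R k (fun=> `[- K, K]%classic)) => i; exact: segment_compact.
have /compact_near_coveringP nc := cK.
have [x _|rho /= rho0 hrho] := nc R (0^'+) (fun (del : R) (x : 'rV[R]_k) =>
    forall y, (forall i, `|x ord0 i - y ord0 i| <= del) -> `|f x - f y| <= e) _.
  have /cvgr_dist_le /(_ (e / 2)) := cf x.
  rewrite divr_gt0// => /(_ isT) /nbhs_ballP[rho /= rho0 hrho].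
  exists (ball x (rho / 2), [set del | del < rho / 2]) => /=.
    split; first by apply: nbhsx_ballx; rewrite divr_gt0.
    by apply: nbhs_right_lt; rewrite divr_gt0.
  move=> [x' del] /= [bx' hdel] y hy.
  have b1 : ball x rho x' by apply: le_ball bx'; rewrite ler_pdivrMr//; lra.
  have b2 : ball x rho y.
    split => // i j; rewrite !ord1; have := bx'.2 ord0 j; rewrite /ball/= => h1.
    have h2 := hy j.
    have := ler_distD (x' ord0 j) (x ord0 j) (y ord0 j); lra.
  have h1 := hrho _ b1; have h2 := hrho _ b2; rewrite /= in h1 h2.
  have := ler_distD (f x) (f x') (f y); rewrite (distrC (f x') (f x)) => h.
  by apply: le_trans h _; rewrite [leRHS]splitr lerD.
exists (rho / 2); first by rewrite divr_gt0.
move=> x y xK xy; apply: (hrho (rho / 2)) => //=.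
- by rewrite sub0r normrN ger0_norm ?divr_ge0 ?(ltW rho0)// ltr_pdivrMr//; lra.
- by rewrite divr_gt0.
- by move=> i; rewrite /= in_itv/= -ler_norml.
Qed.

(** The upper end stays away from the zero of sin at pi. It is (pi / (4 K)) 3 K, the largest
    half-phase between a point of [-K, K] and a node in [-2 K, 2 K]. *)
Lemma sin_lower_bound (p : R) : 0 < p -> p <= 3 * pi / 4 -> exists2 s : R, 0 < s &
  forall y : R, p <= `|y| -> `|y| <= 3 * pi / 4 -> s <= `|sin y|.
Proof.
move=> p0 p1; have pi0 := pi_gt0 R.
have [|z zin zmin] := @EVT_min R (@sin R) p (3 * pi / 4) p1.
  by apply: continuous_subspaceT => y; exact: continuous_sin.
have z0 : 0 < sin z.
  by apply: sin_gt0_pi; move: zin; rewrite in_itv/= => /andP[]; lra.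
exists (sin z) => // y y1 y2.
have h : sin z <= sin `|y| by apply: zmin; rewrite in_itv/= y1 y2.
apply: le_trans h _.
have [y0|y0] := leP 0 y; first by rewrite (ger0_norm y0) ler_norm.
by rewrite (ltr0_norm y0) sinN -normrN ler_norm.
Qed.

(* The Fejer kernels centred at N equally spaced nodes of a period sum to 1 and are concentrated
   near their centres: g is the average of the values of f at the nodes with these weights. *)
Lemma trig_poly_approx (f : 'rV[R]_k -> R) (M K e : R) : continuous f ->
  (forall x, `|f x| <= M) -> 0 < K -> 0 < e ->
  exists g, [/\ trig_poly g, forall x, `|g x| <= M &
    forall x, (forall i, `|x ord0 i| <= K) -> `|f x - g x| <= e].
Proof.
move=> cf fM K0 e0; have pi0 := pi_gt0 R.
have M0 : 0 <= M by apply: le_trans (fM 0).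
have [del0 del00 Hdel0] := unif_continuous_box K cf (e := e / 2) ltac:(by rewrite divr_gt0).
(* The cap at K keeps pi del / (4 K), the smallest half-phase of a far node, below 3 pi / 4. *)
pose del := Num.min del0 K.
have delp : 0 < del by rewrite lt_min del00 K0.
have delK : del <= K by rewrite ge_min lexx orbT.
have Hdel x y : (forall i, `|x ord0 i| <= K) -> (forall i, `|x ord0 i - y ord0 i| <= del) ->
    `|f x - f y| <= e / 2.
  by move=> h1 h2; apply: Hdel0 => // i; rewrite (le_trans (h2 i))// ge_min lexx.
clearbody del; clear Hdel0.
have [||s s0 Hs] := @sin_lower_bound (pi * del / (4 * K)).
- by rewrite divr_gt0 ?mulr_gt0.
- rewrite ler_pdivrMr ?mulr_gt0//.
  have h1 : pi * del <= pi * K by rewrite ler_wpM2l// ltW.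
  have h2 : 0 < pi * K by rewrite mulr_gt0.
  have -> : 3 * pi / 4 * (4 * K) = 3 * (pi * K) by field.
  lra.
(* The weight of far nodes is at most 2 / (N s^2) in each of the k coordinates and |f x - f y| <= 2
   M, so this N makes their total contribution at most e / 2. *)
pose N := (Num.truncn (8 * M * k%:R / (e * s ^+ 2))).+1.
have Np : (0 : R) < N%:R by [].
have NB : 4 * M * k%:R / (N%:R * s ^+ 2) <= e / 2.
  have /andP[_ /ltW h] := @truncn_itv _ (8 * M * k%:R / (e * s ^+ 2))
    ltac:(by rewrite divr_ge0 ?mulr_ge0// ltW).
  move: h; rewrite -/N ler_pdivrMr ?mulr_gt0// => h.
  by rewrite ler_pdivrMr ?mulr_gt0//; lra.
clearbody N.
(* The frequency pi / (2 K) gives period 4 K, and the N nodes divide [-2 K, 2 K] evenly. *)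
pose lam : R := pi / (2 * K).
pose node (j : 'I_N) : R := - (2 * K) + 4 * K * j%:R / N%:R.
pose xl (l : {ffun 'I_k -> 'I_N}) : 'rV[R]_k := \row_i node (l i).
pose G (i : 'I_k) (j : 'I_N) (x : 'rV[R]_k) := fejer N (lam * x ord0 i + (pi - j%:R * (2 * pi / N%:R))).
have N0 : (0 < N)%N by rewrite -(ltr_nat R).
have G0 i j x : 0 <= G i j x by exact: fejer_ge0.
have G1 i x : \sum_j G i j x = 1.
  rewrite -(fejer_partition (lam * x ord0 i + pi) N0) big_mkord.
  by apply: eq_bigr => j _; rewrite /G addrA.
have P1 x : \sum_(l : {ffun 'I_k -> 'I_N}) \prod_i G i (l i) x = 1.
  rewrite -(bigA_distr_bigA (fun i j => G i j x)) big1// => i _; exact: G1.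
have P0 l x : 0 <= \prod_i G i (l i) x by apply: prodr_ge0.
pose g (x : 'rV[R]_k) := \sum_(l : {ffun 'I_k -> 'I_N}) f (xl l) * \prod_i G i (l i) x.
exists g; split.
- apply: trig_poly_sum => l; apply: trig_polyM; first exact: trig_poly_cst.
  by apply: trig_poly_prod => i; exact: trig_poly_fejer.
- move=> x; rewrite (le_trans (ler_norm_sum _ _ _))//.
  apply: le_trans (_ : \sum_(l : {ffun 'I_k -> 'I_N}) M * \prod_i G i (l i) x <= _).
    by apply: ler_sum => l _; rewrite normrM (ger0_norm (P0 l x)) ler_wpM2r.
  by rewrite -mulr_sumr P1 mulr1.
move=> x xK.
pose b (i : 'I_k) (j : 'I_N) : R := (del < `|x ord0 i - node j|)%R%:R.
have far i j : b i j * G i j x <= 2 / (N%:R * s) ^+ 2.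
  rewrite /b; have [h|h] := ltP; last by rewrite mul0r divr_ge0// sqr_ge0.
  rewrite mul1r; apply: fejer_bound => //.
  have -> : (lam * x ord0 i + (pi - j%:R * (2 * pi / N%:R))) / 2 = pi / (4 * K) * (x ord0 i - node j).
    by rewrite /lam /node; field; rewrite !gt_eqF.
  have c0 : 0 < pi / (4 * K) by rewrite divr_gt0// mulr_gt0.
  apply: Hs; rewrite normrM (gtr0_norm c0).
    by rewrite mulrAC ler_pM2l ?ltW// invr_gt0 mulr_gt0.
  have nb : `|node j| <= 2 * K.
    have j0 : 0 <= 4 * K * j%:R / N%:R by rewrite divr_ge0 ?mulr_ge0// ltW.
    have j1 : 4 * K * j%:R / N%:R <= 4 * K.
      rewrite ler_pdivrMr// ler_wpM2l ?mulr_ge0 ?(ltW K0)// ler_nat.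
      by rewrite ltnW.
    by rewrite /node ler_norml; lra.
  have h3 : `|x ord0 i - node j| <= 3 * K.
    by rewrite (le_trans (ler_normB _ _))//; have := xK i; lra.
  apply: le_trans (_ : pi / (4 * K) * (3 * K) <= _); first by rewrite ler_pM2l.
  by rewrite le_eqVlt; apply/orP; left; apply/eqP; field; rewrite gt_eqF.
(* The weights of the other coordinates sum to 1, so only coordinate i0 counts. *)
have B i0 : \sum_(l : {ffun 'I_k -> 'I_N}) b i0 (l i0) * \prod_i G i (l i) x <= 2 / (N%:R * s ^+ 2).
  pose F i j := (if i == i0 then b i0 j else 1) * G i j x.
  have FE (l : {ffun 'I_k -> 'I_N}) : b i0 (l i0) * \prod_i G i (l i) x = \prod_i F i (l i).
    rewrite (bigD1 i0)//= [RHS](bigD1 i0)//= /F eqxx mulrA; congr (_ * _).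
    by apply: eq_bigr => i /negbTE ->; rewrite mul1r.
  under eq_bigr do rewrite FE.
  rewrite -(bigA_distr_bigA F) (bigD1 i0)//= [X in _ * X]big1 ?mulr1; last first.
    by move=> i /negbTE ii; rewrite -[RHS](G1 i x); apply: eq_bigr => j _; rewrite /F ii mul1r.
  apply: le_trans (_ : \sum_(j < N) 2 / (N%:R * s) ^+ 2 <= _).
    by apply: ler_sum => j _; rewrite /F eqxx.
  rewrite sumr_const card_ord -[leLHS]mulr_natr le_eqVlt; apply/orP; left; apply/eqP.
  by field; rewrite !gt_eqF.
have dist l : `|f x - f (xl l)| <= e / 2 + 2 * M * \sum_i b i (l i).
  have [h|] := pselect (forall i, `|x ord0 i - xl l ord0 i| <= del).
    rewrite (le_trans (Hdel _ _ xK h))// lerDl mulr_ge0 ?mulr_ge0//.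
    by apply: sumr_ge0 => i _; rewrite /b.
  move=> /existsNP[i /negP]; rewrite -ltNge mxE => hi.
  rewrite (le_trans (ler_normB _ _))//.
  apply: le_trans (lerD (fM _) (fM _)) _.
  have : 1 <= \sum_i b i (l i).
    rewrite (bigD1 i)//= {1}/b hi lerDl; apply: sumr_ge0 => i' _; exact: ler0n.
  move=> h; have := ler_wpM2l (mulr_ge0 (ler0n R 2) M0) h; lra.
have -> : f x - g x = \sum_(l : {ffun 'I_k -> 'I_N}) (f x - f (xl l)) * \prod_i G i (l i) x.
  under [RHS]eq_bigr do rewrite mulrBl.
  by rewrite sumrB -mulr_sumr P1 mulr1.
rewrite (le_trans (ler_norm_sum _ _ _))//.
apply: le_trans (_ : \sum_(l : {ffun 'I_k -> 'I_N}) (e / 2 + 2 * M * \sum_i b i (l i)) * \prod_i G i (l i) x <= _).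
  by apply: ler_sum => l _; rewrite normrM (ger0_norm (P0 l x)) ler_wpM2r.
have tE (l : {ffun 'I_k -> 'I_N}) : (e / 2 + 2 * M * \sum_i b i (l i)) * \prod_i G i (l i) x =
    e / 2 * \prod_i G i (l i) x + 2 * M * \sum_i (b i (l i) * \prod_i0 G i0 (l i0) x).
  by rewrite mulrDl -mulr_suml mulrA.
under eq_bigr do rewrite tE.
rewrite big_split/= -mulr_sumr P1 mulr1 -mulr_sumr exchange_big/=.
have : \sum_(i < k) \sum_(l : {ffun 'I_k -> 'I_N}) b i (l i) * \prod_i0 G i0 (l i0) x <= 2 / (N%:R * s ^+ 2) * k%:R.
  apply: le_trans (ler_sum _ (fun i _ => B i)) _.
  by rewrite sumr_const card_ord mulr_natr.
move=> h; have := ler_wpM2l (mulr_ge0 (ler0n R 2) M0) h => h2.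
have E : 2 * M * (2 / (N%:R * s ^+ 2) * k%:R) = 4 * M * k%:R / (N%:R * s ^+ 2) by ring.
rewrite E in h2; rewrite [leRHS]splitr lerD// (le_trans h2)//.
Qed.

End TrigPolynomials.

Section RandomVectors.
Context {R : realType} {k : nat} {d} {T : measurableType d} (P : probability T R).
Variable X : T -> 'rV[R]_k.
Hypothesis mX : forall i, measurable_fun setT (fun w => X w ord0 i).

Lemma measurable_dot (u : 'rV[R]_k) : measurable_fun setT (fun w => dot u (X w)).
Proof. by apply: measurable_sum => i; exact: measurable_funZ. Qed.

Lemma bounded_trig_poly (g : 'rV[R]_k -> R) : trig_poly g -> bounded_mfun (fun w => g (X w)).
Proof.
move=> [s hs]; rewrite (_ : (fun _ => _) = fun w => \sum_(z <- s) z.1.1 * cos (dot z.2 (X w) + z.1.2)).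
  apply: bounded_mfun_sum => z; apply: bounded_mfunZ; apply: bounded_mfun_cos.
  by apply: measurable_funD; [exact: measurable_dot|exact: measurable_cst].
by apply/funext => w; rewrite hs.
Qed.

(** Only the coordinates of X are assumed measurable. A continuous bounded function of X is
    measurable as the pointwise limit of trigonometric polynomials of X, taken on growing boxes. *)
Lemma bounded_continuous_comp (f : 'rV[R]_k -> R) (M : R) : continuous f ->
  (forall x, `|f x| <= M) -> bounded_mfun (fun w => f (X w)).
Proof.
move=> cf fM; apply: (@bounded_mfunW _ _ _ _ M) => //.
have /choice[g Hg] : forall m : nat, exists g : 'rV[R]_k -> R, [/\ trig_poly g, forall x, `|g x| <= M &
    forall x : 'rV[R]_k, (forall i, `|x ord0 i| <= m.+1%:R) -> `|f x - g x| <= m.+1%:R^-1].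
  by move=> m; apply: trig_poly_approx => //; rewrite invr_gt0.
apply: (@measurable_fun_cvg _ _ R setT (fun (m : nat) (w : T) => g m (X w))).
  by move=> m; case: (Hg m) => hg _ _; exact: bounded_mfun_measurable (bounded_trig_poly hg).
move=> w _; apply/cvgrPdist_le => e e0.
near=> m; have [_ _ h] := Hg m.
apply: le_trans (h (X w) _) _.
  move=> i; apply: le_trans (_ : \sum_j `|X w ord0 j| <= _).
    by rewrite (bigD1 i)//= lerDl sumr_ge0.
  rewrite (@le_trans _ _ m%:R)//; last by rewrite ler_nat.
  by near: m; exact: nbhs_infty_ger.
rewrite invf_ple ?posrE//; apply: le_trans (_ : m%:R <= _); last by rewrite ler_nat.
by near: m; exact: nbhs_infty_ger.
Unshelve. all: by end_near.
Qed.

Lemma Ex_approx_gap (f g : 'rV[R]_k -> R) (M K e : R) : 0 <= e ->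
  bounded_mfun (fun w => f (X w)) -> bounded_mfun (fun w => g (X w)) ->
  (forall x, `|f x| <= M) -> (forall x, `|g x| <= M) ->
  (forall x : 'rV[R]_k, (forall i, `|x ord0 i| <= K) -> `|f x - g x| <= e) ->
  `|Ex P (fun w => f (X w)) - Ex P (fun w => g (X w))| <=
    e + 2 * M * \sum_i pr P [set w | K < `|X w ord0 i|].
Proof.
move=> e0 bf bg fM gM fg.
have M0 : 0 <= M by apply: le_trans (fM 0).
have mA i : measurable [set w | K < `|X w ord0 i|] by exact: measurable_gt_abs.
have bi i : bounded_mfun (\1_[set w | K < `|X w ord0 i|] : T -> R) by exact: bounded_mfun_indic.
have bS : bounded_mfun (fun w => \sum_i \1_[set w | K < `|X w ord0 i|] w : R).
  exact: bounded_mfun_sum.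
rewrite -ExB//; apply: le_trans (norm_Ex _ (bounded_mfunB bf bg)) _.
have -> : e + 2 * M * \sum_i pr P [set w | K < `|X w ord0 i|] =
    Ex P (fun w => e + 2 * M * \sum_i \1_[set w | K < `|X w ord0 i|] w).
  rewrite ExD; [|exact: bounded_mfun_cst|exact: bounded_mfunZ].
  rewrite Ex_cst ExZ// Ex_sum//; congr (_ + _ * _).
  by apply: eq_bigr => i _; rewrite Ex_indic.
apply: le_Ex; first by apply: bounded_mfun_abs; exact: bounded_mfunB.
  by apply: bounded_mfunD; [exact: bounded_mfun_cst|exact: bounded_mfunZ].
move=> w; have [h|] := pselect (forall i, `|X w ord0 i| <= K).
  rewrite (le_trans (fg _ h))// lerDl mulr_ge0 ?mulr_ge0//.
  by apply: sumr_ge0 => i _.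
move=> /existsNP[i /negP]; rewrite -ltNge => hi.
rewrite (le_trans (ler_normB _ _))//.
apply: le_trans (lerD (fM _) (gM _)) _.
have : 1 <= \sum_i \1_[set w | K < `|X w ord0 i|] w :> R.
  rewrite (bigD1 i)//= {1}indicE mem_set//= lerDl.
  by apply: sumr_ge0 => j _.
move=> h; have := ler_wpM2l (mulr_ge0 (ler0n R 2) M0) h; lra.
Qed.

Lemma Ex_trig_term (u : 'rV[R]_k) (c t : R) :
  Ex P (fun w => c * cos (dot u (X w) + t)) =
  c * (cos t * complex.Re (cf P (fun w => dot u (X w)) 1) -
       sin t * complex.Im (cf P (fun w => dot u (X w)) 1)).
Proof.
have mu := measurable_dot u; have bc := bounded_mfun_cos mu; have bs := bounded_mfun_sin mu.
rewrite ExZ; last first.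
  by apply: bounded_mfun_cos; apply: measurable_funD => //; exact: measurable_cst.
congr (_ * _); rewrite /cf/=.
under [in RHS]eq_fun do rewrite mul1r.
under [X in _ = _ - _ * Ex P X]eq_fun do rewrite mul1r.
rewrite -!ExZ// -ExB; [|exact: bounded_mfunZ..].
by congr Ex; apply/funext => w; rewrite cosD; ring.
Qed.

End RandomVectors.

Section ContinuityTheorem.
Context {R : realType} {k : nat} {d d'} {T : measurableType d} {T' : measurableType d'}.
Variables (P : probability T R) (Q : probability T' R).
Variables (X : nat -> T -> 'rV[R]_k) (L : T' -> 'rV[R]_k).
Hypothesis mX : forall n i, measurable_fun setT (fun w => X n w ord0 i).
Hypothesis mL : forall i, measurable_fun setT (fun w => L w ord0 i).
Hypothesis cf_cvg : forall u : 'rV[R]_k,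
  (fun n => cnorm (cf P (fun w => dot u (X n w)) 1 - cf Q (fun w => dot u (L w)) 1)) @ \oo --> 0.
Hypothesis tight : forall eta : R, 0 < eta -> exists2 K : R, 0 < K &
  (\forall n \near \oo, \sum_i pr P [set w | K < `|X n w ord0 i|] <= eta) /\
  \sum_i pr Q [set w | K < `|L w ord0 i|] <= eta.

Lemma Ex_trig_cvg (g : 'rV[R]_k -> R) : trig_poly g ->
  (fun n => Ex P (fun w => g (X n w))) @ \oo --> Ex Q (fun w => g (L w)).
Proof.
move=> [s hs].
have E d0 (T0 : measurableType d0) (P0 : probability T0 R) (X0 : T0 -> 'rV[R]_k) :
    (forall i, measurable_fun setT (fun w => X0 w ord0 i)) ->
    Ex P0 (fun w => g (X0 w)) = \sum_(z <- s) z.1.1 * (cos z.1.2 * complex.Re (cf P0 (fun w => dot z.2 (X0 w)) 1) -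
       sin z.1.2 * complex.Im (cf P0 (fun w => dot z.2 (X0 w)) 1)).
  move=> m0; under eq_fun do rewrite hs.
  rewrite Ex_sum; first by apply: eq_bigr => z _; exact: Ex_trig_term.
  move=> z; apply: bounded_mfunZ; apply: bounded_mfun_cos; apply: measurable_funD.
    exact: measurable_dot.
  exact: measurable_cst.
rewrite E//; under eq_fun do rewrite E//.
have squeeze (F : nat -> R) (l : R) (h : nat -> R) : h @ \oo --> 0 ->
    (forall n, `|F n - l| <= h n) -> F @ \oo --> l.
  move=> h0 Fh; apply/cvgrPdist_le => e e0.
  have /cvgr_dist_le /(_ e e0) := h0; apply: filterS => n.
  rewrite sub0r normrN distrC => hn; apply: le_trans (Fh n) (le_trans (ler_norm _) hn).
have Rec u : (fun n => complex.Re (cf P (fun w => dot u (X n w)) 1)) @ \oo --> complex.Re (cf Q (fun w => dot u (L w)) 1).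
  by apply: (squeeze _ _ _ (cf_cvg u)) => n; have := Re_le_cnorm (cf P (fun w => dot u (X n w)) 1 - cf Q (fun w => dot u (L w)) 1).
have Imc u : (fun n => complex.Im (cf P (fun w => dot u (X n w)) 1)) @ \oo --> complex.Im (cf Q (fun w => dot u (L w)) 1).
  by apply: (squeeze _ _ _ (cf_cvg u)) => n; have := Im_le_cnorm (cf P (fun w => dot u (X n w)) 1 - cf Q (fun w => dot u (L w)) 1).
have termc (z : R * R * 'rV[R]_k) : (fun n => z.1.1 * (cos z.1.2 * complex.Re (cf P (fun w => dot z.2 (X n w)) 1) -
       sin z.1.2 * complex.Im (cf P (fun w => dot z.2 (X n w)) 1))) @ \oo -->
    z.1.1 * (cos z.1.2 * complex.Re (cf Q (fun w => dot z.2 (L w)) 1) -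
       sin z.1.2 * complex.Im (cf Q (fun w => dot z.2 (L w)) 1)).
  apply: cvgM; first exact: cvg_cst.
  by apply: cvgB; apply: cvgM; do ?exact: cvg_cst.
have sumc (F : nat -> R * R * 'rV[R]_k -> R) (G : R * R * 'rV[R]_k -> R) :
    (forall z, F ^~ z @ \oo --> G z) -> (fun n => \sum_(z <- s) F n z) @ \oo --> \sum_(z <- s) G z.
  move=> FG; elim: (s) => [|z t IH].
    rewrite (_ : (fun n => _) = fun=> \sum_(z <- [::]) G z); first exact: cvg_cst.
    by apply/funext => n; rewrite !big_nil.
  rewrite (_ : (fun n => _) = fun n => F n z + \sum_(z <- t) F n z).
    by rewrite [X in _ --> X]big_cons; apply: cvgD.
  by apply/funext => n; rewrite big_cons.
exact: (sumc _ _ termc).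
Qed.

(** On a box that carries most of the mass of both laws f is close to a trigonometric polynomial
    with the same bound M, and the means of trigonometric polynomials converge with the
    characteristic functions. *)
Lemma continuity_theorem : cvg_in_dist P Q X L.
Proof.
move=> f cf [M fM].
have bP n : bounded_mfun (fun w => f (X n w)) by exact: (bounded_continuous_comp (mX n) cf fM).
have bQ : bounded_mfun (fun w => f (L w)) by exact: (bounded_continuous_comp mL cf fM).
rewrite EFin_Ex//; under eq_fun do rewrite EFin_Ex//.
apply: cvg_EFin; first exact: nearW.
have M0 : 0 <= M by apply: le_trans (fM 0).
apply/cvgrPdist_le => e e0.
(* Each law costs e / 8 on the box and 2 M eta <= e / 4 off it, which leaves e / 4 for the
   trigonometric polynomial. M + 1 avoids division by 0. *)
pose eta := e / (8 * (M + 1)).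
have eta0 : 0 < eta by rewrite divr_gt0// mulr_gt0//; lra.
have [K K0 [tP tQ]] := tight eta0.
have [|g [tg gM fg]] := @trig_poly_approx R k f M K (e / 8) cf fM K0.
  by rewrite divr_gt0.
have Meta : 2 * M * eta <= e / 4.
  have -> : e / 4 = 2 * (M + 1) * eta by rewrite /eta; field; rewrite gt_eqF//; lra.
  by rewrite ler_wpM2r ?(ltW eta0)//; lra.
have M20 : 0 <= 2 * M by rewrite mulr_ge0.
have hQ : `|Ex Q (fun w => f (L w)) - Ex Q (fun w => g (L w))| <= 3 * e / 8.
  apply: le_trans (Ex_approx_gap _ mL _ bQ (bounded_trig_poly mL tg) fM gM fg) _; first by lra.
  have := ler_wpM2l M20 tQ; lra.
near=> n.
have hP : `|Ex P (fun w => f (X n w)) - Ex P (fun w => g (X n w))| <= 3 * e / 8.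
  apply: le_trans (Ex_approx_gap _ (mX n) _ (bP n) (bounded_trig_poly (mX n) tg) fM gM fg) _; first by lra.
  have tPn : \sum_i pr P [set w | K < `|X n w ord0 i|] <= eta by near: n.
  have := ler_wpM2l M20 tPn; lra.
have hg : `|Ex Q (fun w => g (L w)) - Ex P (fun w => g (X n w))| <= e / 4.
  near: n; have /cvgr_dist_le := Ex_trig_cvg tg; apply.
  by rewrite divr_gt0.
rewrite /=.
have -> : Ex Q (fun w => f (L w)) - Ex P (fun w => f (X n w)) =
  (Ex Q (fun w => f (L w)) - Ex Q (fun w => g (L w))) +
  (Ex Q (fun w => g (L w)) - Ex P (fun w => g (X n w))) -
  (Ex P (fun w => f (X n w)) - Ex P (fun w => g (X n w))) by ring.
rewrite (le_trans (ler_normB _ _))//.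
have := ler_normD (Ex Q (fun w => f (L w)) - Ex Q (fun w => g (L w))) (Ex Q (fun w => g (L w)) - Ex P (fun w => g (X n w))).
lra.
Unshelve. all: by end_near.
Qed.

End ContinuityTheorem.

(** * Levy processes and arrays *)

Section ArraysOfSums.
Context {R : realType} {d} {T : measurableType d} (P : probability T R).
Variables (z : nat -> R -> R[i]) (S : nat -> nat -> T -> R).
Hypothesis mS : forall n m, measurable_fun setT (S n m).
Hypothesis zS : forall n m u, (m <= n)%N -> z n u ^+ m = cf P (S n m) u.
Hypothesis S_small : forall e eta : R, 0 < e -> 0 < eta -> exists2 del : R, 0 < del &
  \forall n \near \oo, forall m : nat, (m <= n)%N -> m%:R <= del * n%:R ->
    pr P [set w | e < `|S n m w|] <= eta.
Hypothesis S_tight : forall eta : R, 0 < eta -> exists2 K : R, 0 < K &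
  \forall n \near \oo, forall m : nat, (m <= n)%N -> pr P [set w | K < `|S n m w|] <= eta.

(** This lemma and the next translate smallness and tightness of the sums into the two block
    conditions, both for the normed sums of Y and for the grid increments of Z. *)
Lemma small_blocks_sums : small_blocks z.
Proof.
move=> U e e0; pose U' := `|U| + 1.
have U'0 : 0 < U' by rewrite ltr_wpDl.
have [||del del0 H] := @S_small (e / 2 / U') (e / 4); rewrite ?divr_gt0//.
exists (Num.min del 1); first by rewrite lt_min del0 ltr01.
near=> n => m u md uU.
have mn : (m <= n)%N.
  rewrite -(ler_nat R) (le_trans md)// ler_piMl// ge_min lexx orbT//.
rewrite zS//; apply: le_trans (cf_near1 P u (e := e / 2) _ (mS n m)) _; first by rewrite divr_ge0// ltW.
have h : pr P [set w | e / 2 / U' < `|S n m w|] <= e / 4.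
  suff : forall m : nat, (m <= n)%N -> m%:R <= del * n%:R ->
    pr P [set w | e / 2 / U' < `|S n m w|] <= e / 4.
    by apply => //; rewrite (le_trans md)// ler_wpM2r// ge_min lexx.
  by near: n.
have : pr P [set w | e / 2 < `|u * S n m w|] <= e / 4.
  apply: le_trans h; apply: le_pr.
  - by apply: measurable_gt_abs; exact: measurable_funZ.
  - exact: measurable_gt_abs.
  - move=> w /= hw; rewrite ltr_pdivrMr//; apply: (lt_le_trans hw).
    rewrite normrM mulrC ler_wpM2l// (le_trans uU)// /U'.
    by rewrite (le_trans (ler_norm U))// lerDl.
lra.
Unshelve. all: by end_near.
Qed.

Lemma equicontinuous_blocks_sums : equicontinuous_blocks z.
Proof.
move=> e e0; have [|K K0 H] := @S_tight (e / 4); first by rewrite divr_gt0.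
exists (e / 2 / K); first by rewrite !divr_gt0.
near=> n => m u v mn uv.
have h : pr P [set w | K < `|S n m w|] <= e / 4.
  suff : forall m : nat, (m <= n)%N -> pr P [set w | K < `|S n m w|] <= e / 4 by apply.
  by near: n.
rewrite !zS//; apply: le_trans (cf_dist_pr P u v (e := e / 2) _ (mS n m) (mS n m)) _; first by rewrite divr_ge0// ltW.
have : pr P [set w | e / 2 < `|u * S n m w - v * S n m w|] <= e / 4.
  apply: le_trans h; apply: le_pr.
  - by apply: measurable_gt_abs; apply: measurable_funB; exact: measurable_funZ.
  - exact: measurable_gt_abs.
  - move=> w /=; rewrite -mulrBl normrM => hw; rewrite ltNge; apply/negP => hK.
    have : `|u - v| * `|S n m w| <= e / 2 / K * K by rewrite ler_pM.
    by rewrite divfK ?gt_eqF//; lra.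
lra.
Unshelve. all: by end_near.
Qed.

End ArraysOfSums.

Section Probabilities.
Context {R : realType} {d} {T : measurableType d} (P : probability T R).

(** X / (n + 1) tends to 0 everywhere, hence in probability. *)
Lemma single_tight (X : T -> R) (eta : R) : measurable_fun setT X -> 0 < eta ->
  exists2 K : R, 0 < K & pr P [set w | K < `|X w|] <= eta.
Proof.
move=> mX eta0.
have [|||N _ H] := @ae_cvg_pr R _ T P (fun n w => n.+1%:R^-1 * X w) (fun=> 0) _ _ _ 1 eta ltr01 eta0.
- by move=> n; exact: measurable_funZ.
- exact: measurable_cst.
- apply: aeW => w; rewrite -[X in _ --> X](mul0r (X w)).
  by apply: cvgM; [exact: cvg_harmonic|exact: cvg_cst].
exists N.+1%:R => //; have := H N (leqnn N); rewrite /=.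
apply: le_trans; apply: le_pr.
- exact: measurable_gt_abs.
- by apply: measurable_gt_abs; apply: measurable_funB; [exact: measurable_cst|exact: measurable_funZ].
- by move=> w /= h; rewrite sub0r normrN normrM gtr0_norm ?invr_gt0// mulrC ltr_pdivlMr ?mul1r.
Qed.

Lemma finite_family_tight (X : nat -> T -> R) (M : nat) (eta : R) :
  (forall j, measurable_fun setT (X j)) -> 0 < eta ->
  exists2 K : R, 0 < K & forall j, (j < M)%N -> pr P [set w | K < `|X j w|] <= eta.
Proof.
move=> mX eta0; elim: M => [|M [K K0 HK]]; first by exists 1.
have [K' K'0 HK'] := single_tight (mX M) eta0.
have mono (k : R) j : k <= K + K' -> pr P [set w | k < `|X j w|] <= eta ->
    pr P [set w | K + K' < `|X j w|] <= eta.
  move=> kK; apply: le_trans; apply: le_pr; do ?exact: measurable_gt_abs.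
  by move=> w /=; exact: le_lt_trans.
exists (K + K'); first exact: addr_gt0.
move=> j; rewrite ltnS leq_eqVlt => /predU1P[->|jM].
  by apply: (mono K') => //; rewrite lerDr ltW.
by apply: (mono K); [rewrite lerDl ltW|exact: HK].
Qed.

Lemma pr_sum_small (I : Type) (s : seq I) (u : I -> R) (e eta : R) (D : nat -> I -> T -> R) :
  (forall n i, measurable_fun setT (D n i)) ->
  (forall i (e eta : R), 0 < e -> 0 < eta -> \forall n \near \oo, pr P [set w | e < `|D n i w|] <= eta) ->
  0 < e -> 0 < eta ->
  \forall n \near \oo, pr P [set w | e < `|\sum_(i <- s) u i * D n i w|] <= eta.
Proof.
move=> mD D0; elim: s e eta => [|i s IH] e eta e0 eta0.
  near=> m; rewrite (_ : [set _ | _] = set0) ?pr_set0 ?ltW//.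
  by apply/seteqP; split => w //=; rewrite big_nil normr0 ltNge (ltW e0).
have e2 : 0 < e / 2 by rewrite divr_gt0.
have eta2 : 0 < eta / 2 by rewrite divr_gt0.
near=> m.
have h1 : pr P [set w | e / 2 < `|\sum_(i <- s) u i * D m i w|] <= eta / 2 by near: m; exact: IH.
have h2 : pr P [set w | e / 2 / (`|u i| + 1) < `|D m i w|] <= eta / 2.
  by near: m; apply: D0 => //; rewrite divr_gt0.
rewrite [leRHS]splitr; apply: le_trans (lerD h2 h1).
have mS (r : seq I) : measurable_fun setT (fun w => \sum_(i <- r) u i * D m i w).
  by apply: measurable_sum => j; exact: measurable_funZ.
apply: pr_le_setU; do ?exact: measurable_gt_abs.
move=> w /= hw; apply: contrapT => /not_orP[/negP + /negP]; rewrite -!leNgt => k1 k2.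
move: hw; apply/negP; rewrite -leNgt big_cons (le_trans (ler_normD _ _))// [leRHS]splitr lerD//.
move: k1; rewrite ler_pdivlMr// => /(le_trans _); apply.
by rewrite normrM mulrC ler_wpM2l// lerDl.
Unshelve. all: by end_near.
Qed.

Lemma cf_cvg_pr (X Y : nat -> T -> R) :
  (forall n, measurable_fun setT (X n)) -> (forall n, measurable_fun setT (Y n)) ->
  (forall e eta : R, 0 < e -> 0 < eta -> \forall n \near \oo, pr P [set w | e < `|X n w - Y n w|] <= eta) ->
  forall e : R, 0 < e -> \forall n \near \oo, cnorm (cf P (X n) 1 - cf P (Y n) 1) <= e.
Proof.
move=> mX mY XY e e0; have e2 : 0 < e / 2 by rewrite divr_gt0.
have := XY (e / 2) (e / 4) e2; rewrite divr_gt0// => /(_ isT).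
apply: filterS => n h.
apply: le_trans (cf_dist_pr P 1 1 (ltW e2) (mX n) (mY n)) _.
under eq_set do rewrite !mul1r.
lra.
Qed.

End Probabilities.

Section LevyProcess.
Context {R : realType} {d} {T : measurableType d} (Q : probability T R).
Variable Z : R -> T -> R.
Hypothesis mZ : forall t, measurable_fun setT (Z t).
Hypothesis levyZ : levy_process Q Z.

Lemma measurable_increment s t : measurable_fun setT (fun w => Z t w - Z s w).
Proof. exact: measurable_funB. Qed.

Lemma increment_law (s t : R) (B : set R) : 0 <= s -> s <= t -> measurable B ->
  Q ((fun w => Z t w - Z s w) @^-1` B) = Q ((fun w => Z (t - s) w - Z 0 w) @^-1` B).
Proof.
have [_ _ st _] := levyZ => s0 st' mB.
have E u v : (fun w => Z u w - Z v w) @^-1` B = [set w | Z u w - Z v w \in B].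
  by apply/seteqP; split => w /=; rewrite inE.
rewrite !E st//.
by have := st 0 (t - s) B (lexx 0) ltac:(by rewrite subr_ge0) mB; rewrite subr0 => ->.
Qed.

Lemma increment_continuous (s e eta : R) : 0 <= s -> 0 < e -> 0 < eta ->
  exists2 del : R, 0 < del & forall t : R, 0 <= t -> `|t - s| < del ->
    pr Q [set w | e < `|Z t w - Z s w|] <= eta.
Proof.
have [_ _ _ cont] := levyZ => s0 e0 eta0.
have [del del0 H] := cont s s0 e eta e0 eta0; exists del => // t t0 ts.
rewrite -lee_fin -(EFin_pr Q); last exact/measurable_gt_abs/measurable_increment.
exact/ltW/H.
Qed.

(** Stationarity makes the stochastic continuity at 0 uniform over all starting points. *)
Lemma increment_small (e eta : R) : 0 < e -> 0 < eta -> exists2 del : R, 0 < del &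
  forall s t : R, 0 <= s -> s <= t -> t - s < del -> pr Q [set w | e < `|Z t w - Z s w|] <= eta.
Proof.
move=> e0 eta0; have [del del0 H] := increment_continuous (lexx 0) e0 eta0.
exists del => // s t s0 st ts.
have mA : measurable [set y : R | e < `|y|] by exact: (measurable_gt_abs e (@measurable_id _ R setT)).
rewrite /pr (increment_law s0 st mA) -/(pr _ _).
by apply: H; rewrite ?subr0 ?ger0_norm// subr_ge0.
Qed.

(** Finitely many grid points are jointly tight, and from the preceding grid point to s the
    increment exceeds 1 only with small probability. *)
Lemma levy_tight (eta : R) : 0 < eta -> exists2 K : R, 0 < K &
  forall s : R, 0 <= s -> s <= 1 -> pr Q [set w | K < `|Z s w - Z 0 w|] <= eta.
Proof.
move=> eta0; have eta2 : 0 < eta / 2 by rewrite divr_gt0.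
have [del del0 H] := increment_small (ltr01 : 0 < 1) eta2.
pose M := (Num.truncn (del^-1)).+1.
have Md : M%:R^-1 < del.
  rewrite invf_plt ?posrE//.
  by have /andP[] := @truncn_itv _ del^-1 ltac:(by rewrite invr_ge0 ltW).
have [K K0 HK] := finite_family_tight Q M.+1
  (fun j => measurable_increment 0 (j%:R / M%:R)) eta2.
exists (K + 1); first exact: addr_gt0.
move=> s s0 s1; pose j := Num.truncn (s * M%:R).
have /andP[js sj] : j%:R <= s * M%:R < j.+1%:R by apply: truncn_itv; rewrite mulr_ge0.
have jM : (j < M.+1)%N.
  by rewrite ltnS -(ler_nat R) (le_trans js)// ler_piMl.
have j0 : 0 <= j%:R / M%:R :> R by rewrite divr_ge0.
have jsM : j%:R / M%:R <= s by rewrite ler_pdivrMr.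
have sjd : s - j%:R / M%:R < del.
  apply: lt_trans Md; rewrite ltrBlDr -{1}(mul1r M%:R^-1) -mulrDl ltr_pdivlMr//.
  by rewrite -natr1 addrC in sj.
rewrite [leRHS]splitr; apply: le_trans (lerD (HK j jM) (H _ _ j0 jsM sjd)).
apply: pr_le_setU; do ?exact/measurable_gt_abs/measurable_increment.
move=> w /= hw; apply: contrapT => /not_orP[/negP + /negP]; rewrite -!leNgt => k1 k2.
move: hw; apply/negP; rewrite -leNgt.
rewrite -(subrKA (Z (j%:R / M%:R) w)) (le_trans (ler_normD _ _))// addrC lerD//.
Qed.

End LevyProcess.

Section CharacteristicFunctionsOfLimits.
Context {R : realType} {d d'} {T : measurableType d} {T' : measurableType d'}.
Variables (P : probability T R) (Q : probability T' R).

Lemma cvg_in_dist_Ex {U : topologicalType} (X : nat -> T -> U) (L : T' -> U) (f : U -> R) :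
  cvg_in_dist P Q X L -> continuous f -> (exists M : R, forall x, `|f x| <= M) ->
  bounded_mfun (f \o L) ->
  Ex P (f \o X n) @[n --> \oo] --> Ex Q (f \o L).
Proof.
move=> XL cf bf bL; apply: fine_cvg.
by rewrite -(EFin_Ex Q bL); exact: XL.
Qed.

Lemma cvg_in_dist_cf {U : topologicalType} (X : nat -> T -> U) (L : T' -> U) (f : U -> R) u :
  cvg_in_dist P Q X L -> continuous f -> measurable_fun setT (f \o L) ->
  (fun n => cnorm (cf P (f \o X n) u - cf Q (f \o L) u)) @ \oo --> 0.
Proof.
move=> XL cf mL.
have cu : continuous (fun x => u * f x) by move=> x; apply: cvgM; [exact: cvg_cst|exact: cf].
have mu := measurable_funZ u mL.
have Hc : Ex P (fun w => cos (u * f (X n w))) @[n --> \oo] --> Ex Q (fun w => cos (u * f (L w))).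
  apply: (@cvg_in_dist_Ex _ X L (fun x => cos (u * f x))) => //.
  - by move=> x; apply: (continuous_comp (cu x)); exact: continuous_cos.
  - by exists 1 => x; rewrite ler_norml cos_geN1 cos_le1.
  - exact: bounded_mfun_cos.
have Hs : Ex P (fun w => sin (u * f (X n w))) @[n --> \oo] --> Ex Q (fun w => sin (u * f (L w))).
  apply: (@cvg_in_dist_Ex _ X L (fun x => sin (u * f x))) => //.
  - by move=> x; apply: (continuous_comp (cu x)); exact: continuous_sin.
  - by exists 1 => x; rewrite ler_norml sin_geN1 sin_le1.
  - exact: bounded_mfun_sin.
apply/cvgr0Pnorm_le => e e0; have e2 : 0 < e / 2 by rewrite divr_gt0.
move/cvgr_dist_le : Hc => /(_ _ e2) Hc; move/cvgr_dist_le : Hs => /(_ _ e2) Hs.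
near=> n; rewrite ger0_norm ?cnorm_ge0// (le_trans (cnorm_le_ReIm _))//.
rewrite [leRHS]splitr lerD//=.
- by rewrite distrC; near: n.
- by rewrite distrC; near: n.
Unshelve. all: by end_near.
Qed.

End CharacteristicFunctionsOfLimits.

Section RowComparison.
Context {R : realType} {d d'} {T : measurableType d} {T' : measurableType d'}.
Variables (P : probability T R) (Q : probability T' R).
Variables (X : nat -> nat -> T -> R) (X' : nat -> nat -> T' -> R) (z z' : nat -> R -> R[i]).
Hypothesis z1 : forall n u, cnorm (z n u) <= 1.
Hypothesis z1' : forall n u, cnorm (z' n u) <= 1.
Hypothesis cf_row : forall n v u,
  cf P (fun w => \sum_(0 <= i < n) v i * X n i w) u = \prod_(0 <= i < n) z n (v i * u).
Hypothesis cf_row' : forall n v u,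
  cf Q (fun w => \sum_(0 <= i < n) v i * X' n i w) u = \prod_(0 <= i < n) z' n (v i * u).
Hypothesis rate : forall v e : R, 0 < e -> \forall n \near \oo,
  n%:R * cnorm (z n v - z' n v) <= e.

Lemma step_sum {V : Type} (k n : nat) (u : 'I_k -> R) (m : 'I_k -> nat) (x : nat -> V -> R) w :
  (forall i, (m i <= n)%N) ->
  \sum_i u i * \sum_(0 <= j < m i) x j w = \sum_(0 <= j < n) (\sum_(i | (j < m i)%N) u i) * x j w.
Proof.
move=> mn; under [RHS]eq_bigr do rewrite mulr_suml.
rewrite (exchange_big_dep xpredT)//=; apply: eq_bigr => i _.
rewrite mulr_sumr (big_cat_nat (leq0n _) (mn i))//= -[LHS]addr0; congr (_ + _).
  by apply: congr_big_nat => // j /andP[_ ->].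
by rewrite big_nat_cond big1// => j /andP[/andP[h _] h']; move: h'; rewrite ltnNge h.
Qed.

(** By [step_sum] the coefficient of the j-th term is the sum of u over a subset of 'I_k. These are
    finitely many values whatever n is, so the rate holds for all of them at once, and the n factors
    are compared by [cnorm_prodB]. *)
Lemma row_comparison (k : nat) (u : 'I_k -> R) (m : nat -> 'I_k -> nat) (e : R) :
  (forall n i, (m n i <= n)%N) -> 0 < e -> \forall n \near \oo,
  cnorm (cf P (fun w => \sum_i u i * \sum_(0 <= j < m n i) X n j w) 1 -
         cf Q (fun w => \sum_i u i * \sum_(0 <= j < m n i) X' n j w) 1) <= e.
Proof.
move=> mn e0.
have H : \forall n \near \oo, forall A : {set 'I_k},
    n%:R * cnorm (z n (\sum_(i in A) u i) - z' n (\sum_(i in A) u i)) <= e.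
  by apply: filter_forall => A; exact: rate.
near=> n.
have n0 : (0 : R) < n%:R by rewrite ltr0n; near: n; exact: nbhs_infty_gt.
under eq_fun do rewrite (step_sum _ _ _ (mn n)).
under [X in cf Q X]eq_fun do rewrite (step_sum _ _ _ (mn n)).
rewrite cf_row cf_row'; apply: le_trans (cnorm_prodB _ _ _) _ => //.
have -> : e = \sum_(0 <= i < n) (e / n%:R).
  by rewrite sumr_const_nat subn0 -[RHS]mulr_natr divfK ?gt_eqF.
apply: ler_sum => j _; rewrite mulr1 ler_pdivlMr// mulrC.
have -> : \sum_(i | (j < m n i)%N) u i = \sum_(i in [set i | (j < m n i)%N]%SET) u i.
  by apply: eq_bigl => i; rewrite finset.inE.
suff : forall A : {set 'I_k},
    n%:R * cnorm (z n (\sum_(i in A) u i) - z' n (\sum_(i in A) u i)) <= e by apply.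
by near: n.
Unshelve. all: by end_near.
Qed.

End RowComparison.

Section LevyRows.
Context {R : realType} {d} {T : measurableType d} (Q : probability T R).
Variable Z : R -> T -> R.
Hypothesis mZ : forall t, measurable_fun setT (Z t).
Hypothesis levyZ : levy_process Q Z.

Definition grid_increment (n i : nat) w := Z (i.+1%:R / n%:R) w - Z (i%:R / n%:R) w.
(** The increment from 0 is used because Z(0) = 0 holds only almost surely. *)
Definition levy_cf (n : nat) u := cf Q (fun w => Z n%:R^-1 w - Z 0 w) u.

Lemma measurable_grid_increment n i : measurable_fun setT (grid_increment n i).
Proof. exact: measurable_increment. Qed.

Lemma cf_grid_increment n i u : cf Q (grid_increment n i) u = levy_cf n u.
Proof.
apply: cf_eq_law; do ?exact: measurable_increment.
move=> B mB; rewrite (increment_law levyZ) ?divr_ge0//.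
  by rewrite -mulrBl -natrB// subSnn mul1r.
by rewrite ler_wpM2r ?invr_ge0// ler_nat.
Qed.

Lemma levy_cf_row n v u :
  cf Q (fun w => \sum_(0 <= i < n) v i * grid_increment n i w) u = \prod_(0 <= i < n) levy_cf n (v i * u).
Proof.
have [_ indZ _ _] := levyZ.
pose t (i : 'I_n.+1) : R := i%:R / n%:R.
have := indZ n t; rewrite /t/= mul0r => /(_ (lexx 0)) H.
have /H {}H : forall i : 'I_n, i%:R / n%:R < (lift ord0 i)%:R / n%:R :> R.
  move=> i; rewrite ltr_pM2r ?invr_gt0 ?ltr_nat//.
  by rewrite ltr0n (leq_ltn_trans _ (ltn_ord i)).
under eq_fun do rewrite big_mkord.
rewrite (cf_sum_independent (X := fun i : 'I_n => grid_increment n i)) ?index_enum_uniq//.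
  by rewrite big_mkord; apply: eq_bigr => i _; rewrite cf_grid_increment.
by move=> i; exact: measurable_grid_increment.
Qed.

Lemma sum_grid_increment n m w :
  \sum_(0 <= i < m) grid_increment n i w = Z (m%:R / n%:R) w - Z 0 w.
Proof. by rewrite telescope_sumr// mul0r. Qed.

Lemma levy_cf_pow n m u : (m <= n)%N ->
  levy_cf n u ^+ m = cf Q (fun w => Z (m%:R / n%:R) w - Z 0 w) u.
Proof.
(* Weights 1 below m and 0 from m on turn the row product into an m-th power. *)
move=> mn; have := levy_cf_row n (fun i => (i < m)%N%:R) u.
under eq_fun => w.
  rewrite (big_cat_nat (leq0n _) mn)/= [X in _ + X]big_nat_cond [X in _ + X]big1 ?addr0; last first.
    by move=> j /andP[/andP[h _] _]; rewrite ltnNge h mul0r.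
  under eq_big_nat => j /andP[_ jm] do rewrite jm mul1r.
  rewrite sum_grid_increment; over.
move=> ->; rewrite (big_cat_nat (leq0n _) mn)/= [X in _ * X]big_nat_cond [X in _ * X]big1 ?mulr1; last first.
  by move=> j /andP[/andP[h _] _]; rewrite ltnNge h mul0r /levy_cf cf0.
under eq_big_nat => j /andP[_ jm] do rewrite jm mul1r.
by rewrite prodr_const_nat subn0.
Qed.

Lemma levy_cf_small_blocks : small_blocks levy_cf.
Proof.
apply: (@small_blocks_sums _ _ _ Q _ (fun n m w => Z (m%:R / n%:R) w - Z 0 w)).
- by move=> n m; exact: measurable_increment.
- by move=> n m u; exact: levy_cf_pow.
- move=> e eta e0 eta0; have [del del0 H] := increment_small mZ levyZ e0 eta0.
  exists (del / 2); first by rewrite divr_gt0.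
  near=> n => m mn md.
  have n0 : (0 : R) < n%:R by rewrite ltr0n; near: n; exact: nbhs_infty_gt.
  apply: H; rewrite ?divr_ge0// subr0 ltr_pdivrMr// (le_lt_trans md)// ltr_pM2r//.
  by rewrite ltr_pdivrMr// ltr_pMr// ltr1n.
Unshelve. all: by end_near.
Qed.

Lemma levy_cf_equicontinuous_blocks : equicontinuous_blocks levy_cf.
Proof.
apply: (@equicontinuous_blocks_sums _ _ _ Q _ (fun n m w => Z (m%:R / n%:R) w - Z 0 w)).
- by move=> n m; exact: measurable_increment.
- by move=> n m u; exact: levy_cf_pow.
- move=> eta eta0; have [K K0 H] := levy_tight mZ levyZ eta0.
  exists K => //; near=> n => m mn.
  have n0 : (0 : R) < n%:R by rewrite ltr0n; near: n; exact: nbhs_infty_gt.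
  by apply: H; rewrite ?divr_ge0// ler_pdivrMr// mul1r ler_nat.
Unshelve. all: by end_near.
Qed.

End LevyRows.

(** Takes the place of prod (1 - x_i) <= exp(- sum x_i): a product close to 1 forces a small sum.
    The induction rests on (1 - x)(1 + S + x) <= (1 - x)(1 + S) + x and on the product staying in
    [0, 1]. *)
Lemma prod_complement_le (R : realType) (I : eqType) (s : seq I) (x : I -> R) :
  (forall i, i \in s -> 0 <= x i <= 1) ->
  (\prod_(i <- s) (1 - x i)) * (1 + \sum_(i <- s) x i) <= 1.
Proof.
suff : (forall i, i \in s -> 0 <= x i <= 1) ->
  0 <= \prod_(i <- s) (1 - x i) <= 1 /\
  (\prod_(i <- s) (1 - x i)) * (1 + \sum_(i <- s) x i) <= 1 by move=> h /h[].
elim: s => [|i s IH] h; first by rewrite !big_nil addr0 mulr1 ler01 lexx.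
have [|/andP[p0 p1] ps] := IH; first by move=> j js; apply: h; rewrite inE js orbT.
have /andP[x0 x1] := h i (mem_head _ _).
have x1' : 0 <= 1 - x i by rewrite subr_ge0.
rewrite !big_cons; set p := \prod_(j <- s) _ in p0 p1 ps *; set S := \sum_(j <- s) _ in ps *.
split; first by rewrite mulr_ge0//= mulr_ile1// lerBlDr lerDl.
have e1 : (1 - x i) * (p * (1 + S)) <= (1 - x i) * 1 by rewrite ler_wpM2l.
have e2 : p * ((1 - x i) * x i) <= x i.
  have : p * ((1 - x i) * x i) <= 1 * (1 * x i).
    by rewrite ler_pM ?mulr_ge0// ler_wpM2r// lerBlDr lerDl.
  by rewrite !mul1r.
rewrite (_ : _ * _ * _ = (1 - x i) * (p * (1 + S)) + p * ((1 - x i) * x i)); first by lra.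
by ring.
Qed.

(** * How far the characteristic function of Y_1 stays below modulus 1 *)

Section LowerBound.
Context {R : realType} {d} {T : measurableType d} (P : probability T R).
Variables (Y1 Y2 xi : T -> R) (alpha : R).
Hypothesis mY1 : measurable_fun setT Y1.
Hypothesis mY2 : measurable_fun setT Y2.
Hypothesis mxi : measurable_fun setT xi.
Hypothesis iY : independent2 P Y1 Y2.
Hypothesis law1 : forall B, measurable B -> P (Y1 @^-1` B) = P (xi @^-1` B).
Hypothesis law2 : forall B, measurable B -> P (Y2 @^-1` B) = P (xi @^-1` B).
Hypothesis alpha0 : 0 < alpha.
Hypothesis tail_gt0 : forall x, 0 < tail P xi x.
Hypothesis tail_rv : forall l : R, 0 < l ->
  tail P xi (l * x) / tail P xi x @[x --> +oo] --> l `^ (- alpha).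

(** Symmetrisation: the difference of two independent copies has the real characteristic function
    |phi|^2. *)
Lemma sqr_cnorm_cf b : cnorm (cf P xi b) ^+ 2 = Ex P (fun w => cos (b * Y1 w - b * Y2 w)).
Proof.
have mb := measurable_scale b.
have bc := bounded_mfun_cos mb; have bs := bounded_mfun_sin mb.
rewrite /cf sqr_cnorm.
have -> : Ex P (fun w => cos (b * Y1 w - b * Y2 w)) =
    Ex P (fun w => cos (b * Y1 w) * cos (b * Y2 w)) + Ex P (fun w => sin (b * Y1 w) * sin (b * Y2 w)).
  rewrite -ExD.
  - by congr Ex; apply/funext => w; rewrite cosB.
  - by apply: bounded_mfunM; apply: bounded_mfun_cos; exact: measurable_funZ.
  - by apply: bounded_mfunM; apply: bounded_mfun_sin; exact: measurable_funZ.
rewrite (Ex_independent2 mY1 mY2 iY bc bc) (Ex_independent2 mY1 mY2 iY bs bs).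
have E1 f : bounded_mfun f -> Ex P (f \o Y1) = Ex P (f \o xi) by exact: Ex_eq_law.
have E2 f : bounded_mfun f -> Ex P (f \o Y2) = Ex P (f \o xi) by exact: Ex_eq_law.
by rewrite !(E1 _ bc, E1 _ bs, E2 _ bc, E2 _ bs) -!expr2.
Qed.

(* |cf|^2 is the mean of cos (b (Y1 - Y2)). With x = 1 / |b|, the argument has modulus between
   1/8 and 1 when x/4 < |Y1| <= x/2 and |Y2| <= L; this event has probability at least
   (tail (x/4) - tail (x/2)) / 2, which is comparable with tail x as 4^alpha > 2^alpha. *)
Lemma cnorm_cf_le_tail : exists2 kappa : R, 0 < kappa & exists2 r : R, 0 < r &
  forall b, `|b| <= r -> cnorm (cf P xi b) <= 1 - kappa * pr_gt1 P xi b.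
Proof.
(* The limiting gap between the two tail ratios is 4 [del]. Each approximation loses [del], and the
   factor 1/2 from |Y2| <= L leaves [del]. *)
pose del := (4 `^ alpha - 2 `^ alpha) / 4 : R.
have del0 : 0 < del.
  have e4 : 4 = 2 * 2 :> R by rewrite -natrM.
  rewrite divr_gt0// subr_gt0 e4 powRM// ltr_pMl ?powR_gt0//.
  exact: powR2_gt1.
have q4 : 0 < (4^-1 : R) by []. have q2 : 0 < (2^-1 : R) by [].
have [x1 x10 H1] := tail_ratio_near tail_gt0 tail_rv q4 del0.
have [x2 x20 H2] := tail_ratio_near tail_gt0 tail_rv q2 del0.
have [L L0 HL] := single_tight P mxi q2.
have dl0 : 0 < del / 8 / 8 / 16 by do 3!(apply: divr_gt0 => //).
(* On the event, cos t <= 1 - t^2 / 8 with |t| >= 1/8 gains 1/512; passing from the square to the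
   modulus halves the gain. *)
exists (del / 8 / 8 / 16) => //.
(* The bound 1 / (8 L) makes |b Y2| <= 1/8 on the event |Y2| <= L. *)
exists (Num.min (Num.min x1^-1 x2^-1) (8 * L)^-1).
  by rewrite !lt_min !invr_gt0 x10 x20 mulr_gt0.
move=> b; rewrite !le_min => /andP[/andP[b1 b2] b3].
have [->|b0] := eqVneq b 0; first by rewrite pr_gt1_0 mulr0 subr0; exact: cnorm_cf_le1.
have bp : 0 < `|b| by rewrite normr_gt0.
pose x := `|b|^-1; have x0 : 0 < x by rewrite invr_gt0.
have {}b1 : x1 <= x by rewrite -[x1]invrK lef_pV2// ?posrE ?invr_gt0.
have {}b2 : x2 <= x by rewrite -[x2]invrK lef_pV2// ?posrE ?invr_gt0.
have {}b3 : 8 * L * `|b| <= 1 by rewrite -ler_pdivlMl ?mulr_gt0// mulr1.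
have bx : `|b| * x = 1 by rewrite divff ?gt_eqF.
have t1 := H1 _ b1; have t2 := H2 _ b2.
have := pr_gt1E P xi b0; rewrite -/x => ->.
have inv_pow (k : R) : 0 < k -> k^-1 `^ (- alpha) = k `^ alpha.
  by move=> k0; rewrite -powR_inv1 ?ltW// -powRrM mulN1r opprK.
rewrite !inv_pow// in t1 t2.
have gap : 2 * del * tail P xi x <= tail P xi (4^-1 * x) - tail P xi (2^-1 * x).
  move: t1 t2; rewrite !ler_norml => /andP[t1 _] /andP[_ t2].
  have : (4 `^ alpha - 2 `^ alpha) * tail P xi x = 4 * del * tail P xi x.
    by rewrite /del; congr (_ * _); field.
  by rewrite mulrBl; lra.
pose A := [set y : R | 4^-1 * x < `|y| /\ `|y| <= 2^-1 * x].
pose B := [set y : R | `|y| <= L].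
have mid := @measurable_id _ R setT.
have mB : measurable B by exact: (measurable_le_abs L mid).
have mA : measurable A.
  apply: (@measurableI _ _ [set y : R | 4^-1 * x < `|y|] [set y : R | `|y| <= 2^-1 * x]).
    exact: (measurable_gt_abs _ mid).
  exact: (measurable_le_abs _ mid).
have mpre (Y : T -> R) C : measurable_fun setT Y -> measurable C -> measurable (Y @^-1` C).
  by move=> mY mC; rewrite -[X in measurable X]setTI; exact: mY.
pose E := Y1 @^-1` A `&` Y2 @^-1` B.
have mE : measurable E by apply: measurableI; exact: mpre.
have prE : pr P E = pr P (xi @^-1` A) * pr P (xi @^-1` B).
  by rewrite /pr /E iY// law1// law2// (EFin_pr P (mpre _ _ mxi mA)) (EFin_pr P (mpre _ _ mxi mB)).
have prA : 2 * del * tail P xi x <= pr P (xi @^-1` A).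
  apply: le_trans gap _; rewrite lerBlDr; apply: pr_le_setU.
  - exact: measurable_gt_abs.
  - exact: mpre.
  - exact: measurable_gt_abs.
  - by move=> w /= hw; have [h|h] := leP `|xi w| (2^-1 * x); [left|right].
have prB : 2^-1 <= pr P (xi @^-1` B).
  have -> : xi @^-1` B = ~` [set w | L < `|xi w|].
    by apply/seteqP; split => w /=; rewrite /B /= leNgt => /negP.
  by rewrite pr_setC; [lra|exact: measurable_gt_abs].
have prE' : del * tail P xi x <= pr P E.
  have : 2 * del * tail P xi x * 2^-1 <= pr P E.
    have n0 : 0 <= 2 * del * tail P xi x by apply: ltW; apply: mulr_gt0 => //; exact: mulr_gt0.
    by rewrite prE ler_pM.
  have -> : 2 * del * tail P xi x * 2^-1 = del * tail P xi x by field.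
  by [].
have sq : cnorm (cf P xi b) ^+ 2 <= 1 - del * tail P xi x / 8 / 8 / 8.
  rewrite sqr_cnorm_cf.
  have bE : bounded_mfun (fun w => - (8^-1 * 8^-1 * 8^-1) * \1_E w : R).
    by apply: bounded_mfunZ; exact: bounded_mfun_indic.
  have mW : measurable_fun setT (fun w => b * Y1 w - b * Y2 w).
    by apply: measurable_funB; exact: measurable_funZ.
  apply: (le_trans (y := Ex P (fun w => 1 + - (8^-1 * 8^-1 * 8^-1) * \1_E w))).
    apply: le_Ex; [exact: bounded_mfun_cos|by apply: bounded_mfunD => //; exact: bounded_mfun_cst|].
    move=> w; rewrite indicE; case: (boolP (w \in E)); last by rewrite mulr0 addr0 cos_le1.
    rewrite inE => -[[/= h1 h2] /= h3]; rewrite mulr1.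
    have k1 : 4^-1 <= `|b * Y1 w|.
      by rewrite normrM; have := ler_wpM2l (ltW bp) (ltW h1); rewrite mulrCA bx mulr1.
    have k2 : `|b * Y1 w| <= 2^-1.
      by rewrite normrM; have := ler_wpM2l (ltW bp) h2; rewrite mulrCA bx mulr1.
    have k3 : `|b * Y2 w| <= 8^-1.
      by rewrite normrM; have := ler_wpM2l (ltW bp) h3; lra.
    set u := b * Y1 w in k1 k2 *; set v := b * Y2 w in k3 *.
    have k4 : `|u - v| <= 1 by apply: le_trans (ler_normB _ _) _; lra.
    have k5 : 8^-1 <= `|u - v| by apply: le_trans (lerB_dist _ _); lra.
    apply: le_trans (cos_le_quadratic k4) _.
    have : 8^-1 * 8^-1 <= (u - v) ^+ 2 by rewrite -real_normK ?num_real// expr2 ler_pM.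
    lra.
  rewrite ExD ?Ex_cst//; last exact: bounded_mfun_cst.
  rewrite ExZ ?Ex_indic//; last exact: bounded_mfun_indic.
  lra.
set z := cnorm _ in sq *; set y := del * tail P xi x in sq prE' *.
have -> : del / 8 / 8 / 16 * tail P xi x = y / 8 / 8 / 16 by rewrite /y; field.
have y1 : y <= 1 by rewrite (le_trans prE')// pr_le1.
rewrite -(@ler_pXn2r _ 2)// ?nnegrE ?cnorm_ge0//; last by lra.
apply: le_trans sq _; have := sqr_ge0 (y / 8 / 8 / 16); rewrite sqrrB expr1n mul1r.
move: (_ ^+ 2) => q; rewrite mulr2n; lra.
Qed.

End LowerBound.

(** * Consequences of the usual conditions for the tail and the truncated mean *)

Section UsualConditions.
Context {R : realType} {d} {T : measurableType d} (P : probability T R).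
Variables (xi : T -> R) (alpha : R) (h : R -> R).
Hypothesis mxi : measurable_fun setT xi.
Hypothesis alpha02 : 0 < alpha < 2.
Hypothesis sv : slowly_varying h.
Hypothesis law : forall x : R, 0 < x -> P [set w | x < `|xi w|] = (x `^ (- alpha) * h x)%:E.

Lemma tail_regvar x : 0 < x -> tail P xi x = x `^ (- alpha) * h x.
Proof. by move=> x0; rewrite /tail /pr law. Qed.

(** h is known to be positive only near infinity; monotonicity of the tail extends positivity to
    every x. *)
Lemma regvar_tail_gt0 x : 0 < tail P xi x.
Proof.
have [_ [[M [_ HM]] _]] := sv.
pose x0 := Num.max (Num.max x 1) (M + 1).
have x00 : 0 < x0 by rewrite !lt_max ltr01 orbT.
apply: lt_le_trans (le_tail P mxi (_ : x <= x0)); last by rewrite !le_max lexx.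
rewrite tail_regvar// mulr_gt0 ?powR_gt0//; apply: HM.
by rewrite lt_max ltrDl ltr01 orbT.
Qed.

Lemma regvar_tail_ratio l : 0 < l -> tail P xi (l * x) / tail P xi x @[x --> +oo] --> l `^ (- alpha).
Proof.
move=> l0; have [_ [_ hl]] := sv.
have : l `^ (- alpha) * (h (l * x) / h x) @[x --> +oo] --> l `^ (- alpha) * 1.
  by apply: cvgM; [exact: cvg_cst|exact: hl].
rewrite mulr1; apply: cvg_trans; apply: near_eq_cvg; near=> x.
rewrite !tail_regvar ?mulr_gt0// powRM ?ltW// -mulrA -[RHS]mulrA; congr (_ * _).
by rewrite invfM [h _ * (_ * _)]mulrCA mulVKf// gt_eqF ?powR_gt0.
Unshelve. all: by end_near.
Qed.

Lemma regvar_termE b : regvar_term alpha h b = pr_gt1 P xi b.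
Proof.
rewrite /regvar_term; case: eqVneq => [->|b0]; first by rewrite pr_gt1_0.
have b1 : 0 < `|b| by rewrite normr_gt0.
by rewrite pr_gt1E// tail_regvar ?invr_gt0// -powR_inv1 ?ltW// -powRrM mulN1r opprK.
Qed.

Lemma dtermE a b : 0 < a -> dterm alpha h a b = pr_gt1 P xi (b / a).
Proof.
move=> a0; rewrite -regvar_termE /dterm /regvar_term mulf_eq0 invr_eq0 (gt_eqF a0) orbF.
case: eqVneq => // b0.
rewrite normrM normfV (gtr0_norm a0) invf_div; congr (_ * _).
have ai : 0 <= a^-1 by rewrite invr_ge0 ltW.
rewrite powRM//; congr (_ * _).
by rewrite -[in RHS]powR_inv1 ?ltW// -powRrM mulN1r powRN.
Qed.

(** Integrability has to be extracted from the value 0 of the extended integral: an infinite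
    positive or negative part would make the difference infinite, since +oo - +oo is -oo by
    convention. Dominated convergence then applies. *)
Lemma centered_trunc_mean x : (\int[P]_w (xi w)%:E = 0)%E -> 0 < x ->
  (fun k => trunc_mean P xi (2 ^+ k * x)) @ \oo --> 0.
Proof.
move=> E0 x0; have mE : measurable_fun setT (EFin \o xi) by exact/measurable_EFinP.
have xi_int : P.-integrable setT (EFin \o xi).
  have p0 : (0 <= \int[P]_w (EFin \o xi)^\+ w)%E by exact: integral_ge0.
  have n0 : (0 <= \int[P]_w (EFin \o xi)^\- w)%E by exact: integral_ge0.
  move: E0; rewrite integralE.
  have fp : measurable_fun setT (EFin \o xi)^\+%E by exact: measurable_funepos.
  have fn : measurable_fun setT (EFin \o xi)^\-%E by exact: measurable_funeneg.
  move=> E0; apply/integrableP; split => //.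
  rewrite (_ : (fun _ => _) = (EFin \o xi)^\+ \+ (EFin \o xi)^\-)%E; last exact: fune_abse.
  have fin (p q : \bar R) : (0 <= p -> 0 <= q -> p - q = 0 -> p + q < +oo)%E.
    by case: p => [p| |]; case: q => [q| |]//= _ _ _; rewrite -EFinD ltry.
  by rewrite ge0_integralD//; exact: fin p0 n0 E0.
have H : (\int[P]_w (trunc (2 ^+ n * x) (xi w))%:E)%E @[n --> \oo] --> (\int[P]_w (xi w)%:E)%E.
  apply: (@dominated_cvg _ _ _ P setT measurableT (fun n w => (trunc (2 ^+ n * x) (xi w))%:E)
    (EFin \o xi) (abse \o (EFin \o xi))) => //.
  - by move=> n; apply/measurable_EFinP; apply: measurableT_comp => //; exact: measurable_trunc.
  - move=> w _; apply: cvg_near_cst; near=> n => /=; congr EFin; rewrite /trunc ifT//.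
    rewrite -ler_pdivrMr//.
    apply: (le_trans (y := n%:R)); first by near: n; exact: nbhs_infty_ger.
    by rewrite -natrX ler_nat ltnW// ltn_expl.
  - exact: integrable_abse.
  - by move=> n w _ /=; rewrite lee_fin /trunc; case: ifP => // _; rewrite normr0.
move: H; rewrite E0 => H.
exact: fine_cvg H.
Unshelve. all: by end_near.
Qed.

(** Truncation is an odd function, so the truncated mean equals its own opposite. *)
Lemma symmetric_trunc_mean x : (forall B : set R, measurable B ->
     P [set w | xi w \in B] = P [set w | - xi w \in B]) -> trunc_mean P xi x = 0.
Proof.
move=> sym; have b : bounded_mfun (trunc x : R -> R).
  apply: (@bounded_mfunW _ _ _ _ `|x|); first exact: measurable_trunc.
  move=> y; rewrite /trunc; case: ifP => [yx|_]; last by rewrite normr0.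
  by rewrite (le_trans yx)// ler_norm.
have E (X : T -> R) B : X @^-1` B = [set w | X w \in B] by apply/seteqP; split => w /=; rewrite inE.
have mN : measurable_fun setT (fun w => - xi w) by exact: measurableT_comp.
have law_eq B : measurable B -> P (xi @^-1` B) = P ((fun w => - xi w) @^-1` B).
  by move=> mB; rewrite !E sym.
have := Ex_eq_law mxi mN law_eq b.
rewrite -/(trunc_mean P xi x).
have -> : Ex P (trunc x \o (fun w => - xi w)) = - trunc_mean P xi x.
  rewrite -mulN1r -ExZ.
    by congr Ex; apply/funext => w /=; rewrite /trunc normrN; case: ifP => _; rewrite mulN1r ?oppr0.
  by case: b => mb [M hM]; apply: (@bounded_mfunW _ _ _ _ M) => //; exact: measurableT_comp.
rewrite /trunc_mean => h1; have : Ex P (trunc x \o xi) = - Ex P (trunc x \o xi) by []. lra.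
Qed.

End UsualConditions.

Section Esums.
Context {R : realType}.

Lemma esum_le_seq (S : set int) (f : int -> R) (e : R) :
  (forall s, uniq s -> (forall j, j \in s -> S j) -> \sum_(j <- s) f j <= e) ->
  (\esum_(j in S) (f j)%:E <= e%:E)%E.
Proof.
move=> H; apply: ge_ereal_sup => _ [A [fA AS] <-].
rewrite fsbig_finite//= sumEFin lee_fin; apply: H; first exact: finmap.fset_uniq.
by move=> j; rewrite in_fset_set// inE; exact: AS.
Qed.

(** Reduces the outer series to their finite subfamilies, the only form in which they are estimated.
    Finiteness of the series for large n is part of the convergence on the left. *)
Lemma esum_cvg0P (S : nat -> set int) (f : nat -> int -> R) : (forall n j, 0 <= f n j) ->
  (fun n => \esum_(j in S n) (f n j)%:E)%E @ \oo --> 0%E <->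
  forall e : R, 0 < e -> \forall n \near \oo, forall s, uniq s ->
    (forall j, j \in s -> S n j) -> \sum_(j <- s) f n j <= e.
Proof.
move=> f0; split.
  move=> /fine_cvgP[fin /cvgr0Pnorm_le H] e e0.
  near=> n => s us sS.
  have fn : (\esum_(j in S n) (f n j)%:E)%E \is a fin_num by near: n.
  rewrite -lee_fin; apply: le_trans (sum_seq_le_esum (f n) us sS) _.
  rewrite -(fineK fn) lee_fin; apply: le_trans (ler_norm _) _.
  by near: n; exact: H.
move=> H; have ge0 n : (0 <= \esum_(j in S n) (f n j)%:E)%E by apply: esum_ge0 => j _; rewrite lee_fin.
have le n e : (forall s, uniq s -> (forall j, j \in s -> S n j) -> \sum_(j <- s) f n j <= e) ->
    (\esum_(j in S n) (f n j)%:E)%E \is a fin_num /\ fine (\esum_(j in S n) (f n j)%:E)%E <= e.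
  move=> /esum_le_seq h.
  have fn : (\esum_(j in S n) (f n j)%:E)%E \is a fin_num.
    by rewrite ge0_fin_numE// (le_lt_trans h)// ltry.
  by split => //; rewrite -lee_fin fineK.
apply/fine_cvgP; split.
  by apply: filterS (H 1 ltr01) => n /le[].
apply/cvgr0Pnorm_le => e e0; apply: filterS (H e e0) => n /le[_ h].
by rewrite /= ger0_norm// fine_ge0.
Unshelve. all: by end_near.
Qed.

End Esums.

Lemma count_low (m L : nat) : (\sum_(1 <= k < m.+1) (k <= L) <= L)%N.
Proof.
suff -> : (\sum_(1 <= k < m.+1) (k <= L) = minn m L)%N by lia.
elim: m => [|m IH]; first by rewrite big_nil min0n.
by rewrite big_nat_recr//= IH; case: leqP => /=; lia.
Qed.

Lemma count_high (m L : nat) : (\sum_(1 <= k < m.+1) (m < k + L) <= L)%N.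
Proof.
rewrite big_nat_rev/=.
rewrite (eq_big_nat _ _ (F2 := fun k => nat_of_bool (k <= L)%N)); first exact: count_low.
by move=> k km; congr nat_of_bool; apply/idP/idP; lia.
Qed.

(** * Partial sums of a moving average *)

Definition outside (m : nat) (j : int) := (j <= 0) || (m.+1%:Z <= j).

Lemma sum_zseq_inside {R : realType} (m N : nat) (F : int -> R) : (m <= N)%N ->
  \sum_(j <- zseq N | ~~ outside m j) F j = \sum_(1 <= k < m.+1) F k%:Z.
Proof.
move=> mN; rewrite -[RHS](big_map Posz xpredT F) -[LHS]big_filter; apply: perm_big; apply: uniq_perm.
- by rewrite filter_uniq// uniq_zseq.
- by rewrite map_inj_uniq ?iota_uniq// => x y [].
move=> j; rewrite mem_filter mem_zseq /outside; apply/andP/mapP.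
  move=> [h1 h2]; exists (absz j); last by lia.
  by rewrite mem_index_iota; lia.
by move=> [k]; rewrite mem_index_iota => h ->; split; lia.
Qed.

Lemma outside_nat (n k : nat) : k \in index_iota 1 n.+1 -> ~~ outside n k%:Z.
Proof. by rewrite mem_index_iota /outside; lia. Qed.

Section MovingAverage.
Context {R : realType} {d d'} {T : measurableType d} {T' : measurableType d'}.
Variables (P : probability T R) (Q : probability T' R).
Variables (Y : int -> T -> R) (xi : T -> R) (alpha : R).
Hypothesis mY : forall i, measurable_fun setT (Y i).
Hypothesis mxi : measurable_fun setT xi.
Hypothesis indY : mutually_independent P Y.
Hypothesis lawY : forall i B, measurable B -> P (Y i @^-1` B) = P (xi @^-1` B).
Hypothesis alpha0 : 0 < alpha.
Hypothesis tail_gt0 : forall x, 0 < tail P xi x.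
Hypothesis tail_rv : forall l : R, 0 < l ->
  tail P xi (l * x) / tail P xi x @[x --> +oo] --> l `^ (- alpha).
Variables (a : nat -> R) (C : R).
Hypothesis a_gt0 : forall n, 0 < a n.
Hypothesis C0 : 0 < C.
Hypothesis a_cvg : n%:R * tail P xi (a n) @[n --> \oo] --> C.
Variables (K r : R).
Hypothesis K0 : 0 <= K.
Hypothesis r0 : 0 < r.
Hypothesis pr_sum_bound : forall (e : R) (s : seq int) (b : int -> R), 0 < e -> uniq s ->
  (forall i, i \in s -> `|b i / e| <= r) ->
  pr P [set w | e < `|\sum_(i <- s) b i * Y i w|] <= K * \sum_(i <- s) pr_gt1 P xi (b i / e).
Variable Z : R -> T' -> R.
Hypothesis mZ : forall t, measurable_fun setT (Z t).
Hypothesis levyZ : levy_process Q Z.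
Hypothesis sums_cvg : cvg_in_dist P Q (fun n w => (a n)^-1 * \sum_(1 <= i < n.+1) Y i%:Z w) (Z 1).
Variables (c : int -> R) (M : R).
Hypothesis c_bound : forall s : seq int, uniq s -> \sum_(j <- s) `|c j| <= M.
Hypothesis c_tail : forall eta : R, 0 < eta -> exists N : nat, forall s, uniq s ->
  (forall j, j \in s -> (N < `|j|)%N) -> \sum_(j <- s) `|c j| <= eta.
Hypothesis Tc_tail : forall eta : R, 0 < eta -> exists N : nat, forall s, uniq s ->
  (forall j, j \in s -> (N < `|j|)%N) -> \sum_(j <- s) pr_gt1 P xi (c j) <= eta.

Local Notation X := (linproc c Y).
Local Notation A := (sumZ c).

Let M0 : 0 <= M.
Proof. by have := c_bound (s := [::]) isT; rewrite big_nil. Qed.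

(** If a n stayed below B for some large n, then n [tail (a n)] would be at least n [tail B], which
    exceeds any bound. *)
Lemma norming_infty : a n @[n --> \oo] --> +oo.
Proof.
apply/cvgryPge => B.
have /cvgr_dist_le /(_ 1 ltr01) := a_cvg => H.
near=> n.
have h1 : `|C - n%:R * tail P xi (a n)| <= 1 by near: n.
have h2 : (C + 2) / tail P xi B <= n%:R by near: n; exact: nbhs_infty_ger.
rewrite leNgt; apply/negP => aB.
have h3 := le_tail P mxi (ltW aB).
move: h2; rewrite ler_pdivrMr// => h2.
have : n%:R * tail P xi B <= n%:R * tail P xi (a n) by rewrite ler_wpM2l// ltW.
move: h1; rewrite ler_norml => /andP[h1 _]; lra.
Unshelve. all: by end_near.
Qed.

Lemma div_norming_small (B eta : R) : 0 < eta -> \forall n \near \oo, `|B / a n| <= eta.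
Proof.
move=> eta0; near=> n.
have h : `|B| / eta <= a n by near: n; move/cvgryPge : norming_infty; exact.
rewrite normrM (gtr0_norm (_ : 0 < (a n)^-1)) ?invr_gt0//.
by rewrite ler_pdivrMr// mulrC -ler_pdivrMr.
Unshelve. all: by end_near.
Qed.

Lemma pr_gt1_norming_cvg (l : R) : 0 < l -> n%:R * pr_gt1 P xi (l / a n) @[n --> \oo] --> C * l `^ alpha.
Proof.
move=> l0; have li : 0 < l^-1 by rewrite invr_gt0.
have E n : n%:R * pr_gt1 P xi (l / a n) =
    (n%:R * tail P xi (a n)) * (tail P xi (l^-1 * a n) / tail P xi (a n)).
  rewrite pr_gt1E//; last by rewrite mulf_neq0 ?invr_eq0 ?gt_eqF.
  rewrite gtr0_norm ?divr_gt0// invf_div mulrC (mulrC (a n)).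
  by field; rewrite gt_eqF.
under eq_fun do rewrite E.
apply: cvgM; first exact: a_cvg.
have -> : l `^ alpha = l^-1 `^ (- alpha).
  by rewrite -(powR_inv1 (ltW l0)) -powRrM mulrN mulN1r opprK.
exact: (cvg_comp a (fun x => tail P xi (l^-1 * x) / tail P xi x) norming_infty (tail_rv li)).
Qed.

Lemma pr_gt1_norming_small (eta : R) : 0 < eta -> exists2 l : R, 0 < l &
  \forall n \near \oo, n%:R * pr_gt1 P xi (l / a n) <= eta.
Proof.
move=> eta0; pose l := (eta / (2 * C)) `^ alpha^-1.
have l0 : 0 < l by rewrite powR_gt0// divr_gt0// mulr_gt0.
exists l => //.
have E : C * l `^ alpha = eta / 2.
  rewrite -powRrM mulVf ?gt_eqF// powRr1; last by rewrite divr_ge0 ?mulr_ge0// ltW.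
  by field; rewrite gt_eqF.
have /cvgr_dist_le /(_ (eta / 2)) := pr_gt1_norming_cvg l0.
rewrite divr_gt0// => /(_ isT); apply: filterS => n; rewrite E ler_norml => /andP[+ _]; lra.
Qed.

Lemma pr_gt1_norming_bounded (l : R) : 0 < l -> exists2 B : R, 0 < B &
  \forall n \near \oo, n%:R * pr_gt1 P xi (l / a n) <= B.
Proof.
move=> l0; exists (C * l `^ alpha + 1); first by rewrite ltr_pwDr// mulr_ge0 ?powR_ge0// ltW.
have /cvgr_dist_le /(_ 1 ltr01) := pr_gt1_norming_cvg l0.
apply: filterS => n; rewrite ler_norml => /andP[+ _]; lra.
Qed.

Lemma pr_gt1_norming_cvg0 (l eta : R) : 0 < l -> 0 < eta ->
  \forall n \near \oo, pr_gt1 P xi (l / a n) <= eta.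
Proof.
move=> l0 eta0; have [B B0 HB] := pr_gt1_norming_bounded l0.
near=> n.
have n0 : (0 : R) < n%:R by rewrite ltr0n; near: n; exact: nbhs_infty_gt.
have h1 : n%:R * pr_gt1 P xi (l / a n) <= B by near: n.
have h2 : B / eta <= n%:R by near: n; exact: nbhs_infty_ger.
rewrite -(ler_pM2l n0) (le_trans h1)//.
by rewrite mulrC -ler_pdivrMl// mulrC.
Unshelve. all: by end_near.
Qed.

Lemma sum_seq_dist (N : nat) (s t : seq int) (eta : R) :
  (forall s, uniq s -> (forall j, j \in s -> (N < `|j|)%N) -> \sum_(j <- s) `|c j| <= eta) ->
  uniq s -> uniq t -> {subset zseq N <= s} -> {subset s <= t} ->
  `|\sum_(j <- t) c j - \sum_(j <- s) c j| <= eta.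
Proof.
move=> H us ut zs st.
pose u := [seq j <- t | j \notin s].
have uu : uniq u by rewrite filter_uniq.
have E : \sum_(j <- t) c j = \sum_(j <- s) c j + \sum_(j <- u) c j.
  rewrite -big_cat/=; apply: perm_big; apply: uniq_perm => //.
    rewrite cat_uniq us uu andbT/=; apply/hasPn => j; rewrite mem_filter => /andP[]//.
  move=> j; rewrite mem_cat mem_filter; have [js|js] := boolP (j \in s); first exact: st.
  by [].
rewrite E addrAC subrr add0r (le_trans (ler_norm_sum _ _ _))// H// => j.
by rewrite mem_filter => /andP[js _]; rewrite ltnNge -mem_zseq; apply: contra js => /zs.
Qed.

(** Absolute summability makes the symmetric limit [sumZ] unconditional, so that shifted windows of
    indices can also be compared with it. *)
Lemma sumZ_approx (eta : R) : 0 < eta -> exists N : nat, forall s, uniq s ->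
  {subset zseq N <= s} -> `|sumZ c - \sum_(j <- s) c j| <= eta.
Proof.
move=> eta0.
have zsub n m : (n <= m)%N -> {subset zseq n <= zseq m}.
  by move=> nm j; rewrite !mem_zseq => /leq_trans; apply.
have cvgS : cvgn (symsum c).
  apply: cauchy_cvg; apply: cauchy_exP => eps eps0.
  have [|N HN] := @c_tail (eps / 2); first by rewrite divr_gt0.
  exists (symsum c N); exists N => // n /= Nn.
  rewrite -ball_normE/= distrC !symsumE.
  apply: (@le_lt_trans _ _ (eps / 2)); last by lra.
  apply: (sum_seq_dist HN) => //; [exact: uniq_zseq|exact: uniq_zseq|exact: zsub].
have e2 : 0 < eta / 2 by rewrite divr_gt0.
have [N HN] := c_tail e2.
exists N => s us zs.
have /cvgr_dist_le /(_ _ e2) [N0 _ HN0] := cvgS.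
pose N1 := maxn N0 (\max_(j <- s) absz j).
have h1 := HN0 N1 ltac:(by rewrite /= /N1 leq_max leqnn); rewrite /= in h1.
have h2 : `|symsum c N1 - \sum_(j <- s) c j| <= eta / 2.
  rewrite symsumE; apply: (sum_seq_dist HN) => //; first exact: uniq_zseq.
  by move=> j js; rewrite mem_zseq /N1 leq_max (leq_bigmax_seq _ js) ?orbT.
have -> : sumZ c - \sum_(j <- s) c j = (sumZ c - symsum c N1) + (symsum c N1 - \sum_(j <- s) c j).
  by ring.
by rewrite (le_trans (ler_normD _ _))// [leRHS]splitr lerD.
Qed.

Definition window (n : nat) (k : int) : seq int := [seq m%:Z - k | m <- index_iota 1 n.+1].

Lemma dnjE n k : dnj c n k = \sum_(j <- window n k) c j.
Proof. by rewrite /dnj big_map. Qed.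

Lemma uniq_window n k : uniq (window n k).
Proof. by rewrite map_inj_uniq ?iota_uniq// => x y; lia. Qed.

Lemma norm_sum_le (s : seq int) : uniq s -> `|\sum_(j <- s) c j| <= M.
Proof. by move=> us; rewrite (le_trans (ler_norm_sum _ _ _))// c_bound. Qed.

Lemma norm_dnj_le n k : `|dnj c n k| <= M.
Proof. by rewrite dnjE norm_sum_le// uniq_window. Qed.

Lemma norm_sumZ_le : `|sumZ c| <= M + 1.
Proof.
have [N HN] := sumZ_approx ltr01.
have h1 := HN _ (uniq_zseq N) (fun _ => id).
have h2 := norm_sum_le (uniq_zseq N).
have -> : sumZ c = \sum_(j <- zseq N) c j + (sumZ c - \sum_(j <- zseq N) c j) by rewrite addrC subrK.
by rewrite (le_trans (ler_normD _ _))// lerD.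
Qed.

Lemma sumZ_dnj_approx (eta : R) : 0 < eta -> exists L : nat, forall n k : nat,
  (L < k)%N -> (k + L <= n)%N -> `|sumZ c - dnj c n k%:Z| <= eta.
Proof.
move=> /sumZ_approx[N HN]; exists N => n k Nk kn; rewrite dnjE; apply: HN; first exact: uniq_window.
move=> j; rewrite mem_zseq => jN; apply/mapP; exists (absz (j + k%:Z)); last by lia.
by rewrite mem_index_iota; lia.
Qed.

(* At distance more than L from both ends of [1, m], dnj c m k is within l e of sumZ c; each of
   the remaining indices contributes o(1). *)
Lemma middle_small (e eta : R) : 0 < e -> 0 < eta ->
  \forall n \near \oo, forall m : nat, (m <= n)%N ->
    \sum_(1 <= k < m.+1) pr_gt1 P xi ((dnj c m k%:Z - sumZ c) / (e * a n)) <= eta.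
Proof.
move=> e0 eta0; have M1 := M0; have eta2 : 0 < eta / 2 by rewrite divr_gt0.
have [l l0 Hl] := pr_gt1_norming_small eta2.
have [L HL] := sumZ_dnj_approx (mulr_gt0 l0 e0).
pose B := (2 * M + 1) / e.
have B0 : 0 < B by rewrite divr_gt0//; lra.
(* At most 2 L indices lie near an end; 2 L + 1 is a positive bound for their number. *)
have := pr_gt1_norming_cvg0 B0 (eta := eta / 2 / (2 * L + 1)%:R).
rewrite divr_gt0// => /(_ isT) HB.
near=> n => m mn.
have hl : n%:R * pr_gt1 P xi (l / a n) <= eta / 2 by near: n.
have hB : pr_gt1 P xi (B / a n) <= eta / 2 / (2 * L + 1)%:R by near: n.
have ean : 0 < e * a n by rewrite mulr_gt0.
have term (k : nat) : (1 <= k < m.+1)%N -> pr_gt1 P xi ((dnj c m k%:Z - sumZ c) / (e * a n)) <=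
    pr_gt1 P xi (l / a n) + ((k <= L) + (m < k + L))%N%:R * pr_gt1 P xi (B / a n).
  move=> km; have [kL|kL] := boolP ((L < k)%N && (k + L <= m)%N).
    move/andP : kL => [k1 k2]; apply: le_trans (_ : pr_gt1 P xi (l / a n) <= _).
      apply: le_pr_gt1 => //; rewrite normrM [X in _ * X]gtr0_norm ?invr_gt0//.
      rewrite ler_pdivrMr// [X in _ <= X * _]gtr0_norm ?divr_gt0// distrC.
      by apply: le_trans (HL _ _ k1 k2) _; rewrite le_eqVlt; apply/orP; left; apply/eqP; field; rewrite gt_eqF.
    by rewrite lerDl mulr_ge0// pr_gt1_ge0.
  apply: le_trans (_ : pr_gt1 P xi (B / a n) <= _).
    apply: le_pr_gt1 => //; rewrite normrM [X in _ * X]gtr0_norm ?invr_gt0//.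
    rewrite ler_pdivrMr// (gtr0_norm (divr_gt0 B0 (a_gt0 n))).
    have -> : B / a n * (e * a n) = 2 * M + 1 by rewrite /B; field; rewrite !gt_eqF.
    rewrite (le_trans (ler_normB _ _))//.
    have := norm_dnj_le m k%:Z; have := norm_sumZ_le; lra.
  rewrite -[leLHS]add0r lerD ?pr_gt1_ge0// -[leLHS]mul1r ler_wpM2r ?pr_gt1_ge0// ler1n.
  by move: kL; rewrite negb_and -leqNgt -ltnNge => /orP[->|->]; rewrite ?addn1 ?add1n// addnS.
rewrite big_nat_cond; apply: le_trans (ler_sum _ _) _.
  by move=> k /andP[km _]; exact: (term k km).
rewrite -big_nat_cond big_split/= -mulr_suml -natr_sum.
rewrite sumr_const_nat subn1/= [leRHS]splitr lerD//.
  by rewrite -[leLHS]mulr_natl (le_trans _ hl)// ler_wpM2r ?pr_gt1_ge0// ler_nat.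
apply: le_trans (_ : (2 * L + 1)%:R * pr_gt1 P xi (B / a n) <= _).
  rewrite ler_wpM2r ?pr_gt1_ge0// ler_nat big_split/=.
  by rewrite addn1 ltnW// ltnS mul2n -addnn leq_add// ?count_low// count_high.
by rewrite mulrC -ler_pdivlMr.
Unshelve. all: by end_near.
Qed.

Definition normed_cf (n : nat) u := cf P xi (u / a n).

Lemma cf_Y_row n (b : nat -> R) u :
  cf P (fun w => \sum_(0 <= i < n) b i * Y i.+1%:Z w) u = \prod_(0 <= i < n) cf P xi (b i * u).
Proof.
pose s := [seq i.+1%:Z | i <- index_iota 0 n].
have us : uniq s by rewrite map_inj_uniq ?iota_uniq// => x y [].
have E w : \sum_(0 <= i < n) b i * Y i.+1%:Z w = \sum_(j <- s) b (absz j).-1 * Y j w by rewrite big_map.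
under eq_fun do rewrite E.
rewrite cf_sum_independent// big_map/=; apply: eq_bigr => i _.
by apply: cf_eq_law => //; exact: lawY.
Qed.

Lemma normed_cf_row n v u :
  cf P (fun w => \sum_(0 <= i < n) v i * ((a n)^-1 * Y i.+1%:Z w)) u = \prod_(0 <= i < n) normed_cf n (v i * u).
Proof.
under eq_fun do under eq_bigr do rewrite mulrA.
by rewrite cf_Y_row; apply: eq_bigr => i _; rewrite /normed_cf; congr cf; rewrite mulrAC.
Qed.

Lemma normed_cf_pow n m u :
  normed_cf n u ^+ m = cf P (fun w => \sum_(0 <= i < m) (a n)^-1 * Y i.+1%:Z w) u.
Proof. by rewrite cf_Y_row prodr_const_nat subn0 /normed_cf mulrC. Qed.

Lemma normed_sum_tail (m : nat) (e : R) n : 0 < e -> `|e^-1 / a n| <= r ->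
  pr P [set w | e < `|\sum_(0 <= i < m) (a n)^-1 * Y i.+1%:Z w|] <= K * (m%:R * pr_gt1 P xi (e^-1 / a n)).
Proof.
move=> e0 er.
pose s := [seq i.+1%:Z | i <- index_iota 0 m].
have us : uniq s by rewrite map_inj_uniq ?iota_uniq// => x y [].
have := @pr_sum_bound e s (fun=> (a n)^-1) e0 us.
rewrite [(a n)^-1 / e]mulrC => /(_ (fun _ _ => er)).
have -> : \sum_(i <- s) pr_gt1 P xi (e^-1 / a n) = m%:R * pr_gt1 P xi (e^-1 / a n).
  by rewrite big_map sumr_const_nat subn0 mulr_natl.
by under eq_set do rewrite big_map.
Qed.

Lemma normed_cf_small_blocks : small_blocks normed_cf.
Proof.
apply: (@small_blocks_sums _ _ _ P _ (fun n m w => \sum_(0 <= i < m) (a n)^-1 * Y i.+1%:Z w)).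
- by move=> n m; apply: measurable_sum => i; exact: measurable_funZ.
- by move=> n m u _; exact: normed_cf_pow.
- move=> e eta e0 eta0; have ei : 0 < e^-1 by rewrite invr_gt0.
  have [B B0 HB] := pr_gt1_norming_bounded ei.
  have kB : 0 < (K + 1) * B by rewrite mulr_gt0// ltr_wpDl.
  exists (eta / ((K + 1) * B)); first by rewrite divr_gt0.
  near=> n => m mn md.
  have hB : n%:R * pr_gt1 P xi (e^-1 / a n) <= B by near: n.
  have hr : `|e^-1 / a n| <= r.
    by near: n; exact: (div_norming_small).
  apply: le_trans (normed_sum_tail m e0 hr) _.
  have h : m%:R * pr_gt1 P xi (e^-1 / a n) <= eta / ((K + 1) * B) * B.
    apply: le_trans (_ : eta / ((K + 1) * B) * n%:R * pr_gt1 P xi (e^-1 / a n) <= _).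
      by rewrite ler_wpM2r// pr_gt1_ge0.
    by rewrite -mulrA ler_wpM2l// divr_ge0// ltW.
  apply: le_trans (ler_wpM2l K0 h) _.
  have K1 : 0 < K + 1 by rewrite ltr_wpDl.
  have -> : eta / ((K + 1) * B) * B = eta / (K + 1).
    by field; rewrite !gt_eqF.
  rewrite mulrA ler_pdivrMr// mulrC ler_pM2l//.
  by rewrite lerDl.
Unshelve. all: by end_near.
Qed.

Lemma normed_sums_tight (eta : R) : 0 < eta -> exists2 L : R, 0 < L &
  \forall n \near \oo, forall m : nat, (m <= n)%N ->
    pr P [set w | L < `|\sum_(0 <= i < m) (a n)^-1 * Y i.+1%:Z w|] <= eta.
Proof.
move=> eta0; have K1 : 0 < K + 1 by rewrite ltr_wpDl.
have [l l0 Hl] := pr_gt1_norming_small (divr_gt0 eta0 K1).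
have li : 0 < l^-1 by rewrite invr_gt0.
exists l^-1 => //; near=> n => m mn.
have hl : n%:R * pr_gt1 P xi (l / a n) <= eta / (K + 1) by near: n.
have hr : `|l^-1^-1 / a n| <= r.
  by near: n; exact: (div_norming_small).
apply: le_trans (normed_sum_tail m li hr) _; rewrite invrK.
have h : m%:R * pr_gt1 P xi (l / a n) <= eta / (K + 1).
  by apply: le_trans hl; rewrite ler_wpM2r ?pr_gt1_ge0// ler_nat.
apply: le_trans (ler_wpM2l K0 h) _.
rewrite mulrA ler_pdivrMr// mulrC ler_pM2l//.
by rewrite lerDl.
Unshelve. all: by end_near.
Qed.

Lemma normed_cf_equicontinuous_blocks : equicontinuous_blocks normed_cf.
Proof.
apply: (@equicontinuous_blocks_sums _ _ _ P _ (fun n m w => \sum_(0 <= i < m) (a n)^-1 * Y i.+1%:Z w)).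
- by move=> n m; apply: measurable_sum => i; exact: measurable_funZ.
- by move=> n m u _; exact: normed_cf_pow.
- exact: normed_sums_tight.
Qed.

Lemma cf_levy_increment1 u : cf Q (fun w => Z 1 w - Z 0 w) u = cf Q (Z 1) u.
Proof.
apply: cf_eq_law => //; first exact: measurable_increment.
move=> B mB; have [_ _ st _] := levyZ.
have E (X : T' -> R) : X @^-1` B = [set w | X w \in B] by apply/seteqP; split => w /=; rewrite inE.
by rewrite !E st// subr0.
Qed.

Lemma pr_levy0 : pr Q [set w | 0 < `|Z 0 w|] = 0.
Proof.
have [Z0 _ _ _] := levyZ.
have E : [set w | 0 < `|Z 0 w|] = ~` [set w | Z 0 w = 0].
  by apply/seteqP; split => w /=; rewrite normr_gt0 => /eqP.
have m1 : measurable [set w | Z 0 w = 0].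
  have := measurable_gt_abs 0 (mZ 0); rewrite E => /measurableC; by rewrite setCK.
by rewrite E pr_setC// /pr Z0 subrr.
Qed.

Lemma normed_levy_rate (v e : R) : 0 < e ->
  \forall n \near \oo, n%:R * cnorm (normed_cf n v - levy_cf Q Z n v) <= e.
Proof.
move: v e; apply: (@rate_cvg0 _ _ _ (cf Q (Z 1))).
- by move=> n u; exact: cnorm_cf_le1.
- by move=> n u; apply: cnorm_cf_le1; exact: measurable_increment.
- by move=> n; rewrite /normed_cf /levy_cf mul0r !cf0.
- exact: (normed_cf_small_blocks).
- exact: levy_cf_small_blocks.
- exact: (normed_cf_equicontinuous_blocks).
- exact: levy_cf_equicontinuous_blocks.
- move=> n u n0; rewrite (levy_cf_pow mZ levyZ)// divff ?pnatr_eq0 -?lt0n//.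
  exact: cf_levy_increment1.
- move=> u; have := cvg_in_dist_cf (f := id) u sums_cvg (fun x => cvg_id) (mZ 1).
  suff -> : (fun n => cnorm (normed_cf n u ^+ n - cf Q (Z 1) u)) = (fun n =>
    cnorm (cf P (id \o (fun w => (a n)^-1 * \sum_(1 <= i < n.+1) Y i%:Z w)) u - cf Q (id \o Z 1) u)) by [].
  apply/funext => n; congr (cnorm (_ - _)).
  rewrite (normed_cf_pow); congr cf; apply/funext => w /=.
  by rewrite mulr_sumr big_add1.
Qed.

(** The comparison of rows leads to the values of Z at the grid points [n t] / n; stochastic
    continuity then moves them to t. *)
Lemma normed_sums_levy (k : nat) (t u : 'I_k -> R) (e : R) : (forall i, 0 <= t i <= 1) -> 0 < e ->
  \forall n \near \oo, cnorm (cf P (fun w => \sum_i u i * Sn a Y n (t i) w) 1 -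
    cf Q (fun w => \sum_i u i * Z (t i) w) 1) <= e.
Proof.
move=> t01 e0; have e2 : 0 < e / 2 by rewrite divr_gt0.
pose m n i := Num.truncn (n%:R * t i).
have mP n i : (m n i)%:R <= n%:R * t i < (m n i).+1%:R.
  by apply: truncn_itv; rewrite mulr_ge0//; have /andP[] := t01 i.
have mn n i : (m n i <= n)%N.
  have /andP[h _] := mP n i; rewrite -(ler_nat R) (le_trans h)// ler_piMr//.
  by have /andP[] := t01 i.
pose Zn n i w := \sum_(0 <= j < m n i) grid_increment Z n j w.
have mZn n i : measurable_fun setT (Zn n i).
  by apply: measurable_sum => j; exact: measurable_grid_increment.
have mS (X : 'I_k -> T' -> R) : (forall i, measurable_fun setT (X i)) ->
  measurable_fun setT (fun w => \sum_i u i * X i w).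
  by move=> mX; apply: measurable_sum => i; exact: measurable_funZ.
have h1 := row_comparison (z := normed_cf) (z' := levy_cf Q Z) (P := P) (Q := Q)
  (X := fun n i w => (a n)^-1 * Y i.+1%:Z w) (X' := grid_increment Z)
  (fun n u => cnorm_cf_le1 _ _ mxi)
  (fun n u => cnorm_cf_le1 _ _ (measurable_increment mZ _ _))
  normed_cf_row (levy_cf_row mZ levyZ) normed_levy_rate u mn e2.
have h2 : \forall n \near \oo, cnorm (cf Q (fun w => \sum_i u i * Zn n i w) 1 -
    cf Q (fun w => \sum_i u i * Z (t i) w) 1) <= e / 2.
  apply: cf_cvg_pr => //; [by move=> n; exact: mS|by move=> n; exact: mS|].
  move=> e' eta' e'0 eta'0.
  have D0 i (x eta : R) : 0 < x -> 0 < eta ->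
      \forall n \near \oo, pr Q [set w | x < `|Zn n i w - Z (t i) w|] <= eta.
    move=> x0 eta0; have [del del0 H] := increment_small mZ levyZ x0 eta0.
    near=> n.
    have n0 : (0 : R) < n%:R by rewrite ltr0n; near: n; exact: nbhs_infty_gt.
    have nd : del^-1 < n%:R by near: n; exact: nbhs_infty_gtr.
    have /andP[m1 m2] := mP n i.
    have s1 : (m n i)%:R / n%:R <= t i by rewrite ler_pdivrMr// mulrC.
    have s2 : t i - (m n i)%:R / n%:R < del.
      have : n%:R^-1 < del by rewrite invf_plt ?posrE.
      apply: le_lt_trans; rewrite lerBlDr -[X in X + _]mul1r -mulrDl ler_pdivlMr// mulrC.
      by rewrite addrC natr1 ltW.
    have := H _ _ (divr_ge0 (ler0n R (m n i)) (ler0n R n)) s1 s2.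
    (* The telescoped increments give Z([n t] / n) - Z(0). The null event Z(0) != 0 is added to
       remove the last term. *)
    apply: le_trans; rewrite -[leRHS]addr0 -[X in _ <= _ + X]pr_levy0; apply: pr_le_setU.
    - by apply: measurable_gt_abs; apply: measurable_funB.
    - by apply: measurable_gt_abs; exact: measurable_increment.
    - exact: measurable_gt_abs.
    - move=> w /=; rewrite /Zn sum_grid_increment; have [->|z0 _] := eqVneq (Z 0 w) 0.
        by rewrite subr0 distrC; left.
      by right; rewrite normr_gt0.
  have := pr_sum_small (P := Q) (index_enum 'I_k) u (D := fun n i w => Zn n i w - Z (t i) w)
    (fun n i => measurable_funB (mZn n i) (mZ (t i))) D0 e'0 eta'0.
  apply: filterS => n; have E w : \sum_i u i * (Zn n i w - Z (t i) w) =
      \sum_i u i * Zn n i w - \sum_i u i * Z (t i) w.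
    by rewrite -sumrB; apply: eq_bigr => i _; rewrite mulrBr.
  by under eq_set do rewrite E.
near=> n.
have k1 : cnorm (cf P (fun w => \sum_i u i * \sum_(0 <= j < m n i) ((a n)^-1 * Y j.+1%:Z w)) 1 -
    cf Q (fun w => \sum_i u i * \sum_(0 <= j < m n i) grid_increment Z n j w) 1) <= e / 2 by near: n.
have k2 : cnorm (cf Q (fun w => \sum_i u i * Zn n i w) 1 -
    cf Q (fun w => \sum_i u i * Z (t i) w) 1) <= e / 2 by near: n.
apply: le_trans (cnorm_dist (cf Q (fun w => \sum_i u i * Zn n i w) 1) _ _) _.
rewrite [leRHS]splitr lerD//; move: k1.
suff -> : (fun w => \sum_i u i * \sum_(0 <= j < m n i) ((a n)^-1 * Y j.+1%:Z w)) =
  (fun w => \sum_i u i * Sn a Y n (t i) w) by [].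
apply/funext => w; apply: eq_bigr => i _; congr (_ * _).
by rewrite /Sn -mulr_sumr big_add1.
Unshelve. all: by end_near.
Qed.

Lemma c_small (eta : R) : 0 < eta -> exists N : nat, forall j, (N < `|j|)%N -> `|c j| <= eta.
Proof.
move=> /c_tail[N HN]; exists N => j Nj.
have := HN [:: j] isT; rewrite big_seq1; apply => k; rewrite inE => /eqP ->//.
Qed.

Lemma c_scaled_tail (e eta : R) : 0 < e -> 0 < eta -> exists N : nat, forall s, uniq s ->
  (forall j, j \in s -> (N < `|j|)%N) ->
  (forall j, j \in s -> `|c j / e| <= r) /\ \sum_(j <- s) pr_gt1 P xi (c j / e) <= eta.
Proof.
move=> e0 eta0; have ei : 0 < e^-1 by rewrite invr_gt0.
have [Kl Kl0 [rl rl0 Hl]] := pr_gt1_scale tail_gt0 tail_rv ei.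
have [N1 H1] := c_small rl0.
have [N2 H2] := @c_small (e * r) (mulr_gt0 e0 r0).
have [|N3 H3] := @Tc_tail (eta / (Kl + 1)).
  by rewrite divr_gt0//; lra.
exists (maxn N1 (maxn N2 N3)) => s us hs; split.
  move=> j js; have := hs _ js; rewrite !gtn_max => /and3P[_ h2 _].
  by rewrite normrM (gtr0_norm ei) ler_pdivrMr// mulrC H2.
apply: le_trans (_ : (Kl + 1) * \sum_(j <- s) pr_gt1 P xi (c j) <= _).
  rewrite mulr_sumr big_seq [leRHS]big_seq; apply: ler_sum => j js.
  have := hs _ js; rewrite !gtn_max => /and3P[h1 _ _].
  rewrite mulrC; apply: le_trans (Hl _ (H1 _ h1)) _.
  by rewrite ler_wpM2r ?pr_gt1_ge0//; lra.
rewrite mulrC -ler_pdivlMr; last by lra.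
apply: H3 => // j js; have := hs _ js; rewrite !gtn_max => /and3P[_ _ h3] //.
Qed.

Lemma sum_reflect (i : int) (s : seq int) (u : int -> int -> R) :
  \sum_(j <- s) u j (i - j) = \sum_(k <- [seq i - j | j <- s]) u (i - k) k.
Proof. by rewrite big_map; apply: eq_bigr => j _; congr u; lia. Qed.

Lemma pr_tail_sum (i : int) (e eta : R) : 0 < e -> 0 < eta -> exists N : nat, forall s, uniq s ->
  (forall j, j \in s -> (N < `|j|)%N) ->
  pr P [set w | e < `|\sum_(j <- s) c j * Y (i - j) w|] <= eta.
Proof.
move=> e0 eta0; have [|N HN] := @c_scaled_tail e (eta / (K + 1)) e0.
  by rewrite divr_gt0// ltr_wpDl.
exists N => s us hs; have [h1 h2] := HN s us hs.
have us' : uniq [seq i - j | j <- s] by rewrite map_inj_uniq//; exact: subrI.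
have := @pr_sum_bound e [seq i - j | j <- s] (fun k => c (i - k)) e0 us'.
have -> : [set w | e < `|\sum_(k <- [seq i - j | j <- s]) c (i - k) * Y k w|] =
    [set w | e < `|\sum_(j <- s) c j * Y (i - j) w|].
  by apply/seteqP; split => w /=; rewrite -(sum_reflect i s (fun j k => c j * Y k w)).
have -> : \sum_(k <- [seq i - j | j <- s]) pr_gt1 P xi (c (i - k) / e) = \sum_(j <- s) pr_gt1 P xi (c j / e).
  by rewrite -(sum_reflect i s (fun j _ => pr_gt1 P xi (c j / e))).
move=> H; apply: le_trans (H _) _.
  by move=> k /mapP[j js ->]; rewrite subKr; exact: h1.
apply: le_trans (_ : K * (eta / (K + 1)) <= _); first by rewrite ler_wpM2l.
by rewrite mulrA ler_pdivrMr ?ltr_wpDl// mulrC ler_wpM2l ?(ltW eta0)// lerDl.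
Qed.

Lemma measurable_symsum i N : measurable_fun setT (fun w => symsum (fun j => c j * Y (i - j) w) N).
Proof. by apply: measurable_sum => k; exact: measurable_funZ. Qed.

Lemma measurable_linproc i : measurable_fun setT (X i).
Proof. by apply: (measurable_limn (f := fun N w => symsum (fun j => c j * Y (i - j) w) N)); exact: measurable_symsum. Qed.

(** Along the enumeration [zenum] this is a series of independent terms, Cauchy in probability by
    [pr_tail_sum]; the symmetric sums are a subsequence of its partial sums. *)
Lemma ae_cvg_linproc i : {ae P, forall w, symsum (fun j => c j * Y (i - j) w) @ \oo --> X i w}.
Proof.
pose e' k := i - zenum k.
have e'inj : injective e' by move=> x y /subrI /zenum_inj.
pose b x := c (i - x).
have bE m n w : block_sum Y b e' m n w = \sum_(j <- [seq zenum k | k <- index_iota m n]) c j * Y (i - j) w.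
  by rewrite big_map; apply: eq_bigr => k _; rewrite /b /e' subKr.
have : {ae P, forall w, cvgn (fun n => block_sum Y b e' 0 n w)}.
  apply: ae_cvg_series => // e eta e0 eta0.
  have [N HN] := pr_tail_sum i e0 eta0.
  (* From this index on, [zenum] takes values of modulus greater than N. *)
  exists (N + N).+2 => m n Nm; under eq_set do rewrite bE.
  apply: HN; first by rewrite map_inj_uniq ?iota_uniq//; exact: zenum_inj.
  move=> j /mapP[k + ->]; rewrite mem_index_iota => /andP[mk _].
  by rewrite /zenum; have := odd_double_half k; case: (odd k) => /=; lia.
apply: filterS => w cw; rewrite /linproc.
have E : symsum (fun j => c j * Y (i - j) w) = (fun N => block_sum Y b e' 0 (N + N).+1 w).
  by apply/funext => N; rewrite symsum_zenum /block_sum; apply: eq_bigr => k _; rewrite /b /e' subKr.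
suff : cvgn (symsum (fun j => c j * Y (i - j) w)) by [].
apply/cvg_ex; case/cvg_ex : cw => l hl; exists l; rewrite E.
apply: (cvg_comp (fun N => (N + N).+1) (fun n => block_sum Y b e' 0 n w)); last exact: hl.
by move=> A [N _ hN]; exists N => // n /= nN; apply: hN => /=; lia.
Qed.

Lemma linproc_approx i (e eta : R) : 0 < e -> 0 < eta -> exists N : nat, forall s, uniq s ->
  {subset zseq N <= s} ->
  pr P [set w | e < `|X i w - \sum_(j <- s) c j * Y (i - j) w|] <= eta.
Proof.
move=> e0 eta0; have e2 : 0 < e / 2 by rewrite divr_gt0.
have eta2 : 0 < eta / 2 by rewrite divr_gt0.
have [N HN] := pr_tail_sum i e2 eta2.
exists N => s us zs.
have [N0 _ HN0] := ae_cvg_pr (fun N => measurable_symsum i N) (measurable_linproc i) (ae_cvg_linproc i) e2 eta2.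
pose N1 := maxn (maxn N0 N) (\max_(j <- s) absz j).
have sN1 : {subset s <= zseq N1}.
  by move=> j js; rewrite mem_zseq /N1 leq_max (leq_bigmax_seq _ js) ?orbT.
have h1 := HN0 N1 ltac:(by rewrite /= /N1 !leq_max leqnn).
pose t := [seq j <- zseq N1 | j \notin s].
have ut : uniq t by rewrite filter_uniq// uniq_zseq.
have h2 : pr P [set w | e / 2 < `|\sum_(j <- t) c j * Y (i - j) w|] <= eta / 2.
  apply: HN => // j; rewrite mem_filter => /andP[js _].
  by rewrite ltnNge -mem_zseq; apply: contra js => /zs.
rewrite [leRHS]splitr.
have mS (u : seq int) : measurable_fun setT (fun w => \sum_(j <- u) c j * Y (i - j) w).
  by apply: measurable_sum => k; exact: measurable_funZ.
apply: le_trans (lerD h1 h2); apply: pr_le_setU.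
- by apply: measurable_gt_abs; apply: measurable_funB => //; exact: measurable_linproc.
- by apply: measurable_gt_abs; apply: measurable_funB; [exact: measurable_linproc|exact: measurable_symsum].
- exact: measurable_gt_abs.
move=> w /= hw; apply: contrapT => /not_orP[/negP + /negP]; rewrite -!leNgt => k1 k2.
have E : symsum (fun j => c j * Y (i - j) w) N1 =
    \sum_(j <- s) c j * Y (i - j) w + \sum_(j <- t) c j * Y (i - j) w.
  rewrite symsumE -big_cat/=; apply: perm_big; apply: uniq_perm; first exact: uniq_zseq.
    rewrite cat_uniq us ut andbT/=; apply/hasPn => j; rewrite mem_filter => /andP[]//.
  move=> j; rewrite mem_cat mem_filter; have [js|js] := boolP (j \in s); first exact: sN1.
  by [].
move: hw; apply/negP; rewrite -leNgt.
rewrite E in k1; set x := \sum_(j <- s) _ in k1 *; set y := \sum_(j <- t) _ in k1 k2.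
have -> : X i w - x = (X i w - (x + y)) + y by ring.
by rewrite (le_trans (ler_normD _ _))// [leRHS]splitr lerD.
Qed.

(** The interchange of sums behind d_{m,k}, in probability. By induction on m, d_{m+1,k} = d_{m,k} +
    c_{m+1-k}, and the reflection of [-N', N'] at m + 1 still contains [-N2, N2] once N' >= N2 + m +
    1. *)
Lemma sum_linproc_approx (m : nat) (e eta : R) : 0 < e -> 0 < eta -> exists N : nat, forall N', (N <= N')%N ->
  pr P [set w | e < `|\sum_(1 <= i < m.+1) X i%:Z w - \sum_(k <- zseq N') dnj c m k * Y k w|] <= eta.
Proof.
elim: m e eta => [|m IH] e eta e0 eta0.
  exists 0%N => N' _; rewrite (_ : [set _ | _] = set0) ?pr_set0 ?ltW//.
  apply/seteqP; split => w //=; rewrite big_nil.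
  rewrite big1 ?subr0 ?normr0; first by rewrite ltNge (ltW e0).
  by move=> k _; rewrite /dnj big_nil mul0r.
have e2 : 0 < e / 2 by rewrite divr_gt0.
have eta2 : 0 < eta / 2 by rewrite divr_gt0.
have [N1 H1] := IH _ _ e2 eta2.
have [N2 H2] := linproc_approx m.+1%:Z e2 eta2.
exists (maxn N1 (N2 + m.+1)) => N'; rewrite geq_max => /andP[n1 n2].
have h1 := H1 _ n1.
pose s := [seq m.+1%:Z - k | k <- zseq N'].
have us : uniq s by rewrite map_inj_uniq ?uniq_zseq//; exact: subrI.
have h2 := H2 s us.
have {}h2 : pr P [set w | e / 2 < `|X m.+1%:Z w - \sum_(j <- s) c j * Y (m.+1%:Z - j) w|] <= eta / 2.
  apply: h2 => j; rewrite mem_zseq => hj; apply/mapP; exists (m.+1%:Z - j); last by rewrite subKr.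
  by rewrite mem_zseq; move: hj n2; clear; lia.
rewrite [leRHS]splitr; apply: le_trans (lerD h1 h2).
have mS (u : seq int) (b : int -> R) (q : int -> int) : measurable_fun setT (fun w => \sum_(j <- u) b j * Y (q j) w).
  by apply: measurable_sum => k; exact: measurable_funZ.
have mX (p : nat) : measurable_fun setT (fun w => \sum_(1 <= i < p) X i%:Z w).
  by apply: measurable_sum => k; exact: measurable_linproc.
apply: pr_le_setU.
- apply: measurable_gt_abs; apply: measurable_funB => //; exact: (mS _ _ id).
- apply: measurable_gt_abs; apply: measurable_funB => //; exact: (mS _ _ id).
- apply: measurable_gt_abs; apply: measurable_funB => //; first exact: measurable_linproc.
move=> w /= hw; apply: contrapT => /not_orP[/negP + /negP]; rewrite -!leNgt => k1 k2.
move: hw; apply/negP; rewrite -leNgt.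
rewrite big_nat_recr//=.
have E : \sum_(k <- zseq N') dnj c m.+1 k * Y k w =
    \sum_(k <- zseq N') dnj c m k * Y k w + \sum_(j <- s) c j * Y (m.+1%:Z - j) w.
  have dE k : dnj c m.+1 k = dnj c m k + c (m.+1%:Z - k) by rewrite /dnj big_nat_recr.
  under eq_bigr => k _ do rewrite dE mulrDl.
  have -> : \sum_(j <- s) c j * Y (m.+1%:Z - j) w = \sum_(k <- zseq N') c (m.+1%:Z - k) * Y k w.
    by rewrite big_map; apply: eq_bigr => k _; rewrite subKr.
  by rewrite big_split.
rewrite E opprD addrACA.
by rewrite (le_trans (ler_normD _ _))// [leRHS]splitr lerD.
Qed.

Let mX i : measurable_fun setT (X i). Proof. exact: measurable_linproc. Qed.

(** If a m > 2 a n with m <= n, then m T(1 / a_m) <= n T(1 / (2 a_n)). For large m this contradicts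
    the limits C and C 2^(-alpha) of the two sides. *)
Lemma norming_le_double : exists N : nat, forall m n : nat, (N <= m)%N -> (m <= n)%N -> a m <= 2 * a n.
Proof.
have half0 : 0 < (2^-1 : R) by rewrite invr_gt0.
have h1 := pr_gt1_norming_cvg ltr01.
have h2 := pr_gt1_norming_cvg half0.
rewrite powR1 mulr1 in h1.
have q1 : C * 2^-1 `^ alpha < C.
  rewrite gtr_pMr// -{1}[2^-1]powR_inv1// -powRrM mulN1r powRN invf_lt1 ?powR_gt0//.
  exact: powR2_gt1.
pose C' := (C * 2^-1 `^ alpha + C) / 2.
have C1 : C * 2^-1 `^ alpha < C' by rewrite /C'; lra.
have C2 : C' < C by rewrite /C'; lra.
have [N1 _ H1] := (cvgr_gt _ h1) _ C2.
have [N2 _ H2] := (cvgr_lt _ h2) _ C1.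
exists (maxn N1 N2) => m n; rewrite geq_max => /andP[m1 m2] mn.
rewrite leNgt; apply/negP => am.
have /= k1 := H1 m m1; have /= k2 := H2 n (leq_trans m2 mn).
suff : m%:R * pr_gt1 P xi (1 / a m) <= n%:R * pr_gt1 P xi (2^-1 / a n) by lra.
rewrite ler_pM ?pr_gt1_ge0// ?ler_nat//; apply: le_pr_gt1 => //.
rewrite mul1r -invfM !gtr0_norm ?invr_gt0 ?mulr_gt0//.
by rewrite lef_pV2 ?posrE ?mulr_gt0// ltW.
Qed.

Lemma measurable_Sn n t (V : int -> T -> R) : (forall i, measurable_fun setT (V i)) ->
  measurable_fun setT (Sn a V n t).
Proof. by move=> mV; apply: measurable_funZ; apply: measurable_sum. Qed.

(** One e pays for replacing the X_i by finitely many Y_k, the other for the weighted sum that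
    remains. The bound B is left free because the outer sums carry the scale a_n, not a_m, and are
    estimated by the caller. *)
Lemma remainder_bound (e eta : R) : 0 < e -> 0 < eta -> \forall n \near \oo, forall (m : nat) (B : R),
  (m <= n)%N ->
  (forall s, uniq s -> (forall j, j \in s -> outside m j) ->
    \sum_(j <- s) pr_gt1 P xi (dnj c m j / (e * a n)) <= B) ->
  pr P [set w | e + e < `|(a n)^-1 * \sum_(1 <= i < m.+1) X i%:Z w -
                      A * ((a n)^-1 * \sum_(1 <= i < m.+1) Y i%:Z w)|] <= eta + K * B.
Proof.
move=> e0 eta0; have eta2 : 0 < eta / 2 by rewrite divr_gt0.
have K1 : 0 < K + 1 by rewrite ltr_wpDl.
have Hm := middle_small e0 (divr_gt0 eta2 K1).
near=> n => m B mn HB.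
have an := a_gt0 n; have ean : 0 < e * a n by rewrite mulr_gt0.
have hm : \sum_(1 <= k < m.+1) pr_gt1 P xi ((dnj c m k%:Z - A) / (e * a n)) <= eta / 2 / (K + 1).
  suff : forall m : nat, (m <= n)%N ->
    \sum_(1 <= k < m.+1) pr_gt1 P xi ((dnj c m k%:Z - A) / (e * a n)) <= eta / 2 / (K + 1) by apply.
  by near: n.
(* M + M + 1 bounds |d_{m,k} - A|, since |d_{m,k}| <= M and |A| <= M + 1. *)
have hr : `|((M + M + 1) / e) / a n| <= r by near: n; exact: (div_norming_small).
have [N HN] := sum_linproc_approx m ean eta2.
pose N' := maxn N m; have {HN} := HN N' (leq_maxl _ _).
pose b k := dnj c m k - (if outside m k then 0 else A).
have hb : forall k, k \in zseq N' -> `|b k / (e * a n)| <= r.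
  move=> k _; apply: le_trans hr; rewrite -mulrA -invfM !normrM ler_wpM2r//.
  have k1 := norm_dnj_le m k; have k2 := norm_sumZ_le.
  have k3 := M0; rewrite [leRHS]ger0_norm; last by lra.
  rewrite /b; case: ifP => _; first by rewrite subr0; lra.
  by rewrite (le_trans (ler_normB _ _))//; lra.
have := pr_sum_bound ean (uniq_zseq N') hb.
rewrite (bigID (outside m))/= (eq_bigr (fun j => pr_gt1 P xi (dnj c m j / (e * a n)))); last first.
  by move=> j jo; rewrite /b jo subr0.
rewrite -big_filter [X in _ <= K * (_ + X)](eq_bigr (fun j => pr_gt1 P xi ((dnj c m j - A) / (e * a n)))); last first.
  by move=> j /negbTE jo; rewrite /b jo.
rewrite sum_zseq_inside ?leq_maxr// => h1 h2.
have h3 : \sum_(j <- [seq x <- zseq N' | outside m x]) pr_gt1 P xi (dnj c m j / (e * a n)) <= B.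
  by apply: HB; [rewrite filter_uniq// uniq_zseq|move=> j; rewrite mem_filter => /andP[]].
have h4 : K * (\sum_(j <- [seq x <- zseq N' | outside m x]) pr_gt1 P xi (dnj c m j / (e * a n)) +
    \sum_(1 <= k < m.+1) pr_gt1 P xi ((dnj c m k%:Z - A) / (e * a n))) <= K * B + eta / 2.
  rewrite mulrDr lerD ?ler_wpM2l//; apply: le_trans (ler_wpM2l K0 hm) _.
  by rewrite mulrA ler_pdivrMr// mulrC ler_pM2l// lerDl.
apply: (le_trans (y := eta / 2 + (K * B + eta / 2))); last by lra.
apply: le_trans (lerD h2 (le_trans h1 h4)).
have mS (s : seq int) (f : int -> R) : measurable_fun setT (fun w => \sum_(k <- s) f k * Y k w).
  by apply: measurable_sum => k; exact: measurable_funZ.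
apply: pr_le_setU.
- apply: measurable_gt_abs; apply: measurable_funB; apply: measurable_funZ.
    by apply: measurable_sum => k; exact: mX.
  by apply: measurable_funZ; apply: measurable_sum.
- by apply: measurable_gt_abs; apply: measurable_funB => //;
    apply: measurable_sum => k; exact: mX.
- exact: measurable_gt_abs.
move=> w /= hw; apply: contrapT => /not_orP[/negP + /negP]; rewrite -!leNgt => k1 k2.
move: hw; apply/negP; rewrite -leNgt.
have E : \sum_(k <- zseq N') b k * Y k w = \sum_(k <- zseq N') dnj c m k * Y k w - A * \sum_(1 <= i < m.+1) Y i%:Z w.
  have -> : \sum_(1 <= i < m.+1) Y i%:Z w = \sum_(j <- zseq N' | ~~ outside m j) Y j w.
    by rewrite sum_zseq_inside// leq_maxr.
  rewrite [X in A * X]big_mkcond mulr_sumr -sumrB; apply: eq_bigr => j _; rewrite /b mulrBl.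
  by case: ifP => jo /=; rewrite ?jo/= ?mul0r ?mulr0.
set x := \sum_(1 <= i < m.+1) X i%:Z w in k1 *; set y := \sum_(1 <= i < m.+1) Y i%:Z w in E *.
move: k1 k2; rewrite E; set z := \sum_(k <- zseq N') dnj c m k * Y k w => k1 k2.
have -> : (a n)^-1 * x - A * ((a n)^-1 * y) = (x - z + (z - A * y)) / a n.
  by rewrite addrA subrK mulrBl; congr (_ - _); ring.
rewrite normrM normfV (gtr0_norm an) ler_pdivrMr// mulrDl.
by rewrite (le_trans (ler_normD _ _))// lerD.
Unshelve. all: by end_near.
Qed.

Lemma cf_weighted_sum (s : seq int) (b : int -> R) : uniq s ->
  cf P (fun w => \sum_(k <- s) b k * Y k w) 1 = \prod_(k <- s) cf P xi (b k).
Proof.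
move=> us; rewrite cf_sum_independent//; apply: eq_bigr => k _; rewrite mulr1.
by apply: cf_eq_law => //; exact: lawY.
Qed.

Lemma cnorm_prod_subseq (s t : seq int) (b : int -> R) : uniq s -> uniq t -> {subset s <= t} ->
  cnorm (\prod_(k <- t) cf P xi (b k)) <= cnorm (\prod_(k <- s) cf P xi (b k)).
Proof.
move=> us ut st.
have pt : perm_eq t (s ++ [seq k <- t | k \notin s]).
  rewrite uniq_perm// ?cat_uniq ?us ?filter_uniq ?andbT//=.
    by apply/hasPn => k; rewrite mem_filter => /andP[].
  move=> k; rewrite mem_cat mem_filter; case: (boolP (k \in s)) => //= ks.
  exact: st.
rewrite (perm_big _ pt) big_cat/= cnormM ler_piMr ?cnorm_ge0//.
by apply: cnorm_prod_le1 => k; exact: cnorm_cf_le1.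
Qed.

(** S_n(1) is a limit in probability of finite weighted sums, whose characteristic functions are
    products. Factors with index neither in [1, n] nor in F have modulus at most 1 and are
    dropped. *)
Lemma cf_Sn_le_prod n (F : seq int) : uniq F -> (forall j, j \in F -> outside n j) ->
  cnorm (cf P (Sn a X n 1) 1) <=
  cnorm (\prod_(1 <= k < n.+1) cf P xi (dnj c n k%:Z / a n)) *
  \prod_(k <- F) cnorm (cf P xi (dnj c n k / a n)).
Proof.
move=> uF outF; rewrite -cnorm_prod -cnormM.
have an := a_gt0 n.
apply/ler_addgt0Pr => e e0.
have e3 : 0 < e / 3 by rewrite divr_gt0.
have [N HN] := sum_linproc_approx n (mulr_gt0 e3 an) e3.
pose s := [seq k%:Z | k <- index_iota 1 n.+1] ++ F.
have us : uniq s.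
  rewrite cat_uniq uF map_inj_uniq ?iota_uniq// ?andbT/=; last by move=> x y [].
  apply/hasPn => j jF; apply/mapP => -[k /outside_nat kn jk].
  by have := outF j jF; rewrite jk (negbTE kn).
pose N' := maxn N (\max_(j <- s) absz j).
have sN : {subset s <= zseq N'}.
  by move=> j js; rewrite mem_zseq leq_max; apply/orP; right; exact: leq_bigmax_seq.
have {HN} h := HN N' (leq_maxl _ _).
pose S w := \sum_(k <- zseq N') dnj c n k / a n * Y k w.
have mS : measurable_fun setT S by apply: measurable_sum => k; exact: measurable_funZ.
have mSn : measurable_fun setT (Sn a X n 1) by exact: measurable_Sn.
have -> : cf P (Sn a X n 1) 1 = cf P S 1 + (cf P (Sn a X n 1) 1 - cf P S 1) by rewrite addrC subrK.
apply: le_trans (cnormD _ _) _; apply: lerD.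
  rewrite cf_weighted_sum ?uniq_zseq//; apply: le_trans (cnorm_prod_subseq _ us (uniq_zseq N') sN) _.
  by rewrite big_cat big_map.
apply: le_trans (cf_dist_pr P 1 1 (ltW e3) mSn mS) _.
suff : pr P [set w | e / 3 < `|1 * Sn a X n 1 w - 1 * S w|] <= e / 3 by lra.
apply: le_trans h; rewrite le_eqVlt; apply/orP; left; apply/eqP; congr pr.
have E w : 1 * Sn a X n 1 w - 1 * S w =
    (\sum_(1 <= i < n.+1) X i%:Z w - \sum_(k <- zseq N') dnj c n k * Y k w) / a n.
  rewrite !mul1r /Sn mulr1 natrK mulrBl [_^-1 * _]mulrC; congr (_ - _).
  by rewrite mulr_suml; apply: eq_bigr => k _; ring.
under eq_set do rewrite E normrM normfV (gtr0_norm an) ltr_pdivlMr//.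
by [].
Qed.

(** The product is the characteristic function of the part of S_n(1) with index in [1, n]. That part
    differs from A V_n(1) by a sum that vanishes in probability, and A V_n(1) converges to A
    Z(1). *)
Lemma middle_prod_cvg (e : R) : 0 < e -> \forall n \near \oo,
  cnorm (\prod_(1 <= k < n.+1) cf P xi (dnj c n k%:Z / a n) - cf Q (Z 1) A) <= e.
Proof.
move=> e0; have e2 : 0 < e / 2 by rewrite divr_gt0.
have /cvgr0Pnorm_le h1 := cvg_in_dist_cf (f := id) A sums_cvg (fun x => cvg_id) (mZ 1).
have {}h1 := h1 _ e2.
pose D n w := \sum_(1 <= k < n.+1) dnj c n k%:Z / a n * Y k%:Z w.
pose V n w := A * ((a n)^-1 * \sum_(1 <= i < n.+1) Y i%:Z w).
have mD n : measurable_fun setT (D n) by apply: measurable_sum => k; exact: measurable_funZ.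
have mV n : measurable_fun setT (V n) by do 2 apply: measurable_funZ; exact: measurable_sum.
have h2 : \forall n \near \oo, cnorm (cf P (D n) 1 - cf P (V n) 1) <= e / 2.
  apply: cf_cvg_pr => // e' eta' e'0 eta'0.
  have K1 : 0 < K + 1 by rewrite ltr_wpDl.
  have Hm := middle_small e'0 (divr_gt0 eta'0 K1).
  near=> n; have an := a_gt0 n.
  have hm : \sum_(1 <= k < n.+1) pr_gt1 P xi ((dnj c n k%:Z - A) / (e' * a n)) <= eta' / (K + 1).
    suff : forall m : nat, (m <= n)%N ->
      \sum_(1 <= k < m.+1) pr_gt1 P xi ((dnj c m k%:Z - A) / (e' * a n)) <= eta' / (K + 1) by apply.
    by near: n.
  have hr : `|((M + M + 1) / e') / a n| <= r by near: n; exact: (div_norming_small).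
  pose s := [seq k%:Z | k <- index_iota 1 n.+1].
  have us : uniq s by rewrite map_inj_uniq ?iota_uniq// => x y [].
  have hb k : k \in s -> `|(dnj c n k - A) / a n / e'| <= r.
    move=> _; apply: le_trans hr; rewrite [X in `|X| <= _]mulrAC !normrM ler_wpM2r// ler_wpM2r//.
    have k1 := norm_dnj_le n k; have k2 := norm_sumZ_le.
    have k3 := M0; rewrite [leRHS]ger0_norm; last by lra.
    by rewrite (le_trans (ler_normB _ _))//; lra.
  have := pr_sum_bound e'0 us hb; rewrite [X in _ <= K * X]big_map.
  under [X in _ <= K * X]eq_bigr do rewrite -mulrA -invfM [a n * e']mulrC.
  move=> h3; have {h3} h3 : pr P [set w | e' < `|\sum_(i <- s) (dnj c n i - A) / a n * Y i w|] <= eta'.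
    apply: le_trans h3 _; apply: le_trans (ler_wpM2l K0 hm) _.
    by rewrite mulrA ler_pdivrMr// mulrC ler_pM2l// lerDl.
  have E w : \sum_(i <- s) (dnj c n i - A) / a n * Y i w = D n w - V n w.
    rewrite big_map /D /V !mulr_sumr -sumrB; apply: eq_bigr => k _.
    by rewrite !mulrBl [A * (_ * _)]mulrA.
  by move: h3; under eq_set do rewrite E.
near=> n.
have -> : \prod_(1 <= k < n.+1) cf P xi (dnj c n k%:Z / a n) = cf P (D n) 1.
  pose s := [seq k%:Z | k <- index_iota 1 n.+1].
  have us : uniq s by rewrite map_inj_uniq ?iota_uniq// => x y [].
  rewrite -(big_map Posz xpredT (fun k => cf P xi (dnj c n k / a n))) -cf_weighted_sum//.
  by congr cf; apply/funext => w; rewrite big_map.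
apply: le_trans (cnorm_dist (cf P (V n) 1) _ _) _; rewrite [leRHS]splitr; apply: lerD; first by near: n.
rewrite cf_scale mulr1.
have : `|cnorm (cf P (id \o (fun w => (a n)^-1 * \sum_(1 <= i < n.+1) Y i%:Z w)) A - cf Q (id \o Z 1) A)| <= e / 2.
  by near: n.
by rewrite ger0_norm ?cnorm_ge0.
Unshelve. all: by end_near.
Qed.

(** By infinite divisibility the value is the n-th power of [levy_cf Q Z n u], which is within 1/2
    of 1 for large n. *)
Lemma cf_levy_gt0 u : 0 < cnorm (cf Q (Z 1) u).
Proof.
have half0 : 0 < (2^-1 : R) by [].
have [del del0 H] := levy_cf_small_blocks mZ levyZ `|u| half0.
have [n [n1 n2 n3]] : exists n : nat, [/\ (0 < n)%N, 1 <= del * n%:R &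
  forall (m : nat) (v : R), m%:R <= del * n%:R -> `|v| <= `|u| -> cnorm (levy_cf Q Z n v ^+ m - 1) <= 2^-1].
  near \oo => n; exists n; split.
  - by near: n; exact: nbhs_infty_gt.
  - by rewrite mulrC -ler_pdivrMr// mul1r; near: n; exact: nbhs_infty_ger.
  - by near: n.
have h := n3 1%N u n2 (lexx _); rewrite expr1 in h.
have := levy_cf_pow mZ levyZ u (leqnn n); rewrite divff ?pnatr_eq0 -?lt0n// => e1.
have <- : cf Q (fun w => Z 1 w - Z 0 w) u = cf Q (Z 1) u by exact: cf_levy_increment1.
rewrite -e1 cnormX exprn_gt0//.
have := cnorm_dist (levy_cf Q Z n u) 1 0; rewrite !subr0 cnorm1 cnormB; lra.
Unshelve. all: by end_near.
Qed.

(** With S the outer sum and rho the limiting modulus, the product bound reads rho - del <= (rho +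
    del) prod (1 - kappa T), and [prod_complement_le] bounds this product by 1 / (1 + kappa S).
    Hence 1 + kappa S <= (rho + del) / (rho - del). *)
Lemma out_small_of_cvg :
  (forall e : R, 0 < e -> \forall n \near \oo, cnorm (cf P (Sn a X n 1) 1 - cf Q (Z 1) A) <= e) ->
  forall eta : R, 0 < eta -> \forall n \near \oo, forall s, uniq s ->
  (forall j, j \in s -> outside n j) -> \sum_(j <- s) pr_gt1 P xi (dnj c n j / a n) <= eta.
Proof.
move=> Sn_cvg eta eta0.
have iY : independent2 P (Y 0) (Y 1).
  apply: (measurable_wrt_independent2 mY indY (s1 := [:: 0 : int]) (s2 := [:: 1 : int])) => //.
  - by apply: (measurable_wrt_comp (g := id)) => //; rewrite mem_head.
  - by apply: (measurable_wrt_comp (g := id)) => //; rewrite mem_head.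
have [kappa k0 [r' r'0 Hk]] := cnorm_cf_le_tail (mY 0) (mY 1) mxi iY (@lawY 0) (@lawY 1) alpha0 tail_gt0 tail_rv.
have rho0 := cf_levy_gt0 A; set rho := cnorm _ in rho0.
pose th := kappa * eta; have th0 : 0 < th by rewrite mulr_gt0.
(* Solves (rho - del)(1 + th) = rho + del, with th = kappa eta. *)
pose del := rho * th / (2 + th); have del0 : 0 < del by rewrite divr_gt0 ?mulr_gt0 ?addr_gt0.
have delE : del * (2 + th) = rho * th by rewrite divfK// gt_eqF// addr_gt0.
have H1 := Sn_cvg _ del0; have H2 := middle_prod_cvg del0.
near=> n => s us outs.
have h1 : cnorm (cf P (Sn a X n 1) 1 - cf Q (Z 1) A) <= del by near: n.
have h2 : cnorm (\prod_(1 <= k < n.+1) cf P xi (dnj c n k%:Z / a n) - cf Q (Z 1) A) <= del by near: n.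
have hr : `|M / a n| <= r' by near: n; exact: (div_norming_small).
have hd j : cnorm (cf P xi (dnj c n j / a n)) <= 1 - kappa * pr_gt1 P xi (dnj c n j / a n).
  by apply: Hk; apply: le_trans hr; rewrite !normrM ler_wpM2r// (ger0_norm M0) norm_dnj_le.
have x01 j : 0 <= kappa * pr_gt1 P xi (dnj c n j / a n) <= 1.
  rewrite mulr_ge0 ?pr_gt1_ge0 ?(ltW k0)//=; have := hd j; have := cnorm_ge0 (cf P xi (dnj c n j / a n)); lra.
have := cf_Sn_le_prod us outs; set p := cnorm _; set q := cnorm _; set F := \prod_(_ <- _) _ => hF.
have p1 : rho - del <= p.
  have := cnorm_dist (cf P (Sn a X n 1) 1) (cf Q (Z 1) A) 0; rewrite !subr0 -/rho -/p cnormB; lra.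
have q1 : q <= rho + del.
  have := cnorm_dist (cf Q (Z 1) A) (\prod_(1 <= k < n.+1) cf P xi (dnj c n k%:Z / a n)) 0.
  by rewrite !subr0 -/rho -/q; lra.
pose G := \prod_(j <- s) (1 - kappa * pr_gt1 P xi (dnj c n j / a n)).
have FG : F <= G by apply: ler_prod => j _; rewrite cnorm_ge0 hd.
have F0 : 0 <= F by apply: prodr_ge0 => j _; exact: cnorm_ge0.
have := prod_complement_le (s := s) (fun j _ => x01 j); rewrite -/G -mulr_sumr.
set S := \sum_(j <- s) _ => hG.
have S0 : 0 <= S by apply: sumr_ge0 => j _; exact: pr_gt1_ge0.
have w1 : rho - del <= (rho + del) * G.
  apply: le_trans p1 (le_trans hF _); rewrite ler_pM// cnorm_ge0//.
have w2 : (rho - del) * (1 + kappa * S) <= rho + del.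
  apply: (le_trans (y := (rho + del) * G * (1 + kappa * S))).
    by rewrite ler_wpM2r// addr_ge0// mulr_ge0// ltW.
  by rewrite -mulrA ler_piMr// ltW// addr_gt0.
have w3 : (rho - del) * (1 + th) = rho + del by move: delE; lra.
have w4 : 0 < rho - del.
  have : 0 < (rho - del) * (1 + th) by rewrite w3 addr_gt0.
  by rewrite pmulr_lgt0// addr_gt0.
have : 1 + kappa * S <= 1 + th by rewrite -(ler_pM2l w4) w3.
by rewrite lerD2l /th ler_pM2l.
Unshelve. all: by end_near.
Qed.

Hypothesis out_small : forall eta : R, 0 < eta -> \forall m \near \oo, forall s, uniq s ->
  (forall j, j \in s -> outside m j) -> \sum_(j <- s) pr_gt1 P xi (dnj c m j / a m) <= eta.

(** For t > 0 the index m = [n t] tends to infinity with n, so the outer sums are small at m with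
    scale a_m; [norming_le_double] and [pr_gt1_scale] carry this over to the scale e a_n / 2. For t
    = 0 all sums are empty. *)
Lemma Sn_approx (t e eta : R) : 0 <= t <= 1 -> 0 < e -> 0 < eta ->
  \forall n \near \oo, pr P [set w | e < `|Sn a X n t w - A * Sn a Y n t w|] <= eta.
Proof.
move=> /andP[t0 t1] e0 eta0; rewrite /Sn.
have [->|tn0] := eqVneq t 0.
  near=> n; rewrite mulr0 truncn0; rewrite (_ : [set _ | _] = set0) ?pr_set0 ?ltW//.
  by apply/seteqP; split => w //=; rewrite !big_nil !mulr0 subrr normr0 ltNge ltW.
have tp : 0 < t by rewrite lt_neqAle eq_sym tn0.
have e2 : 0 < e / 2 by rewrite divr_gt0.
have eta2 : 0 < eta / 2 by rewrite divr_gt0.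
have K1 : 0 < K + 1 by rewrite ltr_wpDl.
have Hr := remainder_bound e2 eta2.
have [N1 HN1] := norming_le_double.
(* Since a_m <= 2 a_n, the argument d / ((e / 2) a_n) is in modulus at most 2 (e / 2)^-1 times d /
   a_m. *)
have l0 : 0 < 2 * (e / 2)^-1 by rewrite mulr_gt0// invr_gt0.
have [Kl Kl0 [rl rl0 Hl]] := pr_gt1_scale tail_gt0 tail_rv l0.
have Kl1 : 0 < Kl + 1 by rewrite ltr_wpDl.
have [N2 _ HN2] := out_small (divr_gt0 (divr_gt0 eta2 K1) Kl1).
have [N3 _ HN3] := div_norming_small M rl0.
near=> n; set m := Num.truncn (n%:R * t).
have /andP[m1 m2] : m%:R <= n%:R * t < m.+1%:R by apply: truncn_itv; rewrite mulr_ge0.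
have mn : (m <= n)%N by rewrite -(ler_nat R) (le_trans m1)// ler_piMr.
have mN : (maxn N1 (maxn N2 N3) <= m)%N.
  rewrite -ltnS -(ltr_nat R); apply: lt_trans m2; rewrite -ltr_pdivrMr//.
  by near: n; exact: nbhs_infty_gtr.
move: mN; rewrite !geq_max => /and3P[mN1 mN2 mN3].
have anm := HN1 m n mN1 mn; have an := a_gt0 n; have am := a_gt0 m.
have H : forall (m : nat) (B : R), (m <= n)%N ->
  (forall s, uniq s -> (forall j, j \in s -> outside m j) ->
    \sum_(j <- s) pr_gt1 P xi (dnj c m j / (e / 2 * a n)) <= B) ->
  pr P [set w | e / 2 + e / 2 < `|(a n)^-1 * \sum_(1 <= i < m.+1) X i%:Z w -
                      A * ((a n)^-1 * \sum_(1 <= i < m.+1) Y i%:Z w)|] <= eta / 2 + K * B by near: n.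
have HB s : uniq s -> (forall j, j \in s -> outside m j) ->
    \sum_(j <- s) pr_gt1 P xi (dnj c m j / (e / 2 * a n)) <= eta / 2 / (K + 1).
  move=> us so; have /= h := HN2 m mN2 s us so.
  apply: (le_trans (y := Kl * \sum_(j <- s) pr_gt1 P xi (dnj c m j / a m))); last first.
    apply: le_trans (ler_wpM2l Kl0 h) _.
    rewrite mulrA ler_pdivrMr// mulrC ler_pM2l ?divr_gt0//.
    by rewrite lerDl.
  rewrite mulr_sumr; apply: ler_sum => j _; apply: le_trans (Hl _ _); last first.
    apply: le_trans (HN3 m mN3); rewrite !normrM ler_wpM2r//.
    by rewrite (ger0_norm M0) norm_dnj_le.
  apply: le_pr_gt1 => //; rewrite !normrM mulrCA ler_wpM2l//.
  have q : (a n)^-1 <= 2 / a m by rewrite ler_pdivlMr// mulrC ler_pdivrMr.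
  have -> : `|2| * `|(e / 2)^-1| * `|(a m)^-1| = (e / 2)^-1 * (2 / a m).
    by rewrite !gtr0_norm ?invr_gt0//; ring.
  by rewrite gtr0_norm ?invr_gt0 ?mulr_gt0// invfM ler_pM2l ?invr_gt0.
have := H m _ mn HB; rewrite -splitr => h.
apply: (le_trans h); rewrite [leRHS]splitr lerD2l.
by rewrite mulrA ler_pdivrMr// mulrC ler_pM2l// lerDl.
Unshelve. all: by end_near.
Qed.

Lemma Sn_cf (k : nat) (t u : 'I_k -> R) (e : R) : (forall i, 0 <= t i <= 1) -> 0 < e ->
  \forall n \near \oo, cnorm (cf P (fun w => \sum_i u i * Sn a X n (t i) w) 1 -
    cf Q (fun w => \sum_i u i * (A * Z (t i) w)) 1) <= e.
Proof.
move=> t01 e0; have e2 : 0 < e / 2 by rewrite divr_gt0.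
have h1 := normed_sums_levy (fun i => u i * A) t01 e2.
have mS n (V : int -> T -> R) : (forall i, measurable_fun setT (V i)) ->
  measurable_fun setT (fun w => \sum_i u i * Sn a V n (t i) w).
  by move=> mV; apply: measurable_sum => i; apply: measurable_funZ; exact: measurable_Sn.
have mSA n : measurable_fun setT (fun w => \sum_i u i * A * Sn a Y n (t i) w).
  by apply: measurable_sum => i; apply: measurable_funZ; exact: measurable_Sn.
have h2 : \forall n \near \oo, cnorm (cf P (fun w => \sum_i u i * Sn a X n (t i) w) 1 -
    cf P (fun w => \sum_i u i * A * Sn a Y n (t i) w) 1) <= e / 2.
  apply: cf_cvg_pr => //; first by move=> n; exact: mS.
  move=> e' eta' e'0 eta'0.
  have mD n i : measurable_fun setT (fun w => Sn a X n (t i) w - A * Sn a Y n (t i) w).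
    by apply: measurable_funB; [exact: measurable_Sn|apply: measurable_funZ; exact: measurable_Sn].
  have := pr_sum_small (P := P) (index_enum 'I_k) u (D := fun n i w => Sn a X n (t i) w - A * Sn a Y n (t i) w)
    mD (fun i e eta => @Sn_approx (t i) e eta (t01 i)) e'0 eta'0.
  apply: filterS => n; have E w : \sum_i u i * (Sn a X n (t i) w - A * Sn a Y n (t i) w) =
      \sum_i u i * Sn a X n (t i) w - \sum_i u i * A * Sn a Y n (t i) w.
    by rewrite -sumrB; apply: eq_bigr => i _; rewrite mulrBr [u i * (A * _)]mulrA.
  by under eq_set do rewrite E.
near=> n; under [X in cf Q X]eq_fun do under eq_bigr do rewrite mulrA.
apply: le_trans (cnorm_dist (cf P (fun w => \sum_i u i * A * Sn a Y n (t i) w) 1) _ _) _.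
by rewrite [leRHS]splitr lerD//; near: n.
Unshelve. all: by end_near.
Qed.

Lemma Sn_tight (k : nat) (t : 'I_k -> R) (eta : R) : (forall i, 0 <= t i <= 1) -> 0 < eta ->
  exists2 L : R, 0 < L &
  \forall n \near \oo, \sum_i pr P [set w | L < `|Sn a X n (t i) w|] <= eta.
Proof.
move=> t01 eta0; pose eta1 := eta / 2 / k.+1%:R.
have eta10 : 0 < eta1 by rewrite !divr_gt0.
have [L L0 HL] := normed_sums_tight eta10.
exists ((`|A| + 1) * L + 1); first by rewrite addr_gt0 ?mulr_gt0 ?ltr_wpDl.
have H : \forall n \near \oo, forall i, pr P [set w | 1 < `|Sn a X n (t i) w - A * Sn a Y n (t i) w|] <= eta1.
  by apply: filter_forall => i; exact: Sn_approx.
near=> n.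
have h1 : forall m : nat, (m <= n)%N ->
    pr P [set w | L < `|\sum_(0 <= i < m) (a n)^-1 * Y i.+1%:Z w|] <= eta1 by near: n.
have h2 : forall i, pr P [set w | 1 < `|Sn a X n (t i) w - A * Sn a Y n (t i) w|] <= eta1 by near: n.
apply: (le_trans (y := \sum_(i < k) (eta1 + eta1))); last first.
  rewrite sumr_const card_ord -mulr_natr -[leRHS]mulr1 /eta1.
  have -> : eta / 2 / k.+1%:R + eta / 2 / k.+1%:R = eta / k.+1%:R by rewrite -mulrDl -splitr.
  by rewrite -mulrA ler_pM2l// ler_pdivrMl// mulr1 ler_nat.
apply: ler_sum => i _.
have mn : (Num.truncn (n%:R * t i) <= n)%N.
  have /andP[ti0 ti1] := t01 i.
  have /andP[h _] := truncn_itv (mulr_ge0 (ler0n R n) ti0).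
  by rewrite -(ler_nat R) (le_trans h)// ler_piMr.
apply: le_trans (lerD (h1 _ mn) (h2 i)).
have E w : \sum_(0 <= j < Num.truncn (n%:R * t i)) (a n)^-1 * Y j.+1%:Z w = Sn a Y n (t i) w.
  by rewrite /Sn -mulr_sumr big_add1.
under [X in _ <= pr P X + _]eq_set do rewrite E.
apply: pr_le_setU.
- by apply: measurable_gt_abs; exact: measurable_Sn.
- by apply: measurable_gt_abs; exact: measurable_Sn.
- by apply: measurable_gt_abs; apply: measurable_funB; [exact: measurable_Sn|apply: measurable_funZ; exact: measurable_Sn].
move=> w /= hw; apply: contrapT => /not_orP[/negP + /negP]; rewrite -!leNgt => k1 k2.
move: hw; apply/negP; rewrite -leNgt.
rewrite -[Sn a X n (t i) w](subrK (A * Sn a Y n (t i) w)) (le_trans (ler_normD _ _))// addrC lerD//.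
by rewrite normrM ler_pM// lerDl.
Unshelve. all: by end_near.
Qed.

Lemma Sn_cvg_in_dist (k : nat) (t : 'I_k -> R) : (forall i, 0 <= t i <= 1) ->
  cvg_in_dist P Q (fun n w => \row_i Sn a X n (t i) w) (fun w => \row_i (A * Z (t i) w)).
Proof.
move=> t01; apply: continuity_theorem.
- by move=> n i; under eq_fun do rewrite mxE; exact: measurable_Sn.
- by move=> i; under eq_fun do rewrite mxE; exact: measurable_funZ.
- move=> u; apply/cvgr0Pnorm_le => e e0.
  have := Sn_cf (fun i => u ord0 i) t01 e0; apply: filterS => n.
  have E1 (x : 'I_k -> R) : dot u (\row_i x i) = \sum_i u ord0 i * x i.
    by apply: eq_bigr => i _; rewrite mxE.
  rewrite ger0_norm ?cnorm_ge0//.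
  under [X in cf P X]eq_fun do rewrite -E1.
  by under [X in cf Q X]eq_fun do rewrite -E1.
- move=> eta eta0; have [L L0 HL] := Sn_tight t01 eta0.
  have /choice[L' HL'] : forall i, exists L' : R, 0 < L' /\ pr Q [set w | L' < `|A * Z (t i) w|] <= eta / k.+1%:R.
    move=> i; have [L' L'0 HL'] := single_tight Q (measurable_funZ A (mZ (t i))) (divr_gt0 eta0 (ltr0Sn R k)).
    by exists L'.
  have sL : 0 <= \sum_i L' i by apply: sumr_ge0 => i _; have [/ltW] := HL' i.
  exists (L + \sum_i L' i); first by rewrite ltr_wpDr.
  split.
    near=> n; apply: (le_trans (y := \sum_i pr P [set w | L < `|Sn a X n (t i) w|])); last by near: n.
    apply: ler_sum => i _; under eq_set do rewrite mxE.
    apply: le_pr; do ?by apply: measurable_gt_abs; exact: measurable_Sn.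
    by move=> w /=; apply: le_lt_trans; rewrite lerDl.
  apply: (le_trans (y := \sum_(i < k) (eta / k.+1%:R))); last first.
    by rewrite sumr_const card_ord -[leLHS]mulr_natr mulrAC ler_pdivrMr// ler_pM2l// ler_nat.
  apply: ler_sum => i _; under eq_set do rewrite mxE.
  have [L'0 h] := HL' i; apply: le_trans h.
  apply: le_pr; do ?by apply: measurable_gt_abs; exact: measurable_funZ.
  move=> w /=; apply: le_lt_trans; rewrite (bigD1 i)//= addrCA lerDl; apply: addr_ge0; first exact: ltW.
  by apply: sumr_ge0 => j _; have [/ltW] := HL' j.
Unshelve. all: by end_near.
Qed.

End MovingAverage.

Theorem theorem1 (R : realType)
  (d : measure_display) (Omega : measurableType d) (P : probability Omega R)
  (Y : int -> {RV P >-> R}) (alpha : R) (h : R -> R) (p q : R)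
  (a : nat -> R) (C : R) (c : int -> R)
  (d' : measure_display) (Omega' : measurableType d') (Q : probability Omega' R)
  (Z : R -> {RV Q >-> R}) :
  (* usual conditions on {Y_j} *)
  iid P (fun j => (Y j : Omega -> R)) ->
  0 < alpha < 2 ->
  slowly_varying h ->
  (forall x : R, 0 < x ->
     P [set w | x < `|Y 1 w|] = (x `^ (- alpha) * h x)%:E) ->
  fine (P [set w | x < Y 1 w]) / fine (P [set w | x < `|Y 1 w|])
    @[x --> +oo] --> p ->
  fine (P [set w | Y 1 w < - x]) / fine (P [set w | x < `|Y 1 w|])
    @[x --> +oo] --> q ->
  p + q = 1 ->
  (1 < alpha -> ('E_P[Y 1%R] = 0)%E) ->
  (alpha = 1 -> forall B : set R, measurable B ->
     P [set w | Y 1 w \in B] = P [set w | - Y 1 w \in B]) ->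
  (* norming constants *)
  (forall n, 0 < a n) -> 0 < C ->
  n%:R * fine (P [set w | a n < `|Y 1 w|]) @[n --> \oo] --> C ->
  (* (Z(t))_{t>=0}: the alpha-stable Levy motion with Z(1) =d Z, where
     a_n^{-1} sum_{i=1}^n Y_i converges in distribution to Z *)
  levy_process Q (fun t => (Z t : Omega' -> R)) ->
  cvg_in_dist P Q (fun n w => (a n)^-1 * \sum_(1 <= i < n.+1) Y i%:Z w)
    (Z 1 : Omega' -> R) ->
  (* coefficients *)
  (\esum_(j in [set: int]) (`|c j|)%:E < +oo)%E ->
  (\esum_(j in [set: int]) (regvar_term alpha h (c j))%:E < +oo)%E ->
  (* conclusion *)
  ((forall (k : nat) (t : 'I_k -> R), (forall i, 0 <= t i <= 1) ->
      cvg_in_dist P Q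
        (fun n w => \row_i Sn a (linproc c (fun j => (Y j : Omega -> R))) n (t i) w)
        (fun w => \row_i (sumZ c * Z (t i) w)))
   <->
   ((fun n => \esum_(j in [set j : int | j <= 0])
                 (dterm alpha h (a n) (dnj c n j))%:E) @ \oo --> 0%E
    /\
    (fun n => \esum_(j in [set j : int | n.+1%:Z <= j])
                 (dterm alpha h (a n) (dnj c n j))%:E) @ \oo --> 0%E)).
Proof.
move=> [indY idY] alpha02 sv law _ _ _ EY symY a_gt0 C0 a_cvg levyZ sums_cvg c_fin Tc_fin.
have /andP[alpha0 _] := alpha02.
pose Yf j : Omega -> R := Y j; pose xi := Yf 1.
have mY i : measurable_fun setT (Yf i) by exact: measurable_funPT.
have mxi : measurable_fun setT xi by exact: mY.
have lawY i (B : set R) : measurable B -> P (Yf i @^-1` B) = P (xi @^-1` B).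
  by move=> mB; rewrite /xi /Yf idY// [RHS]idY.
have mZ t : measurable_fun setT (Z t : Omega' -> R) by exact: measurable_funPT.
have tail_gt0 := regvar_tail_gt0 mxi sv law.
have tail_rv := regvar_tail_ratio sv law.
have [K K0 [r r0 moments]] : exists2 K : R, 0 <= K & exists2 r : R, 0 < r & forall b, `|b| <= r ->
    Ex P (fun w => trunc 1 (b * xi w) ^+ 2) <= K * pr_gt1 P xi b /\
    `|Ex P (fun w => trunc 1 (b * xi w))| <= K * pr_gt1 P xi b.
  apply: (trunc_moments_bound mxi alpha02 tail_gt0 tail_rv).
  - move=> a1 x x0; apply: centered_trunc_mean => //.
    by have := EY a1; rewrite expectation_def.
  - by move=> a1 x; apply: symmetric_trunc_mean => // B mB; exact: symY.
have K1 : 0 <= 1 + 2 * K by rewrite addr_ge0// mulr_ge0.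
have pr_sum_bound (e : R) (s : seq int) (b : int -> R) : 0 < e -> uniq s ->
  (forall i, i \in s -> `|b i / e| <= r) ->
  pr P [set w | e < `|\sum_(i <- s) b i * Yf i w|] <= (1 + 2 * K) * \sum_(i <- s) pr_gt1 P xi (b i / e).
  exact: pr_sum_le_scaled.
have c_tail := esum_tail (fun j => normr_ge0 (c j)) c_fin.
have c_bound s : uniq s -> \sum_(j <- s) `|c j| <= fine (\esum_(j in [set: int]) (`|c j|)%:E).
  move=> us; rewrite -lee_fin fineK; first exact: sum_seq_le_esum.
  by rewrite ge0_fin_numE// esum_ge0.
have TE : (fun j => (regvar_term alpha h (c j))%:E) = (fun j => (pr_gt1 P xi (c j))%:E).
  by apply/funext => j; rewrite (regvar_termE law).
rewrite TE in Tc_fin.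
have Tc_tail := esum_tail (fun j => pr_gt1_ge0 P xi (c j)) Tc_fin.
pose f n j := pr_gt1 P xi (dnj c n j / a n).
have f0 n j : 0 <= f n j by exact: pr_gt1_ge0.
have dE n S : (\esum_(j in S) (dterm alpha h (a n) (dnj c n j))%:E = \esum_(j in S) (f n j)%:E)%E.
  by apply: eq_esum => j _; rewrite (dtermE law).
under [X in _ <-> X @ \oo --> _ /\ _]eq_fun do rewrite dE.
under [X in _ <-> _ /\ X @ \oo --> _]eq_fun do rewrite dE.
rewrite !esum_cvg0P//; split.
  move=> H.
  have Sn_cvg (e : R) : 0 < e -> \forall n \near \oo,
      cnorm (cf P (Sn a (linproc c Yf) n 1) 1 - cf Q (Z 1) (sumZ c)) <= e.
    (* A single time, t = 1, is enough for the converse; the coordinate map turns the row vector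
       into a real variable. *)
    move=> e0; have t01 (i : 'I_1) : 0 <= (1 : R) <= 1 by rewrite ler01 lexx.
    have H1 := H 1%N (fun=> 1) t01.
    pose g (x : 'rV[R]_1) : R := x ord0 ord0.
    have cg : continuous g by exact: coord_continuous.
    have mg : measurable_fun setT (g \o (fun w : Omega' => \row_(i < 1) (sumZ c * Z 1 w))).
      by rewrite /g /comp; under eq_fun do rewrite mxE; exact: measurable_funZ.
    have /cvgr0Pnorm_le /(_ e e0) := cvg_in_dist_cf 1 H1 cg mg.
    apply: filterS => n; rewrite ger0_norm ?cnorm_ge0//.
    rewrite /g /comp; under [X in cf P X]eq_fun do rewrite mxE.
    under [X in cf Q X]eq_fun do rewrite mxE.
    by rewrite cf_scale mulr1.
  have out := out_small_of_cvg mY mxi indY lawY alpha0 tail_gt0 tail_rv a_gt0 C0 a_cvg K1 r0 pr_sum_bound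
    mZ levyZ sums_cvg c_bound c_tail Tc_tail Sn_cvg.
  split => e e0; have := out e e0; apply: filterS => n h' s us sS; apply: h' => // j js.
    by rewrite /outside sS.
  by rewrite /outside sS// orbT.
move=> [H1 H2] k t t01.
apply: (Sn_cvg_in_dist mY mxi indY lawY alpha0 tail_gt0 tail_rv a_gt0 C0 a_cvg K1 r0 pr_sum_bound
  mZ levyZ sums_cvg c_bound c_tail Tc_tail) => // eta eta0.
have e2 : 0 < eta / 2 by rewrite divr_gt0.
near=> n => s us outs.
rewrite (bigID (fun j : int => j <= 0))/= [leRHS]splitr -[X in X + _]big_filter -[X in _ + X]big_filter.
apply: lerD.
  suff : forall s : seq int, uniq s -> (forall j, j \in s -> j <= 0) -> \sum_(j <- s) f n j <= eta / 2.
    by apply; [rewrite filter_uniq|move=> j; rewrite mem_filter => /andP[]].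
  by near: n; exact: H1.
suff : forall s : seq int, uniq s -> (forall j, j \in s -> n.+1%:Z <= j) -> \sum_(j <- s) f n j <= eta / 2.
  apply; [by rewrite filter_uniq|move=> j; rewrite mem_filter => /andP[j0 /outs]].
  by rewrite /outside (negbTE j0).
by near: n; exact: H2.
Unshelve. all: by end_near.
Qed.
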